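(* Let $\mathbf{A}:\mathbb{S}_d\to\mathbb{S}_d$ be a linear operator such that there is an $A\in M_d(\mathbb{R})$ with $\sigma(A)\subset(-\infty,0)+\mathrm{i}\mathbb{R}$ satisfying $\mathbf{A}X=AX+XA^{\mathrm{T}}$ for all $X\in\mathbb{S}_d$. Let $\mu$ be a probability distribution on $\mathbb{S}_d^+$ that is operator self-decomposable with respect to $\mathbf{A}$, with associated $\gamma_\mu\in\mathbb{S}_d^+$ and Lévy measure $\nu_\mu$ such that $$\hat\mu(Z)=\exp\Big(\mathrm{i}\,\mathrm{tr}(\gamma_\mu Z)+\int_{\mathbb{S}_d}(\mathrm{e}^{\mathrm{i}\,\mathrm{tr}(XZ)}-1)\,\nu_\mu(\mathrm{d}X)\Big),\qquad Z\in\mathbb{S}_d,$$ where $\nu_\mu(\mathbb{S}_d\setminus\mathbb{S}_d^+)=0$ and $\int_{\|X\|\le 1}\|X\|\,\nu_\mu(\mathrm{d}X)<\infty$. Let $\psi(Z)=\log\big(\int_{\mathbb{S}_d^+}\mathrm{e}^{\mathrm{i}\,\mathrm{tr}(xZ)}\,\mu(\mathrm{d}x)\big)$, $Z\in\mathbb{S}_d$, be its cumulant transform. Assume that $-A\gamma_\mu-\gamma_\mu A^{\mathrm{T}}\in\mathbb{S}_d^+$, that $\psi$ is differentiable at every $Z\neq 0$ with derivative $D\psi(Z)$, and that $$\psi_L:Z\mapsto\begin{cases}-D\psi(Z)(A^{\mathrm{T}}Z+ZA), & Z\in\mathbb{S}_d\setminus\{0\},\\ 0, & Z=0,\end{cases}$$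 is continuous at zero. Then $\hat\mu_L:Z\mapsto\exp(\psi_L(Z))$ is the characteristic function of an infinitely divisible distribution $\mu_L$ on $\mathbb{S}_d^+$. Let $L$ be a matrix subordinator with characteristic function $\hat\mu_L$ at time one. Then the positive semidefinite Ornstein–Uhlenbeck type process $\mathrm{d}\Sigma_t=\mathbf{A}\Sigma_t\,\mathrm{d}t+\mathrm{d}L_t$ driven by $L$ has stationary distribution $\mu$.
   Context: $M_d(\mathbb{R})$: real $d\times d$ matrices; $\mathbb{S}_d$: symmetric ones; $\mathbb{S}_d^+$: positive semidefinite ones. $\sigma(A)$ is the set of eigenvalues of $A$, $\mathrm{tr}$ the trace, $\|\cdot\|$ any norm. The characteristic function of a distribution $\mu$ on $\mathbb{S}_d$ is $\hat\mu(Z)=\int\mathrm{e}^{\mathrm{i}\,\mathrm{tr}(xZ)}\,\mu(\mathrm{d}x)$, $Z\in\mathbb{S}_d$. For an infinitely divisible $\mu$, $\hat\mu$ has no zeros and $\psi=\log\hat\mu$ is the continuous logarithm with $\psi(0)=0$ (i.e. the exponent in the displayed representation of $\hat\mu$). A probability distribution concentrated on $\mathbb{S}_d^+$ is infinitely divisible if and only if its characteristic function has the displayed representation. Operator self-decomposability: for a linear operator $Q:\mathbb{S}_d\to\mathbb{S}_d$, a probability distribution $\mu$ on $\mathbb{S}_d$ is operator self-decomposable with respect to $Q$ if for every $t\in[0,\infty)$ there is a probability distribution $\nu_t$ on $\mathbb{S}_d$ with $\mu=(\mathrm{e}^{Qt}\mu)\ast\nu_t$, where $\mathrm{e}^{Qt}\mu$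 is the image measure of $\mu$ under $\mathrm{e}^{Qt}$ and $\ast$ is convolution. Differentiability means total (Fréchet) differentiability; $D\psi(Z)$ is a (real-)linear map on $\mathbb{S}_d$, and $D\psi(Z)(H)$ is its value at $H\in\mathbb{S}_d$. A matrix subordinator is an $\mathbb{S}_d$-valued Lévy process $L$ with $L_t-L_s\in\mathbb{S}_d^+$ for all $t>s\ge0$. The Ornstein–Uhlenbeck type process started at $\Sigma_0$ is $\Sigma_t=\mathrm{e}^{At}\Sigma_0\mathrm{e}^{A^{\mathrm{T}}t}+\int_0^t\mathrm{e}^{A(t-s)}\,\mathrm{d}L_s\,\mathrm{e}^{A^{\mathrm{T}}(t-s)}$; it has stationary distribution $\mu$ if, when $\Sigma_0$ has law $\mu$ and is independent of $L$, the process $\Sigma$ is stationary with $\Sigma_t$ having law $\mu$ for all $t\ge0$. *)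

(* Defs.v *)
From HB Require Import structures.
From mathcomp Require Import all_boot all_order all_algebra.
From mathcomp Require Import complex.
From mathcomp Require Import all_classical all_reals all_analysis.

Set Implicit Arguments.
Unset Strict Implicit.
Unset Printing Implicit Defensive.

Import Order.TTheory GRing.Theory Num.Theory.
Import numFieldNormedType.Exports.

Local Open Scope classical_set_scope.
Local Open Scope ring_scope.
Local Open Scope complex_scope.

Section symmetric_matrices.
Context (R : realType) (d : nat).

Definition symmetric_pred : pred 'M[R]_d := fun X => X^T == X.

Lemma symmetric_pred_submod_closed : submod_closed symmetric_pred.
Proof.
split; first by rewrite unfold_in trmx0.
move=> a X Y; rewrite !unfold_in => /eqP XE /eqP YE.
by rewrite linearP /= XE YE.
Qed.

HB.instance Definition _ :=
  GRing.isSubmodClosed.Build R 'M[R]_d symmetric_pred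
    symmetric_pred_submod_closed.

Record symmx :=
  SymMx { symmx_val :> 'M[R]_d ; symmx_valP : symmetric_pred symmx_val }.

HB.instance Definition _ := [isSub for symmx_val].
HB.instance Definition _ := [Choice of symmx by <:].
HB.instance Definition _ := [SubChoice_isSubLmodule of symmx by <:].

(* Largest absolute value of an entry; all norms on this space are equivalent. *)
Definition symmx_norm (X : symmx) : R := `|symmx_val X|.

Lemma symmx_normD X Y : symmx_norm (X + Y) <= symmx_norm X + symmx_norm Y.
Proof. exact: ler_normD. Qed.

Lemma symmx_normZ (a : R) X : symmx_norm (a *: X) = `|a| * symmx_norm X.
Proof. by rewrite /symmx_norm -normrZ. Qed.

Lemma symmx_norm_eq0 X : symmx_norm X = 0 -> X = 0.
Proof. by move=> /normr0_eq0 X0; apply: val_inj; rewrite /= X0. Qed.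

HB.instance Definition _ :=
  Lmodule_isNormed.Build R symmx symmx_normD symmx_normZ symmx_norm_eq0.

HB.instance Definition _ := @isMeasurable.Build (sigma_display (@open symmx))
  symmx <<s (@open symmx) >> (@sigma_algebra0 _ setT (@open symmx))
  (@sigma_algebraC _ (@open symmx))
  (@sigma_algebra_bigcup _ setT (@open symmx)).

End symmetric_matrices.

Section matrices.
Context (R : realType) (d : nat).
Local Notation S := (symmx R d).

Definition psd_cone : set S :=
  [set X | forall v : 'cV[R]_d, 0 <= (v^T *m X *m v) 0 0].

Definition trform (X Z : S) : R := \tr (X *m Z).

Definition mexp (M : 'M[R]_d) : 'M[R]_d :=
  limn (series (fun n => n`!%:R^-1 *: M ^+ n)).

(* [opexp Q t] is the operator exponential of [t Q] on symmetric matrices. *)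
Definition opexp (Q : S -> S) (t : R) (X : S) : S :=
  limn (series (fun n => (t ^+ n / n`!%:R) *: iter n Q X)).

Lemma adj_lyapunov_subproof (A : 'M[R]_d) (Z : S) :
  symmetric_pred (A^T *m Z + Z *m A).
Proof.
rewrite /symmetric_pred linearD /= !trmx_mul trmxK.
by rewrite (eqP (symmx_valP Z)) addrC.
Qed.

Definition adj_lyapunov (A : 'M[R]_d) (Z : S) : S :=
  SymMx (adj_lyapunov_subproof A Z).

Lemma neg_lyapunov_subproof (A : 'M[R]_d) (X : S) :
  symmetric_pred (- (A *m X) - X *m A^T).
Proof.
rewrite /symmetric_pred linearB /= linearN /= !trmx_mul trmxK.
by rewrite (eqP (symmx_valP X)) addrC.
Qed.

Definition neg_lyapunov (A : 'M[R]_d) (X : S) : S :=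
  SymMx (neg_lyapunov_subproof A X).

End matrices.

Arguments psd_cone {R d}.

Section complex_valued.
Context (R : realType).

Definition cexp (z : R[i]) : R[i] :=
  (expR (complex.Re z) * cos (complex.Im z))
    +i* (expR (complex.Re z) * sin (complex.Im z)).

Definition cintegral (dT : measure_display) (T : measurableType dT)
    (m : {measure set T -> \bar R}) (f : T -> R[i]) : R[i] :=
  (\int[m]_x complex.Re (f x)) +i* (\int[m]_x complex.Im (f x)).

(* The complex plane as the real normed plane; topological and differential
   notions for complex-valued functions are taken through it. *)
Definition plane (z : R[i]) : (R^o * R^o)%type := (complex.Re z, complex.Im z).

Definition ccontinuous_at (V : normedModType R) (f : V -> R[i]) (Z : V) :=
  {for Z, continuous (plane \o f)}.

Definition cdifferentiable (V : normedModType R) (f : V -> R[i]) (Z : V) :=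
  differentiable (plane \o f) Z.

Definition cdiff (V : normedModType R) (f : V -> R[i]) (Z H : V) : R[i] :=
  let w := 'd (plane \o f) Z H in w.1 +i* w.2.

End complex_valued.

Section distributions.
Context (R : realType) (d : nat).
Local Notation S := (symmx R d).

Definition charfun (mu : {measure set S -> \bar R}) (Z : S) : R[i] :=
  cintegral mu (fun x => cexp (0 +i* trform x Z)).

(* The continuous logarithm of [charfun mu] vanishing at 0; it is unique
   because the space of symmetric matrices is connected. *)
Definition cumulant_transform (mu : {measure set S -> \bar R})
    (psi : S -> R[i]) :=
  [/\ forall Z, ccontinuous_at psi Z,
      psi 0 = 0
    & forall Z, cexp (psi Z) = charfun mu Z].

Definition levy_measure (nu : {measure set S -> \bar R}) :=
  nu [set 0] = 0%E /\
  (\int[nu]_X (Num.min 1 (`|X| ^+ 2))%:E < +oo)%E.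

Definition subordinator_exponent (g : S) (nu : {measure set S -> \bar R})
    (Z : S) : R[i] :=
  (0 +i* trform g Z)
    + cintegral nu (fun X => cexp (0 +i* trform X Z) - 1).

(* [convolution m1 m2] is a set function, so that it also applies to image
   measures and can be iterated without packing a measure. *)
Definition convolution (m1 : set S -> \bar R) (m2 : {measure set S -> \bar R})
    (B : set S) : \bar R :=
  (\int[m2]_y m1 [set x | B (x + y)%R])%E.

Fixpoint convolution_power (m : {measure set S -> \bar R}) (n : nat)
    : set S -> \bar R :=
  if n is n'.+1 then convolution (convolution_power m n') m
  else \d_(0 : S).

Definition infinitely_divisible (mu : probability S R) :=
  forall n : nat, (0 < n)%N -> exists rho : probability S R,
    forall B, measurable B -> mu B = convolution_power rho n B.

Definition operator_selfdecomposable (Q : S -> S) (mu : probability S R) :=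
  forall t : R, 0 <= t -> exists nu : probability S R,
    forall B, measurable B ->
      mu B = convolution (pushforward mu (opexp Q t)) nu B.

Definition psi_L (A : 'M[R]_d) (psi : S -> R[i]) (Z : S) : R[i] :=
  if Z == 0 then 0 else - cdiff psi Z (adj_lyapunov A Z).

End distributions.

Section stieltjes.
Context (R : realType) (V W : normedModType R).

(* [F s] is the linear map applied at time [s] to the increments of [X];
   [a :: s] lists the points of the partition and [xi] its tags. *)
Definition stieltjes_sum (F : R -> V -> W) (X : R -> V) (a : R) (s : seq R)
    (xi : nat -> R) : W :=
  \sum_(k < size s) F (xi k) (X s`_k - X (a :: s)`_k).

Definition is_stieltjes_integral (F : R -> V -> W) (X : R -> V) (a b : R)
    (I : W) :=
  forall eps : R, 0 < eps -> exists2 delta : R, 0 < delta &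
    forall (s : seq R) (xi : nat -> R),
      itv_partition a b s ->
      (forall k, (k < size s)%N ->
        (a :: s)`_k <= xi k <= s`_k /\ s`_k - (a :: s)`_k < delta) ->
      `|stieltjes_sum F X a s xi - I| < eps.

Definition stieltjes_integral (F : R -> V -> W) (X : R -> V) (a b : R) : W :=
  xget 0 [set I | is_stieltjes_integral F X a b I].

End stieltjes.

Section processes.
Context (R : realType) (d : nat) (dO : measure_display)
  (Omega : measurableType dO) (P : probability Omega R).
Local Notation S := (symmx R d).

(* Processes are indexed by [R]; only times [t >= 0] are ever used. *)
Implicit Types L Sigma : R -> {RV P >-> S}.

Definition independent_increments L :=
  forall (n : nat) (t : nat -> R) (B : nat -> set S),
    0 <= t 0%N -> (forall i, t i < t i.+1) -> (forall i, measurable (B i)) ->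
    P (\big[setI/setT]_(i < n) [set w | B i (L (t i.+1) w - L (t i) w)])
    = (\prod_(i < n) P [set w | B i (L (t i.+1) w - L (t i) w)%R])%E.

Definition stationary_increments L :=
  forall (s h : R) (B : set S), 0 <= s -> 0 <= h -> measurable B ->
    P [set w | B (L (s + h) w - L s w)] = P [set w | B (L h w - L 0 w)].

Definition stochastically_continuous L :=
  forall t eps : R, 0 <= t -> 0 < eps ->
    P [set w | eps < `|L s w - L t w|] @[s --> within `[0, +oo[ (nbhs t)]
      --> 0%E.

Definition cadlag (f : R -> S) :=
  forall t : R, 0 <= t ->
    (f s @[s --> t^'+] --> f t) /\ (0 < t -> cvg (f s @[s --> t^'-])).

Definition levy_process L :=
  [/\ {ae P, forall w, L 0 w = 0},
      independent_increments L,
      stationary_increments L,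
      stochastically_continuous L
    & {ae P, forall w, cadlag (fun t => L t w)}].

Definition matrix_subordinator L :=
  levy_process L /\
  forall s t : R, 0 <= s -> s < t ->
    {ae P, forall w, psd_cone (L t w - L s w)}.

Definition process_sigma_algebra L : set (set Omega) :=
  <<s \bigcup_(t in `[0, +oo[) preimage_set_system setT (L t) measurable >>.

Definition independent_of_process (X : {RV P >-> S}) L :=
  forall (B : set S) (E : set Omega),
    measurable B -> process_sigma_algebra L E ->
    P (X @^-1` B `&` E) = (P (X @^-1` B) * P E)%E.

Definition has_law (X : {RV P >-> S}) (mu : probability S R) :=
  forall B : set S, measurable B -> distribution P X B = mu B.

(* The paths of a matrix subordinator have locally finite variation and the
   integrand is continuous, so the stochastic integral is a pathwise
   Riemann-Stieltjes integral. *)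
Definition ou_value (A : 'M[R]_d) L (Sigma0 : {RV P >-> S}) (t : R)
    (w : Omega) : 'M[R]_d :=
  mexp (t *: A) *m Sigma0 w *m mexp (t *: A^T)
  + stieltjes_integral
      (fun s (H : S) => mexp ((t - s) *: A) *m H *m mexp ((t - s) *: A^T))
      (fun s => L s w) 0 t.

(* The stochastic integral is determined up to null sets, so an OU type
   process is any family of random variables given a.s. by the formula. *)
Definition ou_process (A : 'M[R]_d) L (Sigma0 : {RV P >-> S}) Sigma :=
  forall t : R, 0 <= t ->
    {ae P, forall w, Sigma t w = ou_value A L Sigma0 t w :> 'M[R]_d}.

Definition stationary_process Sigma :=
  forall (n : nat) (t : n.-tuple R) (h : R) (C : set (n.-tuple S)),
    (forall i, 0 <= tnth t i) -> 0 <= h -> measurable C ->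
    P [set w | C [tuple Sigma (tnth t i + h) w | i < n]]
    = P [set w | C [tuple Sigma (tnth t i) w | i < n]].

(* Existence of the process is part of the claim, so that the universal
   part cannot hold vacuously. *)
Definition ou_stationary_distribution (A : 'M[R]_d) L (mu : probability S R) :=
  forall Sigma0 : {RV P >-> S},
    has_law Sigma0 mu -> independent_of_process Sigma0 L ->
    (exists Sigma, ou_process A L Sigma0 Sigma) /\
    forall Sigma, ou_process A L Sigma0 Sigma ->
      stationary_process Sigma /\ forall t : R, 0 <= t -> has_law (Sigma t) mu.

End processes.

(* Main.v *)
Require Import Defs.
From HB Require Import structures.
From mathcomp Require Import all_boot all_order all_algebra.
From mathcomp Require Import complex.
From mathcomp Require Import all_classical all_reals all_analysis measurable_realfun.
From mathcomp Require Import ring lra.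

(** Let [E_t = e^(tA)], and let [Z_t = E_t^T Z E_t] be the dual flow, for which
    [tr (E_t X E_t^T Z) = tr (X Z_t)]. The chain rule gives
    [d/dt psi (Z_t) = - psi_L (Z_t)] (is_derive_psi_flow); both halves of the theorem
    rest on this identity.

    Law of the driving process. Operator self-decomposability says that
    [exp (psi Z - psi Z_t)] is the characteristic function of a distribution
    [N_t]. Its powers of order [n] with [t = s / n] have exponents that converge
    to [s psi_L Z], and as [psi_L] is continuous at zero, Levy's continuity theorem
    (levy_continuity) provides distributions with exponents [s psi_L] for all
    [s > 0] (driving_law); those with [s = 1 / n] are convolution roots of the
    one with [s = 1]. That they live on the cone reduces to the same property
    of [N_t] (selfdecomposable_factor). Now [mu] translated by [- gamma] is
    a limit of compound Poisson laws with jumps in the cone, hence is carried by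
    the cone, and it charges every neighbourhood of the origin because the
    exponent of its Laplace transform at [s] is [o(s)] (compound_limit). If [X]
    has law [mu] and [y] has law [N_t], independently, then [E_t X E_t^T + y] has
    law [mu] and lies in [gamma + cone]; letting [X] approach [gamma] shows that
    [y - (gamma - E_t gamma E_t^T)] is in the cone, and so is
    [gamma - E_t gamma E_t^T], which increases with [t] by the assumption on the
    drift (psd_drift).

    Stationary process. The paths of a matrix subordinator are almost surely
    right-continuous and increasing in the cone (subordinator_paths), so quadratic
    forms of the path are monotone and, by polarization, the Riemann-Stieltjes
    integral exists (cone_stieltjes_integral). The characteristic function of [L_s]
    is [exp (s psi_L)] (levy_charfunE): for [s = 1 / n] both sides have the same
    [n]-th power, and a continuous root of unity is constant; general times
    follow by additivity and right-continuity. For [u <= t] the variable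
    [tr (Sigma_t V)] is [tr (Sigma_u V_(t-u))] plus a limit of sums of increments
    of [L] on [[u, t]], and passing from [u] to [t] multiplies the mean of
    [exp (i .)] by [exp (psi V - psi V_(t-u))] (splits_step). The Riemann sums of
    [psi_L] on the dual flow that appear need not converge, since [psi_L] is only
    known to be a derivative along it, but the mean value theorem provides tags
    that make their real parts exact and others that make their imaginary parts
    exact; the two choices give the modulus and the argument of the limit
    (polar_limit). Iterating over finitely many times from the latest to the
    first, the joint characteristic function of the states depends only on the
    differences of the times (state_phase_splits), and at one time it is that of
    [mu] (splits_one).

    Two general facts carry the argument. Distributions with the same
    characteristic function agree (eq_charfun_eq_measure), because indicators of
    boxes are iterated limits of trigonometric polynomials. Tight sequences have
    limits along ultrafilters (prokhorov): the probabilities of the binary digits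
    of the entries converge, and the limiting digits are realised on the unit
    interval. *)

Set Implicit Arguments.
Unset Strict Implicit.
Unset Printing Implicit Defensive.

Import Order.TTheory GRing.Theory Num.Theory.
Import numFieldNormedType.Exports.

Local Open Scope classical_set_scope.
Local Open Scope ring_scope.
Local Open Scope complex_scope.

(** * Expectations of bounded measurable functions *)

(** Bounded measurable functions are integrable for every probability, so the
    algebra of their means needs no integrability side conditions. *)
Definition bmeas (R : realType) (dT : measure_display) (T : measurableType dT)
    (f : T -> R) :=
  measurable_fun [set: T] f /\ exists K, forall x, `|f x| <= K.

Section expectation.
Context (R : realType) (dT : measure_display) (T : measurableType dT).
Implicit Types (f g : T -> R).

Lemma bmeas_cst (c : R) : bmeas (fun _ : T => c).
Proof. by split; [exact: measurable_cst | exists `|c|]. Qed.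

Lemma bmeasD f g : bmeas f -> bmeas g -> bmeas (fun x => f x + g x).
Proof.
move=> [mf [K fK]] [mg [L gL]]; split; first exact: measurable_funD.
by exists (K + L) => x; rewrite (le_trans (ler_normD _ _))// lerD.
Qed.

Lemma bmeasM f g : bmeas f -> bmeas g -> bmeas (fun x => f x * g x).
Proof.
move=> [mf [K fK]] [mg [L gL]]; split; first exact: measurable_funM.
by exists (K * L) => x; rewrite normrM ler_pM.
Qed.

Lemma bmeasZ (c : R) f : bmeas f -> bmeas (fun x => c * f x).
Proof. by move=> bf; apply: bmeasM => //; exact: bmeas_cst. Qed.

Lemma bmeasN f : bmeas f -> bmeas (fun x => - f x).
Proof.
move=> [mf [K fK]]; split; last by exists K => x; rewrite normrN.
exact: measurableT_comp.
Qed.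

Lemma bmeasB f g : bmeas f -> bmeas g -> bmeas (fun x => f x - g x).
Proof. by move=> bf bg; apply: bmeasD => //; exact: bmeasN. Qed.

Lemma bmeasX f n : bmeas f -> bmeas (fun x => f x ^+ n).
Proof.
move=> bf; elim: n => [|n IH]; first exact: (bmeas_cst 1).
by under eq_fun do rewrite exprS; exact: bmeasM.
Qed.

Lemma bmeas_sum (I : Type) (s : seq I) (F : I -> T -> R) :
  (forall i, bmeas (F i)) -> bmeas (fun x => \sum_(i <- s) F i x).
Proof.
move=> bF; elim: s => [|i s IH].
  by under eq_fun do rewrite big_nil; exact: bmeas_cst.
by under eq_fun do rewrite big_cons; exact: bmeasD.
Qed.

Lemma bmeas_cos f : measurable_fun setT f -> bmeas (fun x => cos (f x)).
Proof.
move=> mf; split; last by exists 1 => x; rewrite ler_norml cos_geN1 cos_le1.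
apply: measurableT_comp => //; apply: continuous_measurable_fun.
exact: continuous_cos.
Qed.

Lemma bmeas_sin f : measurable_fun setT f -> bmeas (fun x => sin (f x)).
Proof.
move=> mf; split; last by exists 1 => x; rewrite ler_norml sin_geN1 sin_le1.
apply: measurableT_comp => //; apply: continuous_measurable_fun.
exact: continuous_sin.
Qed.

Lemma bmeas_indic (A : set T) : measurable A -> bmeas (\1_A : T -> R).
Proof.
move=> mA; split; first exact: measurable_indic.
by exists 1 => x; rewrite indicE; case: (x \in A); rewrite ?normr1 ?normr0.
Qed.

Lemma bmeas_comp (dU : measure_display) (U : measurableType dU) (h : U -> R)
  (X : T -> U) : measurable_fun setT X -> bmeas h -> bmeas (fun x => h (X x)).
Proof.
by move=> mX [mh [K hK]]; split; [exact: measurableT_comp|exists K => x].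
Qed.

Variable P : probability T R.

Lemma bmeas_integrable f : bmeas f -> P.-integrable setT (EFin \o f).
Proof.
move=> [mf [K fK]]; apply: measurable_bounded_integrable => //.
  by rewrite (le_lt_trans (probability_le1 _ _))// ltry.
exists K; split; first exact: num_real.
by move=> M KM x _; exact: le_trans (fK x) (ltW KM).
Qed.

Lemma expD f g : bmeas f -> bmeas g ->
  \int[P]_x (f x + g x) = \int[P]_x f x + \int[P]_x g x.
Proof. by move=> bf bg; rewrite RintegralD//; exact: bmeas_integrable. Qed.

Lemma expB f g : bmeas f -> bmeas g ->
  \int[P]_x (f x - g x) = \int[P]_x f x - \int[P]_x g x.
Proof. by move=> bf bg; rewrite RintegralB//; exact: bmeas_integrable. Qed.

Lemma expZ (c : R) f : bmeas f -> \int[P]_x (c * f x) = c * \int[P]_x f x.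
Proof. by move=> bf; rewrite RintegralZl//; exact: bmeas_integrable. Qed.

Lemma exp_cst (c : R) : \int[P]_x c = c.
Proof. rewrite (Rintegral_cst P measurableT) -[RHS]mulr1; congr (_ * _).
exact: (congr1 fine (probability_setT P)). Qed.

Lemma exp_sum (I : Type) (s : seq I) (F : I -> T -> R) :
  (forall i, bmeas (F i)) ->
  \int[P]_x (\sum_(i <- s) F i x) = \sum_(i <- s) \int[P]_x F i x.
Proof.
move=> bF; elim: s => [|i s IH].
  rewrite big_nil; under eq_Rintegral do rewrite big_nil.
  exact: exp_cst.
rewrite big_cons; under eq_Rintegral do rewrite big_cons.
by rewrite expD ?IH//; exact: bmeas_sum.
Qed.

Lemma le_exp f g : bmeas f -> bmeas g -> (forall x, f x <= g x) ->
  \int[P]_x f x <= \int[P]_x g x.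
Proof. by move=> bf bg fg; apply: le_Rintegral => //; exact: bmeas_integrable. Qed.

Lemma exp_ge0 f : (forall x, 0 <= f x) -> 0 <= \int[P]_x f x.
Proof. by move=> f0; apply: Rintegral_ge0. Qed.

Lemma exp_normr f (K : R) : bmeas f -> (forall x, `|f x| <= K) ->
  `|\int[P]_x f x| <= K.
Proof.
move=> bf fK; rewrite ler_norml -[X in _ && (_ <= X)]exp_cst.
rewrite -[X in X <= _]exp_cst.
have fK' x : - K <= f x <= K by rewrite -ler_norml.
by apply/andP; split; apply: le_exp => //; try exact: bmeas_cst;
  move=> x; case/andP: (fK' x).
Qed.

Lemma exp_normrB f g (K : R) : bmeas f -> bmeas g ->
  (forall x, `|f x - g x| <= K) -> `|\int[P]_x f x - \int[P]_x g x| <= K.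
Proof.
by move=> bf bg fgK; rewrite -expB//; apply: exp_normr => //; exact: bmeasB.
Qed.

Lemma exp_indic A : measurable A -> \int[P]_x (\1_A x) = fine (P A).
Proof.
move=> mA; rewrite /Rintegral; congr fine.
by under eq_integral do rewrite -/((EFin \o \1_A) _);
  rewrite integral_indic// setIT.
Qed.

(** Dominated convergence; the constant [K] is integrable because [P] is finite. *)
Lemma exp_cvg (fn : nat -> T -> R) f (K : R) :
  (forall n, measurable_fun setT (fn n)) -> measurable_fun setT f ->
  (forall n x, `|fn n x| <= K) ->
  (forall x, fn n x @[n --> \oo] --> f x) ->
  \int[P]_x fn n x @[n --> \oo] --> \int[P]_x f x.
Proof.
move=> mfn mf fnK fnf.
have [] := @dominated_convergence _ _ _ P setT measurableT
  (fun n => EFin \o fn n) (EFin \o f) (cst K%:E).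
- by move=> n; exact/measurable_EFinP.
- exact/measurable_EFinP.
- by apply: aeW => x _; apply: cvg_comp (fnf x) _; exact: cvg_refl.
- exact: (bmeas_integrable (bmeas_cst K)).
- by apply: aeW => x n _; rewrite /= lee_fin.
move=> intf _ cvgI; rewrite /Rintegral.
apply: fine_cvg; rewrite fineK; last exact: integrable_fin_num.
exact: cvgI.
Qed.

Lemma ae_eq_exp f g : measurable_fun setT f -> measurable_fun setT g ->
  {ae P, forall x, f x = g x} -> \int[P]_x f x = \int[P]_x g x.
Proof.
move=> mf mg fg; rewrite /Rintegral; congr fine.
apply: ae_eq_integral => //; [exact/measurable_EFinP..|].
by apply: filterS fg => x /= ->.
Qed.

Lemma exp_ae_cst f (c : R) : measurable_fun setT f ->
  {ae P, forall x, f x = c} -> \int[P]_x f x = c.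
Proof. by move=> mf fc; rewrite (@ae_eq_exp f (cst c))// exp_cst. Qed.

Lemma probability1_ae (A : set T) : measurable A -> P A = 1%E ->
  {ae P, forall x, A x}.
Proof.
move=> mA PA; exists (~` A); split => //; first exact: measurableC.
by rewrite probability_setC// PA subee.
Qed.

Lemma ae_probability1 (A : set T) : measurable A ->
  {ae P, forall x, A x} -> P A = 1%E.
Proof.
move=> mA [N [mN N0 AN]].
have : P (~` A) = 0%E.
  by apply/eqP; rewrite eq_le measure_ge0 andbT -N0 le_measure// inE//;
    exact: measurableC.
rewrite probability_setC// => /eqP; rewrite sube_eq ?add0e//.
by move=> /eqP.
Qed.

Lemma exp0_ae f : bmeas f -> (forall x, 0 <= f x) -> \int[P]_x f x = 0 ->
  {ae P, forall x, f x = 0}.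
Proof.
move=> bf f0 If0; have [mf _] := bf.
have : (\int[P]_x `|(EFin \o f) x|)%E = 0%E.
  rewrite -[RHS]/(0%:E) -If0 /Rintegral fineK.
    by apply: eq_integral => x _; rewrite /= ger0_norm.
  exact: (integrable_fin_num measurableT (bmeas_integrable bf)).
move/(ae_eq_integral_abs P measurableT) => H.
have : ae_eq P setT (EFin \o f) (cst 0%E) by apply/H; exact/measurable_EFinP.
by apply: filterS => x /= /(_ I) [].
Qed.

End expectation.

Section expectation_image.
Context (R : realType) (d1 d2 : measure_display)
  (T : measurableType d1) (U : measurableType d2).

Lemma exp_pushforward (P : probability T R) (Q : {measure set U -> \bar R})
    (X : T -> U) (f : U -> R) :
  measurable_fun setT X -> bmeas f ->
  (forall B, measurable B -> Q B = P (X @^-1` B)) ->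
  \int[Q]_y f y = \int[P]_x f (X x).
Proof.
move=> mX bf QP; rewrite /Rintegral; congr fine; have [mf _] := bf.
rewrite (@eq_measure_integral _ _ _ _ (pushforward P X)).
  rewrite integral_pushforward ?preimage_setT//.
  - exact/measurable_EFinP.
  - exact: (bmeas_integrable P (bmeas_comp mX bf)).
by move=> A mA _; rewrite QP.
Qed.

End expectation_image.

(** * The Borel structure of symmetric matrices *)

(** That the [f i] generate the sigma-algebra of [T], in terms of maps into [T],
    which is how it is used. *)
Definition coordinates (R : realType) (dT : measure_display)
    (T : measurableType dT) (I : finType) (f : I -> T -> R) :=
  (forall i, measurable_fun setT (f i)) /\
  forall (dU : measure_display) (U : measurableType dU) (h : U -> T),
    (forall i, measurable_fun setT (f i \o h)) -> measurable_fun setT h.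

Lemma cvg_sum_seq (R : numFieldType) (V : normedModType R) (T I : Type)
    (F : set_system T) {FF : Filter F} (s : seq I) (f : I -> T -> V)
    (l : I -> V) : (forall i, f i t @[t --> F] --> l i) ->
  (\sum_(i <- s) f i t) @[t --> F] --> \sum_(i <- s) l i.
Proof.
move=> fl; elim: s => [|i s IH].
  by under eq_fun do rewrite big_nil; rewrite big_nil; exact: cvg_cst.
by under eq_fun do rewrite big_cons; rewrite big_cons; exact: cvgD.
Qed.

Section borel_symmx.
Context (R : realType) (d : nat).
Local Notation S := (symmx R d).

Lemma symmx_normE (X : S) :
  `|X| = \big[Order.max/0]_(ij : 'I_d * 'I_d) `|X ij.1 ij.2|.
Proof. exact: mx_normrE. Qed.

Lemma symmx_entry_le (X : S) i j : `|X i j| <= `|X|.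
Proof.
rewrite symmx_normE.
exact: (le_bigmax _ (fun ij : 'I_d * 'I_d => `|X ij.1 ij.2|) (i, j)).
Qed.

Lemma symmx_norm_lt (X : S) (e : R) :
  0 < e -> (forall i j, `|X i j| < e) -> `|X| < e.
Proof.
move=> e0 Xe; rewrite symmx_normE.
by apply/bigmax_ltP; split=> // -[i j] _; exact: Xe.
Qed.

Lemma symmx_norm_le (X : S) (e : R) :
  0 <= e -> (forall i j, `|X i j| <= e) -> `|X| <= e.
Proof.
move=> e0 Xe; rewrite symmx_normE.
by apply/bigmax_leP; split=> // -[i j] _; exact: Xe.
Qed.

Lemma symmxP (X Y : S) : (forall i j, X i j = Y i j) -> X = Y.
Proof. by move=> XY; apply: val_inj; apply/matrixP. Qed.

Lemma symmxC (X : S) i j : X i j = X j i.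
Proof. by have /eqP/matrixP/(_ j i) := symmx_valP X; rewrite mxE. Qed.

Lemma symmxD (X Y : S) i j : (X + Y) i j = X i j + Y i j.
Proof. by rewrite /= mxE. Qed.

Lemma symmxN (X : S) i j : (- X) i j = - X i j.
Proof. by rewrite /= mxE. Qed.

Lemma symmxZ (a : R) (X : S) i j : (a *: X) i j = a * X i j.
Proof. by rewrite /= mxE. Qed.

Lemma entry_continuous i j : continuous (fun X : S => X i j).
Proof.
move=> X B /nbhs_ballP[e /= e0 eB]; apply/nbhs_ballP; exists e => // Y.
rewrite -ball_normE /= => XY; apply: eB; rewrite -ball_normE /=.
by rewrite -symmxN -symmxD (le_lt_trans (symmx_entry_le _ _ _)).
Qed.

Lemma open_symmx_measurable (U : set S) : open U -> measurable U.
Proof. exact: sub_sigma_algebra. Qed.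

Lemma continuous_symmx_measurable (f : S -> R) :
  continuous f -> measurable_fun setT f.
Proof.
move=> cf; apply: (measurability _ (RGenOInfty.measurableE R)) => //.
move=> _ [_ [a ->] <-]; rewrite setTI; apply: open_symmx_measurable.
by move/continuousP : cf; apply; exact: interval_open.
Qed.

(** Every open set is a countable union of boxes with rational centres and
    rational radii, and preimages of boxes only involve entries. *)
Lemma measurable_symmx (dU : measure_display) (U : measurableType dU)
    (h : U -> S) :
  (forall i j, measurable_fun setT (fun u => h u i j)) -> measurable_fun setT h.
Proof.
move=> mh; apply: (@measurability _ _ _ _ _ _ (@open S)) => //.
move=> _ [V oV <-]; rewrite setTI.
pose box (qr : {ffun 'I_d * 'I_d -> rat} * rat) : set S :=
  [set X | 0 < ratr qr.2 :> R /\ forall i j, `|X i j - ratr (qr.1 (i, j))| < ratr qr.2].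
have -> : h @^-1` V = \bigcup_(qr in [set qr | box qr `<=` V]) (h @^-1` box qr).
  apply/seteqP; split => [u /= Vu|u [qr /= bV hu]]; last exact: bV.
  have := oV; rewrite openE => /(_ _ Vu) /nbhs_ballP[e /= e0 eV].
  have [r] := rat_in_itvoo (divr_gt0 e0 (ltr0n R 2)).
  rewrite in_itv/= => /andP[r0 re].
  have H (ij : 'I_d * 'I_d) : {q : rat | `|h u ij.1 ij.2 - ratr q| < ratr r}.
    apply: cid.
    have [|q] := @rat_in_itvoo R (h u ij.1 ij.2 - ratr r) (h u ij.1 ij.2 + ratr r).
      by rewrite ltrBlDr -addrA ltrDl addr_gt0.
    by rewrite in_itv/= => /andP[q1 q2]; exists q; rewrite ltr_norml; lra.
  pose q : {ffun 'I_d * 'I_d -> rat} := [ffun ij => sval (H ij)].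
  have qE i j : `|h u i j - ratr (q (i, j))| < ratr r.
    by rewrite ffunE; exact: (svalP (H (i, j))).
  exists (q, r) => //= X [_ XB]; apply: eV.
  rewrite -ball_normE/=; apply: symmx_norm_lt => // i j.
  rewrite symmxD symmxN.
  have := XB i j; have := qE i j => /=.
  rewrite !ltr_norml; lra.
have mb qr : measurable (h @^-1` box qr).
  have -> : h @^-1` box qr = [set u | 0 < ratr qr.2 :> R] `&`
     \bigcap_(ij in [set: 'I_d * 'I_d])
       ((fun u => h u ij.1 ij.2) @^-1` (ball (ratr (qr.1 ij) : R) (ratr qr.2 : R))).
    apply/seteqP; split => u /= [r0 H]; split => //.
      by move=> [i j] _ /=; rewrite -ball_normE/= distrC; exact: H.
    by move=> i j; have /= := H (i, j) I; rewrite -ball_normE/= distrC.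
  apply: measurableI.
    rewrite (_ : [set _ | _] = if 0 < ratr qr.2 :> R then setT else set0).
      by case: ifP.
    by case: (0 < ratr qr.2 :> R); apply/seteqP; split.
  apply: fin_bigcap_measurable => // ij _.
  rewrite -[X in measurable X]setTI; apply: (mh ij.1 ij.2) => //.
  exact: measurable_ball.
rewrite bigcup_mkcond; apply: countable_bigcupT_measurable => // qr.
by case: ifP.
Qed.

Lemma coordinates_symmx :
  coordinates (fun (ij : 'I_d * 'I_d) (X : S) => X ij.1 ij.2).
Proof.
split=> [ij|dU U h mh].
  by apply: continuous_symmx_measurable; exact: entry_continuous.
by apply: measurable_symmx => i j; exact: (mh (i, j)).
Qed.

Lemma measurable_entry i j : measurable_fun setT (fun X : S => X i j).
Proof. exact: (coordinates_symmx.1 (i, j)). Qed.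

(** Joint laws of finitely many matrices are thus determined by their
    characteristic functions, like laws of one matrix. *)
Lemma coordinates_tuple_symmx n :
  coordinates (fun (k : 'I_n * ('I_d * 'I_d)) (t : n.-tuple S) =>
    tnth t k.1 k.2.1 k.2.2).
Proof.
split=> [k|dU U h mh].
  apply: (measurableT_comp (measurable_entry k.2.1 k.2.2)).
  exact: measurable_tnth.
apply/measurable_fun_tnthP => i; apply: measurable_symmx => a b.
exact: (mh (i, (a, b))).
Qed.

Lemma measurable_symmxD (dU : measure_display) (U : measurableType dU)
    (f g : U -> S) : measurable_fun setT f -> measurable_fun setT g ->
  measurable_fun setT (fun u => f u + g u).
Proof.
move=> mf mg; apply: measurable_symmx => i j.
under eq_fun do rewrite symmxD.
by apply: measurable_funD; exact: (measurableT_comp (measurable_entry i j)).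
Qed.

Lemma measurable_symmxN (dU : measure_display) (U : measurableType dU)
    (f : U -> S) : measurable_fun setT f -> measurable_fun setT (fun u => - f u).
Proof.
move=> mf; apply: measurable_symmx => i j.
under eq_fun do rewrite symmxN.
by apply: measurable_funN; exact: (measurableT_comp (measurable_entry i j)).
Qed.

Lemma measurable_symmxB (dU : measure_display) (U : measurableType dU)
    (f g : U -> S) : measurable_fun setT f -> measurable_fun setT g ->
  measurable_fun setT (fun u => f u - g u).
Proof.
by move=> mf mg; apply: measurable_symmxD => //; exact: measurable_symmxN.
Qed.

Lemma measurable_symmx_norm : measurable_fun setT (fun X : S => `|X|).
Proof. by apply: continuous_symmx_measurable => X; exact: norm_continuous. Qed.

Lemma trformE (X Z : S) : trform X Z = \sum_i \sum_j X i j * Z i j.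
Proof.
apply: eq_bigr => i _; rewrite mxE; apply: eq_bigr => j _.
by rewrite -(symmxC Z).
Qed.

Lemma trformDl (X Y Z : S) : trform (X + Y) Z = trform X Z + trform Y Z.
Proof. by rewrite /trform /= mulmxDl mxtraceD. Qed.

Lemma trformDr (X Y Z : S) : trform X (Y + Z) = trform X Y + trform X Z.
Proof. by rewrite /trform /= mulmxDr mxtraceD. Qed.

Lemma trformNl (X Z : S) : trform (- X) Z = - trform X Z.
Proof. by rewrite /trform /= mulNmx linearN. Qed.

Lemma trformBl (X Y Z : S) : trform (X - Y) Z = trform X Z - trform Y Z.
Proof. by rewrite trformDl trformNl. Qed.

Lemma trformZr (a : R) (X Z : S) : trform X (a *: Z) = a * trform X Z.
Proof. by rewrite /trform /= -scalemxAr mxtraceZ. Qed.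

Lemma trform0l (Z : S) : trform 0 Z = 0.
Proof. by rewrite /trform /= mul0mx mxtrace0. Qed.

Lemma trform0r (X : S) : trform X 0 = 0.
Proof. by rewrite /trform /= mulmx0 mxtrace0. Qed.

Lemma trform_le (X Z : S) : `|trform X Z| <= (d%:R ^+ 2 * `|Z|) * `|X|.
Proof.
rewrite trformE; apply: (le_trans (ler_norm_sum _ _ _)).
have -> : d%:R ^+ 2 * `|Z| * `|X| = \sum_(i < d) \sum_(j < d) (`|Z| * `|X|).
  under eq_bigr do rewrite sumr_const card_ord.
  by rewrite sumr_const card_ord -[RHS]mulr_natl -[X in _ = _ * X]mulr_natl; ring.
apply: ler_sum => i _; apply: (le_trans (ler_norm_sum _ _ _)).
apply: ler_sum => j _; rewrite normrM mulrC.
by apply: ler_pM => //; exact: symmx_entry_le.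
Qed.

Lemma measurable_trform (dU : measure_display) (U : measurableType dU)
    (f : U -> S) Z : measurable_fun setT f ->
  measurable_fun setT (fun u => trform (f u) Z).
Proof.
move=> mf; under eq_fun do rewrite trformE.
apply: measurable_sum => i; apply: measurable_sum => j.
apply: measurable_funM => //.
exact: (measurableT_comp (measurable_entry i j)).
Qed.

(** Reading only the upper triangle gives a symmetric matrix for every [M], so
    that the entries of a random matrix can be built one at a time. *)
Definition symmetrize (M : 'I_d -> 'I_d -> R) : S :=
  insubd 0 (\matrix_(i, j) M (Order.min i j) (Order.max i j)).

Lemma symmetrizeE M i j : symmetrize M i j = M (Order.min i j) (Order.max i j).
Proof.
rewrite /symmetrize val_insubd ifT ?mxE//.
by apply/eqP/matrixP => a b; rewrite !mxE minC maxC.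
Qed.

Lemma symmetrize_id (X : S) : symmetrize X = X.
Proof.
apply: symmxP => i j; rewrite symmetrizeE.
by case: (leP i j) => // _; exact: symmxC.
Qed.

Definition quadform (v : 'cV[R]_d) (X : 'M[R]_d) : R := (v^T *m X *m v) 0 0.

Lemma quadformE v X : quadform v X = \sum_i \sum_j v i 0 * X i j * v j 0.
Proof.
rewrite /quadform mxE exchange_big; apply: eq_bigr => j _.
by rewrite mxE mulr_suml; apply: eq_bigr => i _; rewrite mxE.
Qed.

Lemma quadformD v X Y : quadform v (X + Y) = quadform v X + quadform v Y.
Proof. by rewrite /quadform mulmxDr mulmxDl mxE. Qed.

Lemma quadformN v X : quadform v (- X) = - quadform v X.
Proof. by rewrite /quadform mulmxN mulNmx mxE. Qed.

Lemma quadform_le v (X : S) :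
  `|quadform v X| <= (\sum_i \sum_j `|v i 0| * `|v j 0|) * `|X|.
Proof.
rewrite quadformE; apply: (le_trans (ler_norm_sum _ _ _)).
rewrite mulr_suml; apply: ler_sum => i _.
rewrite mulr_suml; apply: (le_trans (ler_norm_sum _ _ _)).
apply: ler_sum => j _; rewrite !normrM mulrAC.
by apply: ler_wpM2l; rewrite ?mulr_ge0// symmx_entry_le.
Qed.

Lemma measurable_quadform (dU : measure_display) (U : measurableType dU)
    (f : U -> S) v : measurable_fun setT f ->
  measurable_fun setT (fun u => quadform v (f u)).
Proof.
move=> mf; under eq_fun do rewrite quadformE.
apply: measurable_sum => i; apply: measurable_sum => j.
apply: measurable_funM => //; apply: measurable_funM => //.
exact: (measurableT_comp (measurable_entry i j)).
Qed.

Lemma quadform_continuous (X : S) :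
  continuous (fun v : 'cV[R]_d => quadform v X).
Proof.
under eq_fun do rewrite quadformE.
move=> v.
apply: (@cvg_sum_seq R R^o _ _ (nbhs v) _ _
  (fun i w => \sum_j w i 0 * X i j * w j 0)
  (fun i => \sum_j v i 0 * X i j * v j 0)) => i.
apply: (@cvg_sum_seq R R^o _ _ (nbhs v) _ _
  (fun j w => w i 0 * X i j * w j 0) (fun j => v i 0 * X i j * v j 0)) => j.
apply: cvgM; last exact: coord_continuous.
by apply: cvgM; [exact: coord_continuous|exact: cvg_cst].
Qed.

(** The quadratic form is continuous in [v]; countably many conditions make the
    cone measurable. *)
Lemma psd_cone_rat (X : S) :
  (forall v : 'cV[rat]_d, 0 <= quadform (map_mx ratr v) X) -> psd_cone X.
Proof.
move=> Xv v; rewrite -/(quadform v X) leNgt; apply/negP => q0.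
pose q (w : 'cV[R]_d) : R := quadform w X.
have cq : {for v, continuous q} by exact: quadform_continuous.
have : nbhs v [set w | q w < 0].
  by apply: (cq [set y | y < 0]); exact: lt_nbhsl.
move=> /nbhs_ballP[e /= e0 eq0].
have H i : {r : rat | `|v i 0 - ratr r| < e}.
  apply: cid.
  have [|r] := @rat_in_itvoo R (v i 0 - e) (v i 0 + e).
    by rewrite ltrBlDr -addrA ltrDl addr_gt0.
  by rewrite in_itv/= => /andP[r1 r2]; exists r; rewrite ltr_norml; lra.
have := Xv (\col_i sval (H i)); rewrite leNgt => /negP; apply.
apply: eq0; split => // i j.
by rewrite !mxE (ord1 j) -ball_normE; exact: (svalP (H i)).
Qed.

Lemma measurable_psd_cone : measurable (psd_cone : set S).
Proof.
have -> : (psd_cone : set S) = \bigcap_(v in [set: 'cV[rat]_d])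
    [set X : S | `[0, +oo[%classic (quadform (map_mx ratr v) X)].
  apply/seteqP; split => [X Xp v _ /=|X Xv].
    by rewrite in_itv/= andbT; exact: Xp.
  by apply: psd_cone_rat => v; have := Xv v I; rewrite /= in_itv/= andbT.
rewrite -[X in measurable X]setCK setC_bigcap; apply: measurableC.
apply: countable_bigcupT_measurable => // v; apply: measurableC.
rewrite -[X in measurable X]setTI.
by apply: (measurable_quadform (map_mx ratr v) (@measurable_id _ S setT)).
Qed.

Lemma psd_coneD (X Y : S) : psd_cone X -> psd_cone Y -> psd_cone (X + Y).
Proof.
by move=> Xp Yp v; rewrite -/(quadform v _) quadformD addr_ge0 ?Xp ?Yp.
Qed.

Lemma psd_cone0 : psd_cone (0 : S).
Proof. by move=> v; rewrite /= mulmx0 mul0mx mxE. Qed.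

End borel_symmx.

(** * Characteristic functions determine distributions *)

(** Iterates converge to a step function with jump at the fixed point 1/2, so
    half-lines are limits of polynomials in sines. *)
Definition sigmoid (R : realType) (u : R) : R := u ^+ 2 * (3 - 2 * u).

Section sigmoid.
Context (R : realType).
Implicit Types u : R.

Lemma sigmoid01 u : 0 <= u <= 1 -> 0 <= sigmoid u <= 1.
Proof.
move=> /andP[u0 u1]; rewrite /sigmoid; apply/andP; split.
  by rewrite mulr_ge0 ?sqr_ge0//; lra.
have -> : u ^+ 2 * (3 - 2 * u) = 1 - (1 - u) ^+ 2 * (1 + 2 * u) by ring.
by rewrite gerBl mulr_ge0 ?sqr_ge0//; lra.
Qed.

Lemma iter_sigmoid01 n u : 0 <= u <= 1 -> 0 <= iter n (@sigmoid R) u <= 1.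
Proof. by move=> u01; elim: n => //= n; exact: sigmoid01. Qed.

Lemma sigmoidC u : sigmoid (1 - u) = 1 - sigmoid u.
Proof. rewrite /sigmoid; ring. Qed.

Lemma cvg_iter_sigmoid_lt u : 0 <= u < 2^-1 ->
  iter n (@sigmoid R) u @[n --> \oo] --> (0 : R).
Proof.
move=> /andP[u0 u2]; pose r := u * (3 - 2 * u).
have r0 : 0 <= r by rewrite mulr_ge0//; lra.
have r1 : r < 1.
  have : 0 < (1 - 2 * u) * (1 - u) by apply: mulr_gt0; lra.
  rewrite /r; lra.
have H n : 0 <= iter n (@sigmoid R) u <= u /\ iter n (@sigmoid R) u <= r ^+ n.
  elim: n => [|n [/andP[s0 su] sr]] /=; first by rewrite u0 lexx expr0; split=> //; lra.
  set s := iter n _ u in s0 su sr *.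
  have sle : sigmoid s <= r * s.
    rewrite /sigmoid /r; have -> : s ^+ 2 * (3 - 2 * s) = (s * (3 - 2 * s)) * s by ring.
    apply: ler_wpM2r => //.
    have : 0 <= (u - s) * (3 - 2 * (u + s)) by apply: mulr_ge0; lra.
    lra.
  have /andP[sg0 _] : 0 <= sigmoid s <= 1 by apply: sigmoid01; lra.
  split.
    rewrite sg0 /= (le_trans sle)// (le_trans _ su)//.
    by rewrite ler_piMl// ltW.
  by rewrite exprS (le_trans sle)// ler_wpM2l.
apply: (@squeeze_cvgr _ _ _ _ (fun _ => 0) (fun n => r ^+ n)).
- by apply: nearW => n; have [/andP[-> _] ->] := H n.
- exact: cvg_cst.
- by apply: cvg_expr; rewrite ger0_norm.
Qed.

Lemma cvg_iter_sigmoid (y : R) : -1 <= y <= 1 ->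
  iter n (@sigmoid R) ((1 + y) / 2) @[n --> \oo] --> (1 + Num.sg y) / 2.
Proof.
move=> y1; case: (ltgtP y 0) => [y0|y0|->].
- rewrite ltr0_sg//.
  rewrite (_ : (1 - 1) / 2 = 0 :> R); last by rewrite subrr mul0r.
  by apply: cvg_iter_sigmoid_lt; lra.
- rewrite gtr0_sg//.
  rewrite (_ : (1 + 1) / 2 = 1 - 0 :> R); last by lra.
  have H n : iter n (@sigmoid R) ((1 + y) / 2) =
      1 - iter n (@sigmoid R) ((1 - y) / 2).
    elim: n => [|n IH] /=; first by lra.
    by rewrite IH sigmoidC.
  under eq_fun do rewrite H.
  apply: cvgB; first exact: cvg_cst.
  by apply: cvg_iter_sigmoid_lt; lra.
- rewrite sgr0 addr0.
  have H n : iter n (@sigmoid R) (1 / 2) = 1 / 2.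
    by elim: n => //= n ->; rewrite /sigmoid; lra.
  by under eq_fun do rewrite H; exact: cvg_cst.
Qed.

(** Letting the frequency tend to zero removes the periodicity of the square wave. *)
Lemma cvg_sg_sin (y : R) :
  Num.sg (sin (y / n.+1%:R)) @[n --> \oo] --> Num.sg y.
Proof.
wlog y0 : y / 0 <= y => [H|].
  have [/H//|/ltW y0] := leP 0 y.
  have /H : 0 <= - y by rewrite oppr_ge0.
  move=> /cvgN; rewrite sgrN opprK; apply: cvg_trans.
  have -> : (fun n => Num.sg (sin (y / n.+1%:R))) =
      - (fun n : nat => Num.sg (sin (- y / n.+1%:R))).
    by apply/funext => n; rewrite !fctE mulNr sinN sgrN opprK.
  exact: cvg_refl.
move: y0; rewrite le_eqVlt => /orP[/eqP <-|y0].
  by under eq_fun do rewrite mul0r sin0; exact: cvg_cst.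
apply: cvg_near_cst.
have : y / n.+1%:R @[n --> \oo] --> (0 : R).
  by rewrite -[X in _ --> X](mulr0 y); apply: cvgMr; exact: cvg_harmonic.
move=> /cvgr_lt /(_ _ (pi_gt0 R)); apply: filterS => n ypi.
by rewrite (gtr0_sg y0) gtr0_sg// sin_gt0_pi// divr_gt0.
Qed.

(** The value at the jump becomes that of the closed half-line. *)
Lemma cvg_sg_shift (y : R) :
  Num.sg (y - n.+1%:R^-1) @[n --> \oo] --> (if y <= 0 then -1 else 1 : R).
Proof.
apply: cvg_near_cst; case: (leP y 0) => y0.
  apply: nearW => n; rewrite ltr0_sg//.
  by rewrite subr_lt0 (le_lt_trans y0)// invr_gt0.
have := @cvg_harmonic R => /cvgr_lt /(_ _ y0); apply: filterS => n ny.
by rewrite gtr0_sg// subr_gt0.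
Qed.

End sigmoid.

Section uniqueness.
Context (R : realType) (dT : measure_display) (T : measurableType dT).
Context (I : finType) (f : I -> T -> R).
Hypothesis cf : coordinates f.
Context (P Q : probability T R).

Let lin (th : I -> R) (x : T) : R := \sum_i th i * f i x.

Let mlin th : measurable_fun setT (lin th).
Proof.
apply: measurable_sum => i; apply: measurable_funM => //.
exact: (cf.1 i).
Qed.

Hypothesis PQcos : forall th,
  \int[P]_x cos (lin th x) = \int[Q]_x cos (lin th x).
Hypothesis PQsin : forall th,
  \int[P]_x sin (lin th x) = \int[Q]_x sin (lin th x).

(** Functions whose product with every character has the same mean under both
    measures; they absorb trigonometric factors, hence by approximation
    indicators of boxes. *)
Let good (g : T -> R) := bmeas g /\ forall th,
  \int[P]_x (g x * cos (lin th x)) = \int[Q]_x (g x * cos (lin th x)) /\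
  \int[P]_x (g x * sin (lin th x)) = \int[Q]_x (g x * sin (lin th x)).

Let bcos th : bmeas (fun x => cos (lin th x)).
Proof. exact: bmeas_cos. Qed.

Let bsin th : bmeas (fun x => sin (lin th x)).
Proof. exact: bmeas_sin. Qed.

Let eq2 (F G : T -> R) : F =1 G ->
  \int[P]_x G x = \int[Q]_x G x -> \int[P]_x F x = \int[Q]_x F x.
Proof. by move=> /funext ->. Qed.

Let good1 : good (fun _ => 1).
Proof.
split; first exact: bmeas_cst.
move=> th; split; [apply: (eq2 (G := fun x => cos (lin th x))) => // x|
  apply: (eq2 (G := fun x => sin (lin th x))) => // x]; exact: mul1r.
Qed.

Let goodD g h : good g -> good h -> good (fun x => g x + h x).
Proof.
move=> [bg Hg] [bh Hh]; split; first exact: bmeasD.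
move=> th; have [g1 g2] := Hg th; have [h1 h2] := Hh th.
split; [apply: (eq2 (fun x => mulrDl (g x) (h x) (cos (lin th x))))|
        apply: (eq2 (fun x => mulrDl (g x) (h x) (sin (lin th x))))];
  by rewrite !expD ?g1 ?g2 ?h1 ?h2//; exact: bmeasM.
Qed.

Let goodZ (c : R) g : good g -> good (fun x => c * g x).
Proof.
move=> [bg Hg]; split; first exact: bmeasZ.
move=> th; have [g1 g2] := Hg th.
split; [apply: (eq2 (fun x => esym (mulrA c (g x) (cos (lin th x)))))|
        apply: (eq2 (fun x => esym (mulrA c (g x) (sin (lin th x)))))];
  by rewrite !expZ ?g1 ?g2//; exact: bmeasM.
Qed.

Let linD th1 th2 x : lin (fun i => th1 i + th2 i) x = lin th1 x + lin th2 x.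
Proof. by rewrite /lin -big_split; apply: eq_bigr => i _; rewrite mulrDl. Qed.

Let linB th1 th2 x : lin (fun i => th1 i - th2 i) x = lin th1 x - lin th2 x.
Proof. by rewrite /lin -sumrB; apply: eq_bigr => i _; rewrite mulrBl. Qed.

Let eq_half (mu : probability T R) (F G H : T -> R) (c : R) :
  bmeas G -> bmeas H -> (forall x, F x = 2^-1 * (G x + c * H x)) ->
  \int[mu]_x F x = 2^-1 * (\int[mu]_x G x + c * \int[mu]_x H x).
Proof.
move=> bG bH FE; under eq_Rintegral do rewrite FE.
rewrite expZ; last by apply: bmeasD => //; exact: bmeasZ.
by rewrite expD ?expZ//; exact: bmeasZ.
Qed.

Let half_sum (g G H K : T -> R) (c : R) : bmeas g -> bmeas G -> bmeas H ->
  (forall x, K x = 2^-1 * (G x + c * H x)) ->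
  \int[P]_x (g x * G x) = \int[Q]_x (g x * G x) ->
  \int[P]_x (g x * H x) = \int[Q]_x (g x * H x) ->
  \int[P]_x (g x * K x) = \int[Q]_x (g x * K x).
Proof.
move=> bg bG bH KE EG EH.
have KE' x : g x * K x = 2^-1 * (g x * G x + c * (g x * H x)).
  by rewrite KE; ring.
by rewrite !(eq_half _ (bmeasM bg bG) (bmeasM bg bH) KE') EG EH.
Qed.

(** Multipliers form an algebra closed under bounded pointwise limits. *)
Let mult (v : T -> R) := bmeas v /\ forall g, good g -> good (fun x => g x * v x).

(** Products of characters are characters. *)
Let mult_cos th : mult (fun x => cos (lin th x)).
Proof.
split=> // g [bg Hg]; split; first exact: bmeasM.
move=> th'; split; apply: (eq2 (fun x => esym (mulrA (g x) _ _))).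
- apply: (@half_sum g (fun x => cos (lin (fun i => th i + th' i) x))
    (fun x => cos (lin (fun i => th i - th' i) x)) _ 1) => //.
  + by move=> x; rewrite linD linB cosD cosB; lra.
  + exact: (Hg _).1.
  + exact: (Hg _).1.
- apply: (@half_sum g (fun x => sin (lin (fun i => th i + th' i) x))
    (fun x => sin (lin (fun i => th i - th' i) x)) _ (-1)) => //.
  + by move=> x; rewrite linD linB sinD sinB; lra.
  + exact: (Hg _).2.
  + exact: (Hg _).2.
Qed.

Let mult_sin th : mult (fun x => sin (lin th x)).
Proof.
split=> // g [bg Hg]; split; first exact: bmeasM.
move=> th'; split; apply: (eq2 (fun x => esym (mulrA (g x) _ _))).
- apply: (@half_sum g (fun x => sin (lin (fun i => th i + th' i) x))
    (fun x => sin (lin (fun i => th i - th' i) x)) _ 1) => //.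
  + by move=> x; rewrite linD linB sinD sinB; lra.
  + exact: (Hg _).2.
  + exact: (Hg _).2.
- apply: (@half_sum g (fun x => cos (lin (fun i => th i - th' i) x))
    (fun x => cos (lin (fun i => th i + th' i) x)) _ (-1)) => //.
  + by move=> x; rewrite linB linD cosB cosD; lra.
  + exact: (Hg _).1.
  + exact: (Hg _).1.
Qed.

Let mult_cst (c : R) : mult (fun _ => c).
Proof.
split=> [|g gg]; first exact: bmeas_cst.
by under eq_fun do rewrite mulrC; exact: goodZ.
Qed.

Let multD v w : mult v -> mult w -> mult (fun x => v x + w x).
Proof.
move=> [bv mv] [bw mw]; split=> [|g gg]; first exact: bmeasD.
by under eq_fun do rewrite mulrDr; apply: goodD; [exact: mv|exact: mw].
Qed.

Let multM v w : mult v -> mult w -> mult (fun x => v x * w x).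
Proof.
move=> [bv mv] [bw mw]; split=> [|g gg]; first exact: bmeasM.
by under eq_fun do rewrite mulrA; apply/mw/mv.
Qed.

Let mult_lim (vn : nat -> T -> R) v (K : R) : (forall n, mult (vn n)) ->
  (forall n x, `|vn n x| <= K) ->
  (forall x, vn n x @[n --> \oo] --> v x) -> mult v.
Proof.
move=> mvn vnK vnv.
have mv : measurable_fun setT v.
  apply: (@measurable_fun_cvg _ _ _ setT vn) => //.
  by move=> n; have [[]] := mvn n.
have vK x : `|v x| <= K.
  have : `|vn n x| @[n --> \oo] --> `|v x| by apply: cvg_norm; exact: vnv.
  by move=> /ler_cvg_to; apply; [exact: (@cvg_cst _ K)|apply: nearW => n].
have bv : bmeas v by split => //; exists K.
split=> // g gg; have [bg Hg] := gg; split; first exact: bmeasM.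
have [mg [L gL]] := bg.
have key (h : T -> R) : bmeas h -> (forall x, `|h x| <= 1) ->
   (forall n, \int[P]_x (g x * vn n x * h x) = \int[Q]_x (g x * vn n x * h x)) ->
   \int[P]_x (g x * v x * h x) = \int[Q]_x (g x * v x * h x).
  move=> [mh bh] h1 E.
  have C (mu : probability T R) : \int[mu]_x (g x * vn n x * h x) @[n --> \oo] -->
      \int[mu]_x (g x * v x * h x).
    apply: (@exp_cvg _ _ _ _ _ _ (L * K)) => //.
    + move=> n; apply: measurable_funM => //; apply: measurable_funM => //.
      by have [[]] := mvn n.
    + by apply: measurable_funM => //; apply: measurable_funM.
    + move=> n x; rewrite !normrM -[leRHS]mulr1; apply: ler_pM => //.
      by apply: ler_pM.
    + by move=> x; apply: cvgM; [apply: cvgM; [exact: cvg_cst|]|exact: cvg_cst].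
  have CP := C P; have CQ := C Q.
  by move: CP; rewrite (funext E) => CP; exact: (cvg_unique _ CP CQ).
move=> th; split; apply: key => //.
- by move=> x; rewrite ler_norml cos_geN1 cos_le1.
- by move=> n; have [_ /(_ g gg)[_ /(_ th)[]]] := mvn n.
- by move=> x; rewrite ler_norml sin_geN1 sin_le1.
- by move=> n; have [_ /(_ g gg)[_ /(_ th)[]]] := mvn n.
Qed.

Let mult_sin_shift i (c b : R) : mult (fun x => sin (c * (f i x - b))).
Proof.
pose th j : R := if j == i then c else 0.
have linE x : lin th x = c * f i x.
  rewrite /lin (bigD1 i)//= /th eqxx big1 ?addr0// => j /negbTE ->.
  by rewrite mul0r.
rewrite (_ : (fun x => _) = (fun x => sin (lin th x) * cos (c * b) +
    (- sin (c * b)) * cos (lin th x))); last first.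
  by apply/funext => x; rewrite linE mulrBr sinB; ring.
by apply: multD; apply: multM.
Qed.

Let mult_sigmoid v : mult v -> mult (fun x => sigmoid (v x)).
Proof.
move=> mv; rewrite /sigmoid.
rewrite (_ : (fun x => _) = (fun x => v x * v x * (3 + (-2) * v x))); last first.
  by apply/funext => x; ring.
by apply: multM; [exact: multM|apply: multD => //; exact: multM].
Qed.

(** A square wave, as the limit of iterated sigmoids of a sine. *)
Let mult_sg_sin i (c b : R) : mult (fun x => Num.sg (sin (c * (f i x - b)))).
Proof.
rewrite (_ : (fun x => _) = (fun x => 2 *
   ((1 + Num.sg (sin (c * (f i x - b)))) / 2) + (-1))); last first.
  by apply/funext => x; lra.
apply: multD => //; apply: multM => //.
apply: (@mult_lim (fun n x => iter n (@sigmoid R) ((1 + sin (c * (f i x - b))) / 2)) _ 1).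
- elim => [|n IH] /=; last exact: mult_sigmoid.
  by apply: multM => //; exact: multD.
- move=> n x; have := @iter_sigmoid01 R n ((1 + sin (c * (f i x - b))) / 2).
  have := sin_geN1 (c * (f i x - b)); have := sin_le1 (c * (f i x - b)).
  move=> s1 s2 /(_ _)/andP[|t0 t1]; first by lra.
  by rewrite ger0_norm.
- by move=> x; apply: cvg_iter_sigmoid; rewrite sin_geN1 sin_le1.
Qed.

Let sg_le1 (y : R) : `|Num.sg y| <= 1.
Proof. by rewrite normr_sg; case: (_ != 0). Qed.

Let mult_sg i (b : R) : mult (fun x => Num.sg (f i x - b)).
Proof.
apply: (@mult_lim (fun n x => Num.sg (sin (n.+1%:R^-1 * (f i x - b)))) _ 1) => //.
by move=> x; under eq_fun do rewrite mulrC; exact: cvg_sg_sin.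
Qed.

Let mult_le i (b : R) : mult (fun x => (f i x <= b)%R%:R).
Proof.
rewrite (_ : (fun x => _) = (fun x => 2^-1 +
   (- 2^-1) * (if f i x - b <= 0 then -1 else 1))); last first.
  by apply/funext => x; rewrite subr_le0; case: ifP => _ /=; lra.
apply: multD => //; apply: multM => //.
apply: (@mult_lim (fun n x => Num.sg (f i x - (b + n.+1%:R^-1))) _ 1) => //.
by move=> x; under eq_fun do rewrite opprD addrA; exact: cvg_sg_shift.
Qed.

Let box (b : I -> R) : set T := [set x | forall i, f i x <= b i].

Let boxE b x : \1_(box b) x = \prod_i (f i x <= b i)%R%:R :> R.
Proof.
rewrite indicE; have [H|H] := pselect (box b x).
  by rewrite mem_set// big1// => i _; rewrite (H i).
rewrite memNset//; have /existsNP[i Hi] := H.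
by rewrite (bigD1 i)//= (negbTE (introN idP Hi)) mul0r.
Qed.

Let measurable_box b : measurable (box b).
Proof.
have -> : box b = \bigcap_(i in [set: I]) (f i @^-1` `]-oo, b i]).
  apply/seteqP; split => [x xb i _ /=|x xb i].
    by rewrite in_itv/=; exact: xb.
  by have := xb i Logic.I; rewrite /= in_itv.
apply: fin_bigcap_measurable => // i _.
by rewrite -[X in measurable X]setTI; exact: (cf.1 i).
Qed.

Let box_eq b : P (box b) = Q (box b).
Proof.
have : mult (fun x => \prod_i (f i x <= b i)%R%:R).
  elim: (index_enum I) => [|i s IH].
    by under eq_fun do rewrite big_nil.
  by under eq_fun do rewrite big_cons; exact: multM.
move=> [bm /(_ _ good1)[_ /(_ (fun=> 0))[+ _]]].
have E x : 1 * \prod_i (f i x <= b i)%R%:R * cos (lin (fun=> 0) x) = \1_(box b) x.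
  have -> : lin (fun=> 0) x = 0 by rewrite /lin big1// => i _; rewrite mul0r.
  by rewrite cos0 mulr1 mul1r boxE.
rewrite (_ : (fun x => _) = (\1_(box b) : T -> R)); last exact/funext.
rewrite !exp_indic// => PQ.
rewrite -[LHS]fineK ?fin_num_measure// -[RHS]fineK ?fin_num_measure//.
by rewrite PQ.
Qed.

(** Indicators of boxes are multipliers (mult_le), so both measures agree on
    boxes, which form a pi-system generating the sigma-algebra. This avoids
    Fourier inversion. *)
Lemma eq_charfun_eq_measure A : measurable A -> P A = Q A.
Proof.
pose G := [set B | exists b, B = box b].
have boxT : \bigcup_k box (fun=> k%:R) = [set: T].
  rewrite -subTset => x _.
  have [n xn] : exists n : nat, forall i, f i x <= n%:R.
    exists (Num.bound (\sum_i `|f i x|)) => i.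
    apply/ltW/(le_lt_trans _ (archi_boundP _)); last exact: sumr_ge0.
    rewrite (bigD1 i)//= (le_trans (ler_norm _))// lerDl.
    exact: sumr_ge0.
  by exists n.
have GI b i : (<<s G >>) (f i @^-1` `]-oo, b]).
  have -> : f i @^-1` `]-oo, b] =
      \bigcup_k box (fun j => if j == i then b else k%:R).
    apply/seteqP; split => [x /=|x [k _ /(_ i)] /=].
      rewrite in_itv/= => xb.
      have : (\bigcup_k box (fun=> k%:R)) x by rewrite boxT.
      by move=> [k _ xk]; exists k => // j; case: eqP => [->|].
    by rewrite eqxx in_itv.
  apply: sigma_algebra_bigcup => k; apply: sub_sigma_algebra.
  by exists (fun j => if j == i then b else k%:R).
apply: (@measure_unique _ R T G (fun k => box (fun=> k%:R))) => //.
- apply/seteqP; split.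
    move=> B mB; have := cf.2 _ (g_sigma_algebraType G) id.
    move=> /(_ _ measurableT B mB); rewrite setTI; apply => i.
    apply: (measurability _ (RGenOInfty.measurableE R)) => //.
    move=> _ [_ [a ->] <-]; rewrite setTI.
    rewrite -[X in measurable X]setCK; apply: measurableC.
    have -> : ~` ((f i \o id) @^-1` `]a, +oo[) = f i @^-1` `]-oo, a].
      by apply/seteqP; split => x /=; rewrite !in_itv/= andbT;
        [move/negP; rewrite -leNgt|move=> ?; apply/negP; rewrite -leNgt].
    exact: GI.
  apply: smallest_sub; first exact: sigma_algebra_measurable.
  by move=> _ [b ->].
- move=> _ _ [b ->] [c ->]; exists (fun i => Order.min (b i) (c i)).
  apply/seteqP; split => [x [xb xc] i|x xbc].
    by rewrite le_min xb xc.
  by split => i; have := xbc i; rewrite le_min => /andP[].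
- by move=> k; exists (fun=> k%:R).
- by move=> _ [b ->]; exact: box_eq.
- by move=> k; rewrite (le_lt_trans (probability_le1 _ _))// ltry.
Qed.

End uniqueness.

(** * Limits of tight sequences of distributions along an ultrafilter *)

Lemma law_exists (R : realType) (d1 d2 : measure_display)
    (T : measurableType d1) (V : measurableType d2) (P : probability T R)
    (X : T -> V) : measurable_fun setT X ->
  exists Q : probability V R, forall B, Q B = P (X @^-1` B).
Proof.
move=> mX; pose Y : {mfun T >-> V} := HB.pack X (isMeasurableFun.Build _ _ _ _ X mX).
by exists (distribution P Y).
Qed.

Section ultralimit.
Context (R : realType) (U : set_system nat) {UU : UltraFilter U}.

(** Along an ultrafilter bounded sequences converge, which replaces the
    extraction of subsequences. *)
Lemma ultralimit_exists (u : nat -> R) (K : R) : (forall n, `|u n| <= K) ->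
  exists l : R, u @ U --> l.
Proof.
move=> uK.
have FU : UltraFilter (u @ U).
  split; first exact: fmap_proper_filter.
  move=> G GF uG; apply/seteqP; split=> // B GB.
  have [//|uCB] := in_ultra_setVsetC (u @^-1` B) UU.
  have GCB : G (~` B) by apply: uG.
  have := @filter_ex _ _ GF _ (filterI GB GCB).
  by rewrite setICr => -[].
have := @segment_compact R (- K) K; rewrite compact_ultra => /(_ _ FU).
have uI : (u @ U) `[(- K), K]%classic.
  have : U (u @^-1` `[(- K), K]%classic); last exact.
  by apply: filterE => n; rewrite /= in_itv/= -ler_norml.
by move=> /(_ uI)[l [_ ul]]; exists l.
Qed.

End ultralimit.

Section interval_splitting.
Context (R : realType) (p : seq bool -> R).
Hypotheses (p0 : p [::] = 1) (p_ge0 : forall b, 0 <= p b)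
  (pS : forall b, p b = p (false :: b) + p (true :: b)).

(** [p b] is the mass of the binary word whose reversal is [b]; the words of
    length [k] cut the unit interval, in lexicographic order, into intervals
    of these lengths, and [bits k w] is the word of the interval of [w]. *)
Fixpoint lower_end (b : seq bool) : R :=
  if b is x :: b' then lower_end b' + (if x then p (false :: b') else 0) else 0.

Fixpoint bits (k : nat) (w : R) : seq bool :=
  if k is k'.+1 then
    let b := bits k' w in (lower_end b + p (false :: b) <= w) :: b
  else [::].

Lemma size_bits k w : size (bits k w) = k.
Proof. by elim: k => //= k ->. Qed.

Lemma bits_itv k (w : R) : 0 <= w < 1 ->
  let b := bits k w in lower_end b <= w < lower_end b + p b.
Proof.
move=> w01; elim: k => [|k IH] /=; first by rewrite p0 add0r.
have /andP[IH1 IH2] := IH; set b := bits k w in IH1 IH2 *.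
rewrite (pS b) addrA in IH2.
by case: (leP (lower_end b + p (false :: b)) w) => h /=; apply/andP; split; lra.
Qed.

(** The intervals of words of equal length are disjoint. *)
Lemma bits_eq b w : 0 <= w < 1 -> lower_end b <= w < lower_end b + p b ->
  bits (size b) w = b.
Proof.
move=> w01; elim: b => //= x b IH /andP[b1 b2].
have bE : bits (size b) w = b.
  apply: IH; rewrite (pS b); have := p_ge0 (false :: b); have := p_ge0 (true :: b).
  case: x b1 b2 => *; lra.
rewrite bE; congr (_ :: _); apply/idP/idP; case: x b1 b2 => // *; lra.
Qed.

Lemma lower_end01 b : 0 <= lower_end b /\ lower_end b + p b <= 1.
Proof.
elim: b => [|x b [IH1 IH2]] /=; first by rewrite p0 add0r.
rewrite (pS b) in IH2; have := p_ge0 (false :: b); have := p_ge0 (true :: b).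
by case: x => *; split; lra.
Qed.

Local Notation unif := (uniform_prob (@ltr01 R)).

Lemma measurable_bits k b : measurable [set w | bits k w = b].
Proof.
elim: k b => [|k IH] [|x b] /=.
- by rewrite (_ : [set _ | _] = setT)//; apply/seteqP.
- by rewrite (_ : [set _ | _] = set0)//; apply/seteqP; split=> // w [].
- by rewrite (_ : [set _ | _] = set0)//; apply/seteqP; split=> // w [].
rewrite (_ : [set _ | _] = [set w | bits k w = b] `&`
    (if x then `[lower_end b + p (false :: b), +oo[%classic
     else `]-oo, lower_end b + p (false :: b)[%classic)).
  by apply: measurableI => //; case: (x); exact: measurable_itv.
apply/seteqP; split => w /=.
  move=> [+ bE]; rewrite bE => <-; split => //.
  by case: leP => h /=; rewrite in_itv/= ?andbT ?h.
move=> [bE]; rewrite bE => h; congr (_ :: _).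
by case: x h => /=; rewrite in_itv/= ?andbT => h; [|apply: negbTE; rewrite -ltNge].
Qed.

Lemma uniform_itv (a b : R) : 0 <= a -> a <= b -> b <= 1 ->
  unif `[a, b[%classic = (b - a)%:E.
Proof.
move=> a0 ab b1; rewrite /uniform_prob.
rewrite (eq_integral (fun=> 1%E)); last first.
  move=> x; rewrite inE/= in_itv/= => /andP[ax xb]; rewrite /uniform_pdf.
  by rewrite ifT ?subr0 ?invr1//; apply/andP; split; lra.
rewrite integral_cst//= lebesgue_measure_itv/= lte_fin mul1e.
case: ltP => [_|ba]; first by rewrite -EFinD.
by rewrite (@le_anti _ _ a b) ?ab ?ba// subrr.
Qed.

(** Under the uniform law the word of the first [k] digits has the prescribed law,
    whatever the consistent family [p]. *)
Lemma prob_bits b : unif [set w | bits (size b) w = b] = (p b)%:E.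
Proof.
have [l0 l1] := lower_end01 b; have pb := p_ge0 b.
set A := [set w | _]; have mA : measurable A by exact: measurable_bits.
have u01 : unif `[0, 1[%classic = 1%E by rewrite uniform_itv ?subr0.
have -> : unif A = unif (A `&` `[0, 1[).
  have CI : unif (~` `[0, 1[%classic) = 0%E.
    rewrite probability_setC//.
    by rewrite [X in (_ - X)%E]u01 subee.
  rewrite -{1}(setUIDK A `[0, 1[%classic) measureU//.
  - rewrite [X in (_ + X)%E](_ : _ = 0%E) ?adde0//.
    apply/eqP; rewrite eq_le measure_ge0 andbT -CI le_measure// ?inE.
    + exact: measurableD.
    + exact: measurableC.

  - exact: measurableI.
  - exact: measurableD.
  - by apply/seteqP; split => // w [[_ ?] []].
rewrite (_ : _ `&` _ = `[lower_end b, lower_end b + p b[%classic).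
  by rewrite uniform_itv ?lerDl// addrAC subrr add0r.
apply/seteqP; split => w /=; rewrite !in_itv/=.
  move=> [Aw w01]; have := bits_itv (size b) w01.
  by rewrite /= (Aw : bits (size b) w = b).
move=> wI; have w01 : 0 <= w < 1 by apply/andP; split; lra.
by split => //; rewrite /A/= bits_eq.
Qed.

End interval_splitting.

Section digit_limit.
Context (R : realType) (U : set_system nat) {UU : UltraFilter U}.
Context (dT : measure_display) (T : measurableType dT).
Context (Pn : nat -> probability T R) (beta : nat -> T -> bool).
Hypothesis mbeta : forall j, measurable [set x | beta j x].

Local Notation unif := (uniform_prob (@ltr01 R)).

(** Reversed, so that one more digit is one more [cons], as in [bits]. *)
Fixpoint prefix_rev (V : Type) (c : nat -> V -> bool) (k : nat) (x : V) :=
  if k is k'.+1 then c k' x :: prefix_rev c k' x else [::].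

Lemma size_prefix_rev (V : Type) (c : nat -> V -> bool) k x :
  size (prefix_rev c k x) = k.
Proof. by elim: k => //= k ->. Qed.

Lemma nth_prefix_rev (V : Type) (c : nat -> V -> bool) k x j : (j < k)%N ->
  nth false (prefix_rev c k x) (k.-1 - j) = c j x.
Proof.
elim: k => //= k IH; rewrite ltnS leq_eqVlt => /orP[/eqP ->|jk].
  by rewrite subnn.
have -> : (k - j = (k.-1 - j).+1)%N by case: k jk {IH} => // k; rewrite ltnS => /subSn.
exact: IH.
Qed.

Let measurable_prefix k b : measurable [set x | prefix_rev beta k x = b].
Proof.
elim: k b => [|k IH] [|y b] /=.
- by rewrite (_ : [set _ | _] = setT)//; apply/seteqP.
- by rewrite (_ : [set _ | _] = set0)//; apply/seteqP; split=> // w [].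
- by rewrite (_ : [set _ | _] = set0)//; apply/seteqP; split=> // w [].
rewrite (_ : [set _ | _] = [set x | prefix_rev beta k x = b] `&`
    (if y then [set x | beta k x] else ~` [set x | beta k x])).
  apply: measurableI => //; case: (y); first exact: mbeta.
  by apply: measurableC; exact: mbeta.
apply/seteqP; split => w /=.
  by move=> [<- ->]; split=> //; case E : (beta k w) => //=; rewrite E.
by move=> [->]; case: y => /= [->//|/negP/negbTE ->].
Qed.

Let prefix_mean (dV : measure_display) (W : measurableType dV)
   (mu : probability W R) (c : W -> seq bool) k (phi : seq bool -> R) :
   (forall x, size (c x) = k) -> (forall b, measurable [set x | c x = b]) ->
   \int[mu]_x phi (c x) =
   \sum_(t : k.-tuple bool) phi t * fine (mu [set x | c x = t]).
Proof.
move=> sc mc.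
have E x : phi (c x) = \sum_(t : k.-tuple bool) phi t * \1_[set x | c x = t] x.
  have sx : size (c x) == k by rewrite sc.
  rewrite (bigD1 (Tuple sx))//= big1 ?addr0.
    by rewrite indicE mem_set// mulr1.
  move=> t tx; rewrite indicE memNset ?mulr0//= => cx; move/eqP: tx; apply.
  by apply: val_inj.
under eq_Rintegral do rewrite E.
rewrite exp_sum => [|t]; last by apply: bmeasZ; exact: bmeas_indic.
by apply: eq_bigr => t _; rewrite expZ ?exp_indic//; exact: bmeas_indic.
Qed.

(** The probabilities of digit words converge along [U] to a consistent family,
    which interval splitting realises by random digits [B] on the unit interval.
    A functional of finitely many digits is a function of one word. *)
Lemma digit_limit : exists B : nat -> R -> bool,
  (forall j, measurable [set w | B j w]) /\
  forall k (phi : (nat -> bool) -> R),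
    (forall c c', (forall j, (j < k)%N -> c j = c' j) -> phi c = phi c') ->
    (fun n => \int[Pn n]_x phi (fun j => beta j x)) @ U -->
      \int[unif]_w phi (fun j => B j w).
Proof.
pose q n b := fine (Pn n [set x | prefix_rev beta (size b) x = b]).
have q01 n b : 0 <= q n b <= 1.
  by rewrite /q fine_ge0//= -lee_fin fineK ?fin_num_measure// probability_le1.
have H b : {l : R | (fun n => q n b) @ U --> l}.
  apply: cid; apply: (@ultralimit_exists R U _ _ 1) => n.
  by have /andP[? ?] := q01 n b; rewrite ger0_norm.
pose p b := sval (H b); have pP b : (fun n => q n b) @ U --> p b := svalP (H b).
have p0 : p [::] = 1.
  have := pP [::]; rewrite (_ : (fun n => _) = cst 1).
    by move=> c; exact: (cvg_unique _ c (@cvg_cst _ (1 : R) _ U _)).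
  apply/funext => n; rewrite /q/= (_ : [set _ | _] = setT) ?probability_setT//.
  by apply/seteqP.
have p_ge0 b : 0 <= p b.
  apply: (ler_cvg_to (cvg_cst 0) (pP b)); apply: filterE => n.
  by have /andP[] := q01 n b.
have pS b : p b = p (false :: b) + p (true :: b).
  suff E : (fun n => q n b) = (fun n => q n (false :: b)) + (fun n => q n (true :: b)).
    have FU : Filter U by exact: _.
    have := @cvgD _ _ _ U FU _ _ _ _ (pP (false :: b)) (pP (true :: b)).
    by rewrite -E => c; exact: (cvg_unique _ (pP b) c).
  apply/funext => n; rewrite !fctE /q -fineD ?fin_num_measure//.
  rewrite -measureU//; last first.
    by apply/seteqP; split => // x [/= [-> _] []].
  congr (fine (Pn n _)); apply/seteqP; split => x /=.
    by move=> ->; case: beta; [right|left].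
  by move=> [[_ ->]|[_ ->]].
pose B j w := lower_end p (bits p j w) + p (false :: bits p j w) <= w.
have BE k w : bits p k w = prefix_rev B k w.
  by elim: k => //= k IH; rewrite -IH.
exists B; split.
  move=> j; rewrite (_ : [set _ | _] = \bigcup_(b in [set: seq bool])
     [set w | bits p j.+1 w = true :: b]).
    by apply: countable_bigcupT_measurable => // b; exact: measurable_bits.
  apply/seteqP; split => [w /= Bw|w [b _] /= []//].
  by exists (bits p j w) => //=; congr (_ :: _).
move=> k phi phiE.
pose psi (b : seq bool) := phi (fun j => nth false b (k.-1 - j)).
have psiE (V : Type) (c : nat -> V -> bool) x :
    phi (fun j => c j x) = psi (prefix_rev c k x).
  by apply: phiE => j jk; rewrite nth_prefix_rev.
rewrite (_ : (fun n => _) = fun n => \sum_(t : k.-tuple bool) psi t * q n t).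
  rewrite (_ : \int[_]__ _ = \sum_(t : k.-tuple bool) psi t * p t).
    by apply: cvg_sum_seq => t; apply: cvgMr; exact: pP.
  under eq_Rintegral do rewrite psiE -BE.
  rewrite (prefix_mean _ (k := k)).
  - apply: eq_bigr => t _; congr (_ * _).
    by have := prob_bits p0 p_ge0 pS t; rewrite size_tuple => h; exact: (congr1 fine h).
  - by move=> x; rewrite size_bits.
  - by move=> b; exact: measurable_bits.
apply/funext => n; under eq_Rintegral do rewrite psiE.
rewrite (prefix_mean _ (k := k)).
- by apply: eq_bigr => t _; rewrite /q size_tuple.
- by move=> x; rewrite size_prefix_rev.
- by move=> b; exact: measurable_prefix.
Qed.

End digit_limit.

Section binary_digits.
Context (R : realType).
Implicit Types y : R.

(** [y] is the sum of its first [k] binary digits and [2^-k] times this remainder. *)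
Fixpoint digit_rem (k : nat) (y : R) : R :=
  if k is k'.+1 then
    let r := digit_rem k' y in 2 * r - (if 2^-1 <= r then 1 else 0)
  else y.

Definition digit (k : nat) (y : R) : bool := 2^-1 <= digit_rem k y.

Definition digit_sum (K : nat) (c : nat -> bool) : R :=
  \sum_(k < K) (if c k then 1 else 0) * 2^-1 ^+ k.+1.

Lemma digit_rem01 k y : 0 <= y < 1 -> 0 <= digit_rem k y < 1.
Proof.
move=> y01; elim: k => //= k /andP[r0 r1].
by case: (leP 2^-1 (digit_rem k y)) => h; apply/andP; split; lra.
Qed.

Lemma digit_sumP K y :
  y = digit_sum K (fun k => digit k y) + 2^-1 ^+ K * digit_rem K y.
Proof.
elim: K => [|K IH]; first by rewrite /digit_sum big_ord0 add0r expr0 mul1r.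
rewrite {1}IH /digit_sum big_ord_recr/= -addrA; congr (_ + _).
by rewrite /digit exprS; case: ifP => _; field.
Qed.

Lemma digit_sum_approx K y : 0 <= y < 1 ->
  `|y - digit_sum K (fun k => digit k y)| <= 2^-1 ^+ K.
Proof.
move=> y01; rewrite {1}(digit_sumP K y) addrAC subrr add0r.
have /andP[r0 r1] := digit_rem01 K y01.
have p0 : 0 <= (2^-1 ^+ K : R) by apply: exprn_ge0; lra.
by rewrite ger0_norm ?mulr_ge0// ler_piMr// ltW.
Qed.

Lemma digit_sum_step (c : nat -> bool) K m :
  0 <= digit_sum (K + m) c - digit_sum K c <= 2^-1 ^+ K - 2^-1 ^+ (K + m).
Proof.
elim: m => [|m /andP[IH1 IH2]]; first by rewrite addn0 !subrr lexx.
rewrite addnS {1 3}/digit_sum big_ord_recr/= -/(digit_sum (K + m) c).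
have p0 : 0 <= (2^-1 ^+ (K + m) : R) by apply: exprn_ge0; lra.
rewrite exprS; case: (c (K + m)%N); apply/andP; split; lra.
Qed.

Definition digit_lim (c : nat -> bool) : R := limn (digit_sum^~ c).

Lemma is_cvg_digit_sum c : cvgn (digit_sum^~ c).
Proof.
apply: nondecreasing_is_cvgn.
  apply/nondecreasing_seqP => n; rewrite -subr_ge0 -addn1.
  by have /andP[] := digit_sum_step c n 1.
exists 1 => _ [n _ <-]; have /andP[_] := digit_sum_step c 0 n.
rewrite add0n /digit_sum big_ord0 subr0 expr0 => /le_trans; apply.
by rewrite gerBl exprn_ge0//; lra.
Qed.

(** The error bound does not depend on the digits, which makes truncation
    uniform over all laws. *)
Lemma digit_lim_approx c K : `|digit_lim c - digit_sum K c| <= 2^-1 ^+ K.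
Proof.
have p0 n : 0 <= (2^-1 ^+ n : R) by apply: exprn_ge0; lra.
have H m : 0 <= digit_sum (K + m) c - digit_sum K c <= 2^-1 ^+ K.
  have /andP[-> /le_trans ->//] := digit_sum_step c K m.
  by rewrite gerBl.
have : digit_sum (m + K) c - digit_sum K c @[m --> \oo] -->
    digit_lim c - digit_sum K c.
  apply: cvgB; last exact: cvg_cst.
  have h : digit_sum^~ c @ \oo --> digit_lim c by exact: is_cvg_digit_sum.
  by rewrite -(@cvg_shiftn K) in h; exact: h.
move=> /cvg_norm cl; apply: (ler_cvg_to cl (@cvg_cst _ _ _ _ _)).
by apply: nearW => m; rewrite addnC; have /andP[h1 h2] := H m; rewrite ger0_norm.
Qed.

Lemma measurable_digit_rem k : measurable_fun setT (digit_rem k).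
Proof.
elim: k => [|k IH] /=; first exact: measurable_id.
apply: measurable_funB; first exact: measurable_funM.
apply: measurable_fun_ifT => //.
by apply: measurable_fun_ler.
Qed.

Lemma measurable_digit k (dT : measure_display) (T : measurableType dT)
    (f : T -> R) : measurable_fun setT f -> measurable [set x | digit k (f x)].
Proof.
move=> mf; rewrite (_ : [set x | _] = (digit_rem k \o f) @^-1` `[2^-1, +oo[).
  rewrite -[X in measurable X]setTI.
  by apply: (measurableT_comp (measurable_digit_rem k) mf).
by apply/seteqP; split => x /=; rewrite in_itv/= andbT.
Qed.

End binary_digits.

Section compress.
Context (R : realType).
Implicit Types x y z M : R.

Lemma dist_clamp (l u x y : R) :
  `|Num.min u (Num.max l x) - Num.min u (Num.max l y)| <= `|x - y|.
Proof.
wlog xy : x y / x <= y => [H|].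
  by have [/H//|/ltW/H] := leP x y; rewrite distrC (distrC x).
have mono : Num.min u (Num.max l x) <= Num.min u (Num.max l y).
  rewrite le_min ge_min lexx/= ge_min; apply/orP; right.
  by rewrite ge_max !le_max lexx xy orbT.
rewrite distrC (distrC x) !ger0_norm ?subr_ge0// lerBlDr addr_minr addr_maxr.
have yx : 0 <= y - x by rewrite subr_ge0.
rewrite subrK le_min ge_min lerDr yx/= ge_min; apply/orP; right.
by rewrite ge_max !le_max lerDr yx lexx orbT.
Qed.

(** [compress] maps the line homeomorphically onto the open unit interval;
    [stretch M] inverts it on the image of [-M, M]. *)
Definition compress x : R := (1 + x / (1 + `|x|)) / 2.

Definition odds z : R := z / (1 - `|z|).

Definition stretch M y : R :=
  odds (Num.min (Num.max (2 * y - 1) (- (M / (1 + M)))) (M / (1 + M))).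

Lemma compress01 x : 0 <= compress x < 1.
Proof.
have h : `|x / (1 + `|x|)| < 1.
  have x0 : 0 < 1 + `|x| by rewrite ltr_wpDr.
  by rewrite normrM normfV (ger0_norm (ltW x0)) ltr_pdivrMr// mul1r ltrDr.
rewrite /compress; move: h; rewrite ltr_norml => /andP[? ?].
by apply/andP; split; lra.
Qed.

Lemma measurable_compress (dT : measure_display) (T : measurableType dT)
    (f : T -> R) : measurable_fun setT f ->
  measurable_fun setT (fun t => compress (f t)).
Proof.
move=> mf; apply: (@measurableT_comp _ _ _ _ _ _ compress) mf.
apply: continuous_measurable_fun => x; rewrite /compress.
apply: cvgM; last exact: cvg_cst.
apply: cvgD; first exact: cvg_cst.
apply: cvgM; first exact: cvg_id.
apply: cvgV; first by rewrite gt_eqF// ltr_wpDr.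
by apply: cvgD; [exact: cvg_cst|exact: norm_continuous].
Qed.

Lemma oddsK x : odds (x / (1 + `|x|)) = x.
Proof.
have x0 : 0 < 1 + `|x| by rewrite ltr_wpDr.
rewrite /odds normrM normfV (ger0_norm (ltW x0)).
by field; apply/andP; split; rewrite gt_eqF//; lra.
Qed.

Lemma stretchK M x : 0 <= M -> `|x| <= M -> stretch M (compress x) = x.
Proof.
move=> M0 xM; rewrite /stretch /compress.
have -> : 2 * ((1 + x / (1 + `|x|)) / 2) - 1 = x / (1 + `|x|) by field.
have x0 : 0 < 1 + `|x| by rewrite ltr_wpDr.
have M1 : 0 < 1 + M by lra.
have h : `|x / (1 + `|x|)| <= M / (1 + M).
  rewrite normrM normfV (ger0_norm (ltW x0)) ler_pdivrMr// mulrAC ler_pdivlMr//.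
  lra.
move: h; rewrite ler_norml => /andP[h1 h2].
by rewrite max_l// min_l// oddsK.
Qed.

(** On the image of [[-M, M]] the inverse of the compression is Lipschitz, because
    [1 - |z|] is bounded below there. *)
Lemma stretch_lip M : 0 <= M -> exists2 L, 0 <= L & forall y y',
  `|stretch M y - stretch M y'| <= L * `|y - y'|.
Proof.
move=> M0; have M1 : 0 < 1 + M by lra.
set r := M / (1 + M).
have r0 : 0 <= r by rewrite divr_ge0// ltW.
have rE : 1 - r = (1 + M)^-1 by rewrite /r; field; rewrite gt_eqF.
pose cl (z : R) := Num.min (Num.max z (- r)) r.
have clr z : `|cl z| <= r.
  rewrite /cl ler_norml ge_min lexx orbT andbT le_min le_max lexx orbT/=; lra.
have cll z z' : `|cl z - cl z'| <= `|z - z'|.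
  by rewrite /cl 2!(minC _ r) 2!(maxC _ (- r)); exact: dist_clamp.
exists (2 * (1 + M) ^+ 2 * 2) => [|y y'].
  by apply: mulr_ge0 => //; apply: mulr_ge0 => //; apply: exprn_ge0; lra.
rewrite /stretch -/r -/(cl _) -/(cl (2 * y' - 1)).
set u := cl _; set v := cl (2 * y' - 1).
have uv : `|u - v| <= 2 * `|y - y'|.
  rewrite (le_trans (cll _ _))// (_ : _ - _ = 2 * (y - y')); last by ring.
  by rewrite normrM ger0_norm.
have ur : `|u| <= r := clr _; have vr : `|v| <= r := clr _.
have c0 : 0 < (1 + M)^-1 by rewrite invr_gt0.
have u1 : (1 + M)^-1 <= 1 - `|u| by lra.
have v1 : (1 + M)^-1 <= 1 - `|v| by lra.
have u2 : 0 < 1 - `|u| by lra.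
have v2 : 0 < 1 - `|v| by lra.
have -> : odds u - odds v =
    ((u - v) * (1 - `|v|) + v * (`|u| - `|v|)) / ((1 - `|u|) * (1 - `|v|)).
  by rewrite /odds; field; apply/andP; split; rewrite gt_eqF.
rewrite normrM normfV (ger0_norm (ltW (mulr_gt0 u2 v2))) ler_pdivrMr ?mulr_gt0//.
apply: (@le_trans _ _ (2 * `|u - v|)).
  rewrite (le_trans (ler_normD _ _))// !normrM mulr_natl mulr2n.
  apply: lerD.
    by rewrite ler_piMr// ger0_norm; have := normr_ge0 v; lra.
  rewrite -[leRHS]mul1r; apply: ler_pM => //; first by lra.
  exact: ler_dist_dist.
have yy := normr_ge0 (y - y').
have key : 1 <= (1 + M) ^+ 2 * ((1 - `|u|) * (1 - `|v|)).
  have := ler_pM (ltW c0) (ltW c0) u1 v1.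
  rewrite -(ler_pM2l (exprn_gt0 2 M1)); apply: le_trans.
  by rewrite le_eqVlt; apply/orP; left; apply/eqP; field; rewrite gt_eqF.
apply: (@le_trans _ _ (4 * `|y - y'| * 1)); first by lra.
apply: (@le_trans _ _ (4 * `|y - y'| * ((1 + M) ^+ 2 * ((1 - `|u|) * (1 - `|v|))))).
  by apply: ler_wpM2l => //; lra.
by rewrite le_eqVlt; apply/orP; left; apply/eqP; ring.
Qed.

(** Where the clamp is not active, [stretch] is the exact inverse. *)
Lemma stretch_lt M y : 0 <= M -> `|stretch M y| < M ->
  stretch M y = odds (2 * y - 1).
Proof.
move=> M0; have M1 : 0 < 1 + M by lra.
have r0 : 0 <= M / (1 + M) by rewrite divr_ge0// ltW.
have rM : odds (M / (1 + M)) = M by have := oddsK M; rewrite (ger0_norm M0).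
have rN z : odds (- z) = - odds z by rewrite /odds normrN mulNr.
rewrite /stretch; set r := M / (1 + M) in r0 rM *; set z := 2 * y - 1.
case: (ltP z (- r)) => h1.
  rewrite min_l; last lra.
  by rewrite rN rM normrN ger0_norm// ltxx.
case: (ltP z r) => h2 //.
by rewrite rM ger0_norm// ltxx.
Qed.

Lemma measurable_stretch M (dT : measure_display) (T : measurableType dT)
    (f : T -> R) : 0 <= M -> measurable_fun setT f ->
  measurable_fun setT (fun t => stretch M (f t)).
Proof.
move=> M0 mf; apply: (@measurableT_comp _ _ _ _ _ _ (stretch M)) mf.
have [L L0 uL] := stretch_lip M0.
apply: continuous_measurable_fun => x; apply/cvgrPdist_le => e e0.
near=> y; rewrite (le_trans (uL _ _))//.
have L1 : 0 < L + 1 by lra.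
apply: (@le_trans _ _ ((L + 1) * `|x - y|)).
  by apply: ler_wpM2r => //; lra.
rewrite mulrC -ler_pdivlMr//; near: y.
apply/nbhs_ballP; exists (e / (L + 1)) => /=; first by rewrite divr_gt0// ltr_wpDl.
by move=> y /ltW.
Unshelve. all: by end_near. Qed.

Lemma measurable_inv (dT : measure_display) (T : measurableType dT)
    (f : T -> R) : measurable_fun setT f ->
  measurable_fun setT (fun t => (f t)^-1).
Proof.
move=> mf.
have -> : (fun t => (f t)^-1) = (fun t => f t * expR (- ln (f t ^+ 2))).
  apply/funext => t; have [->|f0] := eqVneq (f t) 0.
    by rewrite invr0 mul0r.
  rewrite expRN lnK; first by field.
  by rewrite posrE exprn_even_gt0.
apply: measurable_funM => //; apply: measurableT_comp => //.
apply: measurable_funN; apply: (measurableT_comp (@measurable_ln R)).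
exact: measurable_funX.
Qed.

Lemma measurable_odds (dT : measure_display) (T : measurableType dT)
    (f : T -> R) : measurable_fun setT f ->
  measurable_fun setT (fun t => odds (f t)).
Proof.
move=> mf; apply: measurable_funM => //; apply: measurable_inv.
by apply: measurable_funB => //; exact: measurableT_comp.
Qed.

End compress.

(** * Compactness of tight sequences *)

(** Bounded Lipschitz test functions: their means change by a small amount,
    uniformly over all laws, when digits are truncated. *)
Definition blip (R : realType) (d : nat) (g : symmx R d -> R) :=
  (exists K, forall X, `|g X| <= K) /\
  exists2 L, 0 <= L & forall X Y, `|g X - g Y| <= L * `|X - Y|.

Lemma measurable_if01 (R : realType) (dT : measure_display)
    (T : measurableType dT) (b : T -> bool) : measurable [set t | b t] ->
  measurable_fun setT (fun t => if b t then 1 else 0 : R).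
Proof.
move=> mb; rewrite (_ : (fun t => _) = (\1_[set t | b t] : T -> R)).
  exact: measurable_indic.
apply/funext => t; rewrite indicE; case: ifPn => h; first by rewrite mem_set.
by rewrite memNset//= => /(negP h).
Qed.

Lemma exp_norm_le (R : realType) (dT : measure_display) (T : measurableType dT)
    (P : probability T R) (f h : T -> R) : bmeas f -> bmeas h ->
  (forall x, `|f x| <= h x) -> `|\int[P]_x f x| <= \int[P]_x h x.
Proof.
move=> bf bh fh; rewrite ler_norml; apply/andP; split.
  rewrite lerNl -[X in X <= _]mulN1r -expZ//; apply: le_exp => //.
    exact: bmeasZ.
  by move=> x; rewrite mulN1r; have := fh x; rewrite ler_norml => /andP[]; lra.
by apply: le_exp => // x; exact: le_trans (ler_norm _) (fh x).
Qed.

Lemma ler_dist3 (R : realType) (a b c e e1 e2 e3 x : R) :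
  `|a - b| <= e1 -> `|b - c| <= e2 -> `|x - c| <= e3 -> e1 + e2 + e3 <= e ->
  `|a - x| <= e.
Proof.
rewrite !ler_norml => /andP[? ?] /andP[? ?] /andP[? ?] ?.
by apply/andP; split; lra.
Qed.

Section prokhorov.
Context (R : realType) (d : nat).
Local Notation S := (symmx R d).
Local Notation unif := (uniform_prob (@ltr01 R)).

Lemma lipschitz_measurable (g : S -> R) (L : R) : 0 <= L ->
  (forall X Y, `|g X - g Y| <= L * `|X - Y|) -> measurable_fun setT g.
Proof.
move=> L0 gL; apply: continuous_symmx_measurable => X B /nbhs_ballP[e /= e0 eB].
apply/nbhs_ballP; exists (e / (L + 1)) => /=; first by rewrite divr_gt0// ltr_wpDl.
move=> Y; rewrite -ball_normE/= ltr_pdivlMr ?ltr_wpDl// => XY.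
apply: eB; rewrite -ball_normE/= (le_lt_trans (gL _ _))// (le_lt_trans _ XY)//.
by rewrite mulrC; apply: ler_wpM2l => //; lra.
Qed.

Lemma blip_bmeas (g : S -> R) : blip g -> bmeas g.
Proof. by move=> [gK [L L0 gL]]; split=> //; exact: lipschitz_measurable L0 gL. Qed.

(** A Lipschitz substitute for the indicator of [M < `|X|], usable as a test
    function in weak limits. *)
Lemma blip_excess (M : R) : blip (fun X : S => Num.min 1 (Num.max 0 (`|X| - M))).
Proof.
split.
  exists 1 => X; rewrite ger0_norm ?ge_min ?lexx//.
  by rewrite le_min ler01 le_max lexx.
exists 1 => // X Y; rewrite mul1r.
apply: le_trans (ler_dist_dist X Y); apply: (le_trans (dist_clamp _ _ _ _)).
by rewrite opprB addrA subrK.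
Qed.

Definition stretch_mx (M : R) (y : 'I_d * 'I_d -> R) : S :=
  symmetrize (fun i j => stretch M (y (i, j))).

Lemma stretch_mxK M (X : S) : `|X| <= M ->
  stretch_mx M (fun ij => compress (X ij.1 ij.2)) = X.
Proof.
move=> XM; have M0 : 0 <= M := le_trans (normr_ge0 X) XM.
rewrite -[RHS]symmetrize_id; congr symmetrize.
apply/funext => i; apply/funext => j /=; apply: stretchK => //.
exact: le_trans (symmx_entry_le _ _ _) XM.
Qed.

Lemma stretch_mx_lip M : 0 <= M -> exists2 L, 0 <= L &
  forall y y' e, 0 <= e -> (forall ij, `|y ij - y' ij| <= e) ->
    `|stretch_mx M y - stretch_mx M y'| <= L * e.
Proof.
move=> M0; have [L L0 uL] := @stretch_lip R M M0; exists L => // y y' e e0 yy.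
apply: symmx_norm_le => [|i j]; first exact: mulr_ge0.
rewrite symmxD symmxN !symmetrizeE (le_trans (uL _ _))//.
exact: ler_wpM2l.
Qed.

Lemma measurable_stretch_mx M (dT : measure_display) (T : measurableType dT)
    (y : T -> 'I_d * 'I_d -> R) : 0 <= M ->
  (forall ij, measurable_fun setT (fun t => y t ij)) ->
  measurable_fun setT (fun t => stretch_mx M (y t)).
Proof.
move=> M0 my; apply: measurable_symmx => i j.
under eq_fun do rewrite symmetrizeE.
exact: measurable_stretch.
Qed.

Context (U : set_system nat) {UU : UltraFilter U}.
Variable Pn : nat -> probability S R.

(** One sequence of bits encodes the binary expansions of all compressed entries. *)
Let beta (m : nat) (X : S) : bool :=
  if unpickle m is Some (ij, k) then digit k (compress (X ij.1 ij.2)) else false.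

Let mbeta m : measurable [set X | beta m X].
Proof.
rewrite /beta; case: unpickle => [[ij k]|].
  apply: measurable_digit; apply: measurable_compress; exact: measurable_entry.
by rewrite (_ : [set _ | _] = set0)//; apply/seteqP; split.
Qed.


Let Y (B : nat -> R -> bool) (w : R) (ij : 'I_d * 'I_d) : R :=
  digit_lim R (fun k => B (pickle (ij, k)) w).

Let measurable_Y (B : nat -> R -> bool) ij : (forall j, measurable [set w | B j w]) ->
  measurable_fun setT (fun w => Y B w ij).
Proof.
move=> mB; pose c (k : nat) w := B (pickle (ij, k)) w.
apply: (@measurable_fun_cvg _ _ _ setT (fun K w => digit_sum R K (fun k => c k w))).
- move=> K; apply: measurable_sum => k; apply: measurable_funM => //.
  by rewrite /c; exact: measurable_if01.
- by move=> w _; apply: is_cvg_digit_sum.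
Qed.

(** After truncation to norm at most [M] a test function is, up to [e / 3], a
    functional of finitely many digits, uniformly over all laws. *)
Let cvg_truncated (B : nat -> R -> bool) : (forall j, measurable [set w | B j w]) ->
  (forall k (phi : (nat -> bool) -> R),
    (forall c c', (forall j, (j < k)%N -> c j = c' j) -> phi c = phi c') ->
    (fun n => \int[Pn n]_x phi (fun j => beta j x)) @ U -->
      \int[unif]_w phi (fun j => B j w)) ->
  forall M g, 0 <= M -> blip g ->
  (fun n => \int[Pn n]_X g (stretch_mx M (fun ij => compress (X ij.1 ij.2)))) @ U
    --> \int[unif]_w g (stretch_mx M (Y B w)).
Proof.
move=> mB BP M g M0 bg; have [_ [Lg Lg0 gL]] := bg.
have [L L0 uL] := stretch_mx_lip M0.
apply/cvgrPdist_le => e e0.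
have [K KP] : exists K, Lg * L * 2^-1 ^+ K <= e / 3.
  have : Lg * L * 2^-1 ^+ K @[K --> \oo] --> Lg * L * (0 : R).
    apply: cvgMr; apply: cvg_expr; rewrite ger0_norm; lra.
  rewrite mulr0 => /cvgr_le /(_ (e / 3)) [|K _ KP]; first by lra.
  by exists K; exact: (KP K (leqnn K)).
pose phi (c : nat -> bool) :=
  g (stretch_mx M (fun ij => digit_sum R K (fun k => c (pickle (ij, k))))).
have p0 : 0 <= (2^-1 ^+ K : R) by apply: exprn_ge0; lra.
have close y y' : (forall ij, `|y ij - y' ij| <= 2^-1 ^+ K) ->
    `|g (stretch_mx M y) - g (stretch_mx M y')| <= e / 3.
  move=> yy; rewrite (le_trans (gL _ _))// (le_trans _ KP)// -mulrA.
  by apply: ler_wpM2l => //; exact: uL.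
have [k phik] : exists k, forall c c',
    (forall j, (j < k)%N -> c j = c' j) -> phi c = phi c'.
  exists (\max_(p : ('I_d * 'I_d) * 'I_K) (pickle (p.1, val p.2)).+1)%N => c c' cc.
  congr (g (stretch_mx M _)); apply/funext => ij.
  apply: eq_bigr => k _; rewrite cc//.
  exact: (@leq_bigmax _ (fun p : ('I_d * 'I_d) * 'I_K => (pickle (p.1, val p.2)).+1) (ij, k)).
have := BP k phi phik => /cvgrPdist_le /(_ (e / 3)) h.
have {}h := h _; near=> n.
have bphi : bmeas (fun w => phi (fun j => B j w)).
  apply: bmeas_comp (blip_bmeas bg); apply: measurable_stretch_mx => // ij.
  apply: measurable_sum => i; apply: measurable_funM => //.
  exact: measurable_if01.
have bphin : bmeas (fun X => phi (fun j => beta j X)).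
  apply: bmeas_comp (blip_bmeas bg); apply: measurable_stretch_mx => // ij.
  apply: measurable_sum => i; apply: measurable_funM => //.
  exact: measurable_if01.
have bY : bmeas (fun w => g (stretch_mx M (Y B w))).
  apply: bmeas_comp (blip_bmeas bg); apply: measurable_stretch_mx => // ij.
  exact: measurable_Y.
have bX : bmeas (fun X : S => g (stretch_mx M (fun ij => compress (X ij.1 ij.2)))).
  apply: bmeas_comp (blip_bmeas bg); apply: measurable_stretch_mx => // ij.
  by apply: measurable_compress; exact: measurable_entry.
have h1 := @exp_normrB _ _ _ unif _ _ (e / 3) bY bphi (fun w => close _ _ (fun ij => @digit_lim_approx R _ K)).
have h2 := @exp_normrB _ _ _ (Pn n) _ _ (e / 3) bX bphin.
have {h2} : `|\int[Pn n]_X g (stretch_mx M (fun ij => compress (X ij.1 ij.2))) -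
    \int[Pn n]_X phi (fun j => beta j X)| <= e / 3.
  apply: h2 => X; apply: close => ij.
  have -> : (fun k => beta (pickle (ij, k)) X) = (fun k => digit k (compress (X ij.1 ij.2))).
    by apply/funext => j; rewrite /beta pickleK.
  by apply: digit_sum_approx; exact: compress01.
have h3 : `|\int[unif]_w phi (fun j => B j w) - \int[Pn n]_x phi (fun j => beta j x)| <= e / 3.
  by near: n; apply: h; lra.
by move=> h2; apply: (ler_dist3 h1 h3 h2); rewrite (_ : _ + _ = e) //; field.
Unshelve. all: by end_near. Qed.

Hypothesis tight : forall e, 0 < e -> exists2 M, 0 <= M &
  \forall n \near U, fine (Pn n [set X | M < `|X|]) <= e.

Let measurable_excess M : measurable [set X : S | M < `|X|].
Proof.
rewrite (_ : [set _ | _] = (fun X : S => `|X|) @^-1` `]M, +oo[).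
  by rewrite -[X in measurable X]setTI; exact: measurable_symmx_norm.
by apply/seteqP; split => X /=; rewrite in_itv/= andbT.
Qed.

(** The limit law is the image of the uniform law under the matrix rebuilt from
    limiting digits. Tightness bounds the effect of truncating at [M + 1], for the limit
    too: the excess over [M], cut at one, is a test function that equals one
    wherever this truncation acts. *)
Lemma prokhorov : exists Q : probability S R, forall g, blip g ->
  (fun n => \int[Pn n]_X g X) @ U --> \int[Q]_X g X.
Proof.
have [B [mB BP]] := digit_limit Pn mbeta.
pose Xlim w : S := symmetrize (fun i j => odds (2 * Y B w (i, j) - 1)).
have mX : measurable_fun setT Xlim.
  apply: measurable_symmx => i j; under eq_fun do rewrite symmetrizeE.
  apply: measurable_odds; apply: measurable_funB => //.
  by apply: measurable_funM => //; exact: measurable_Y.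
have [Q QE] := law_exists unif mX; exists Q => g bg.
have [[K gK] _] := bg.
have K0 : 0 <= K := le_trans (normr_ge0 _) (gK 0).
rewrite (@exp_pushforward R _ _ _ _ unif Q Xlim g mX (blip_bmeas bg) (fun B _ => QE B)).
apply/cvgrPdist_le => e e0.
pose e' := e / (4 * K + 1).
have K1 : 0 < 4 * K + 1 by lra.
have e'0 : 0 < e' by rewrite divr_gt0.
have eE : e' * (4 * K + 1) = e by rewrite mulfVK// gt_eqF.
have [M M0 MP] := tight e'0.
have M1 : 0 <= M + 1 by lra.
pose T w := stretch_mx (M + 1) (Y B w).
pose V (X : S) := stretch_mx (M + 1) (fun ij => compress (X ij.1 ij.2)).
pose exc (X : S) := Num.min 1 (Num.max 0 (`|X| - M)).
have bexc : blip exc := blip_excess M.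
have exc0 X : 0 <= exc X by rewrite /exc le_min ler01 le_max lexx.
have mT : measurable_fun setT T.
  by apply: measurable_stretch_mx => // ij; exact: measurable_Y.
have mV : measurable_fun setT V.
  apply: measurable_stretch_mx => // ij.
  by apply: measurable_compress; exact: measurable_entry.
have VE X : `|X| <= M -> V X = X by move=> XM; apply: stretch_mxK; lra.
have cexc := cvg_truncated mB BP M1 bexc.
have cg := cvg_truncated mB BP M1 bg.
have bI : bmeas (\1_[set X : S | M < `|X|] : S -> R) by exact: bmeas_indic.
have indE X : \1_[set X : S | M < `|X|] X = (if M < `|X| then 1 else 0) :> R.
  rewrite indicE; case: ifPn => h; first by rewrite mem_set.
  by rewrite memNset//= => /(negP h).
have excT : \int[unif]_w exc (T w) <= e'.
  apply: (ler_cvg_to cexc (@cvg_cst _ _ _ _ _)); move: MP; apply: filterS => n MP.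
  apply: le_trans MP; rewrite -exp_indic//.
  apply: le_exp => //.
    exact: bmeas_comp mV (blip_bmeas bexc).
  move=> X; rewrite indE; case: ltP => [_|XM]; first by rewrite /exc ge_min lexx.
  rewrite -/(V X) VE// /exc max_l; first by rewrite ge_min lexx orbT.
  by rewrite subr_le0.
have dT w : `|g (Xlim w) - g (T w)| <= 2 * K * exc (T w).
  have [h|h] := ltP `|T w| (M + 1).
    rewrite (_ : Xlim w = T w); first by rewrite subrr normr0 !mulr_ge0.
    apply: symmxP => i j; rewrite !symmetrizeE stretch_lt//.
    apply: le_lt_trans h; have := symmx_entry_le (T w) i j.
    by rewrite {1}/T /stretch_mx symmetrizeE.
  rewrite (_ : exc (T w) = 1).
    rewrite mulr1 (le_trans (ler_normB _ _))// mulr_natl mulr2n.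
    exact: lerD.
  by rewrite /exc max_r; [rewrite min_l|]; lra.
have dV n : `|\int[Pn n]_X g X - \int[Pn n]_X g (V X)| <=
    2 * K * fine (Pn n [set X | M < `|X|]).
  rewrite -exp_indic// -expZ// -expB//; last 2 first.
    exact: blip_bmeas.
    exact: bmeas_comp mV (blip_bmeas bg).
  have bd : bmeas (fun X => g X - g (V X)).
    by apply: bmeasB; [exact: blip_bmeas|exact: bmeas_comp mV (blip_bmeas bg)].
  have pw X : `|g X - g (V X)| <= 2 * K * \1_[set X : S | M < `|X|] X.
    rewrite indE; case: ltP => [_|XM].
      by rewrite mulr1 (le_trans (ler_normB _ _))// mulr_natl mulr2n; exact: lerD.
    by rewrite VE// subrr normr0 mulr0.
  by apply: exp_norm_le => //; exact: bmeasZ.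
have dQ : `|\int[unif]_w g (Xlim w) - \int[unif]_w g (T w)| <= 2 * K * e'.
  have bd : bmeas (fun w => g (Xlim w) - g (T w)).
    by apply: bmeasB; apply: bmeas_comp (blip_bmeas bg).
  have be : bmeas (fun w => exc (T w)) by exact: bmeas_comp mT (blip_bmeas bexc).
  apply: (@le_trans _ _ (2 * K * \int[unif]_w exc (T w))); last first.
    by apply: ler_wpM2l => //; rewrite mulr_ge0.
  rewrite -expB; [|exact: bmeas_comp mX (blip_bmeas bg)|exact: bmeas_comp mT (blip_bmeas bg)].
  by rewrite -expZ//; apply: exp_norm_le => //; exact: bmeasZ.
move/cvgrPdist_le : cg => /(_ _ e'0) cg.
near=> n.
have h1 : fine (Pn n [set X | M < `|X|]) <= e' by near: n.
have h2 : `|\int[unif]_w g (T w) - \int[Pn n]_X g (V X)| <= e' by near: n.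
have h3 : 2 * K * fine (Pn n [set X | M < `|X|]) <= 2 * K * e'.
  by apply: ler_wpM2l => //; rewrite mulr_ge0.
have h4 := le_trans (dV n) h3.
apply: (ler_dist3 dQ h2 h4); rewrite -eE; lra.
Unshelve. all: by end_near. Qed.

End prokhorov.

(** * Fubini for expectations, characteristic functions and convolutions *)

Section fubini.
Context (R : realType) (d1 d2 : measure_display)
  (T : measurableType d1) (V : measurableType d2)
  (P : probability T R) (Q : probability V R).

Lemma product_measure_setT : (P \x Q)%E setT = 1%E.
Proof.
have := @product_measure1E _ _ _ _ _ P Q setT setT measurableT measurableT.
rewrite setXTT => ->; rewrite [X in (X * _)%E]probability_setT.
by rewrite [X in (_ * X)%E]probability_setT mule1.
Qed.

Lemma bmeas_prod_integrable (F : T * V -> R) : bmeas F ->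
  (P \x Q)%E.-integrable setT (EFin \o F).
Proof.
move=> [mF [K FK]]; apply: measurable_bounded_integrable => //.
  by rewrite [ltLHS]product_measure_setT ltry.
exists K; split; first exact: num_real.
by move=> M KM x _; exact: le_trans (FK x) (ltW KM).
Qed.

Lemma bmeas_sectionl (F : T * V -> R) y : bmeas F -> bmeas (fun x => F (x, y)).
Proof.
move=> [mF [K FK]]; split; last by exists K.
exact: (measurableT_comp mF (pair2_measurable y)).
Qed.

Lemma bmeas_sectionr (F : T * V -> R) x : bmeas F -> bmeas (fun y => F (x, y)).
Proof.
move=> [mF [K FK]]; split; last by exists K.
exact: (measurableT_comp mF (pair1_measurable x)).
Qed.

Lemma bmeas_fubinil (F : T * V -> R) : bmeas F ->
  bmeas (fun x => \int[Q]_y F (x, y)).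
Proof.
move=> bF; have [mF [K FK]] := bF; split; last first.
  by exists K => x; apply: exp_normr => //; exact: bmeas_sectionr.
apply: (measurableT_comp (@fine_measurable R setT _)) => //.
exact: (measurable_fubini_F (bmeas_prod_integrable bF)).
Qed.

Lemma bmeas_fubinir (F : T * V -> R) : bmeas F ->
  bmeas (fun y => \int[P]_x F (x, y)).
Proof.
move=> bF; have [mF [K FK]] := bF; split; last first.
  by exists K => x; apply: exp_normr => //; exact: bmeas_sectionl.
apply: (measurableT_comp (@fine_measurable R setT _)) => //.
exact: (measurable_fubini_G (bmeas_prod_integrable bF)).
Qed.

Lemma exp_fubini (F : T * V -> R) : bmeas F ->
  \int[P]_x \int[Q]_y F (x, y) = \int[Q]_y \int[P]_x F (x, y).
Proof.
move=> bF; have := Fubini (bmeas_prod_integrable bF) => /(congr1 fine) FF.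
rewrite /Rintegral; move: FF; congr (_ = _); congr fine; apply: eq_integral => x _.
  rewrite fineK//; apply: integrable_fin_num => //.
  exact: (bmeas_integrable Q (bmeas_sectionr x bF)).
rewrite fineK//; apply: integrable_fin_num => //.
exact: (bmeas_integrable P (bmeas_sectionl x bF)).
Qed.

End fubini.

Lemma le_exp_ae (R : realType) (dT : measure_display) (T : measurableType dT)
    (P : probability T R) (f g : T -> R) : bmeas f -> bmeas g ->
  {ae P, forall x, f x <= g x} -> \int[P]_x f x <= \int[P]_x g x.
Proof.
move=> bf bg fg; have [mf [K fK]] := bf; have [mg [L gL]] := bg.
have bm : bmeas (fun x => Num.min (f x) (g x)).
  split; first exact: measurable_minr.
  exists (Num.max K L) => x; rewrite /Num.min; case: ifP => _.
    by rewrite le_max fK.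
  by rewrite le_max gL orbT.
rewrite (@ae_eq_exp _ _ _ P f (fun x => Num.min (f x) (g x))) => //.
- by apply: le_exp => // x; rewrite ge_min lexx orbT.
- by have [] := bm.
- by apply: filterS fg => x fgx; rewrite min_l.
Qed.

Section charfun.
Context (R : realType) (d : nat).
Local Notation S := (symmx R d).
Implicit Types (P Q M : probability S R) (X Z : S).

Lemma cexp_im (t : R) : cexp (0 +i* t) = cos t +i* sin t.
Proof. by rewrite /cexp/= expR0 !mul1r. Qed.

Lemma charfunE (m : {measure set S -> \bar R}) Z : charfun m Z =
  (\int[m]_x cos (trform x Z)) +i* (\int[m]_x sin (trform x Z)).
Proof.
rewrite /charfun /cintegral; congr (_ +i* _); apply: eq_Rintegral => x _;
  by rewrite cexp_im.
Qed.

Lemma bmeas_cos_trform Z : bmeas (fun X => cos (trform X Z)).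
Proof. by apply: bmeas_cos; apply: measurable_trform. Qed.

Lemma bmeas_sin_trform Z : bmeas (fun X => sin (trform X Z)).
Proof. by apply: bmeas_sin; apply: measurable_trform. Qed.

(** Adjoint of the inclusion of symmetric matrices: the linear form of an
    arbitrary array of coefficients is represented by its symmetric part. *)
Definition symmetric_part (th : 'I_d -> 'I_d -> R) : S :=
  insubd 0 (\matrix_(i, j) ((th i j + th j i) / 2)).

Lemma symmetric_partE th i j : symmetric_part th i j = (th i j + th j i) / 2.
Proof.
rewrite /symmetric_part val_insubd ifT ?mxE//.
by apply/eqP/matrixP => a b; rewrite !mxE addrC.
Qed.

Lemma trform_symmetric_part X th :
  trform X (symmetric_part th) = \sum_i \sum_j th i j * X i j.
Proof.
rewrite trformE.
transitivity ((\sum_i \sum_j th i j * X i j + \sum_i \sum_j th j i * X i j) / 2).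
  rewrite -big_split/= mulr_suml; apply: eq_bigr => i _.
  rewrite -big_split/= mulr_suml; apply: eq_bigr => j _.
  by rewrite symmetric_partE; field.
rewrite [X in (_ + X) / 2](_ : _ = \sum_i \sum_j th i j * X i j); first by field.
rewrite exchange_big; apply: eq_bigr => i _; apply: eq_bigr => j _.
by rewrite (symmxC X).
Qed.

Lemma charfun_inj P Q : (forall Z, charfun P Z = charfun Q Z) ->
  forall A, measurable A -> P A = Q A.
Proof.
move=> PQ; apply: (eq_charfun_eq_measure (@coordinates_symmx R d)) => th;
  have E (X : S) : \sum_(k : 'I_d * 'I_d) th k * X k.1 k.2 =
      trform X (symmetric_part (fun i j => th (i, j)))
    by rewrite trform_symmetric_part pair_big; apply: eq_bigr => -[].
- have cE (m : probability S R) : \int[m]_X cos (\sum_i th i * X i.1 i.2) =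
      complex.Re (charfun m (symmetric_part (fun i j => th (i, j)))).
    by rewrite charfunE/=; apply: eq_Rintegral => X _; rewrite E.
  by rewrite !cE PQ.
- have sE (m : probability S R) : \int[m]_X sin (\sum_i th i * X i.1 i.2) =
      complex.Im (charfun m (symmetric_part (fun i j => th (i, j)))).
    by rewrite charfunE/=; apply: eq_Rintegral => X _; rewrite E.
  by rewrite !sE PQ.
Qed.

(** *** Convolution *)

Lemma convolution_ext (m1 m1' : set S -> \bar R) Q B : measurable B ->
  (forall A, measurable A -> m1 A = m1' A) ->
  convolution m1 Q B = convolution m1' Q B.
Proof.
move=> mB E; apply: eq_integral => y _; apply: E.
rewrite (_ : [set x | _] = (fun x => x + y) @^-1` B)//.
rewrite -[X in measurable X]setTI; apply: measurable_symmxD => //.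
Qed.

Lemma measurable_sum_prod : measurable_fun setT (fun xy : S * S => xy.1 + xy.2).
Proof. exact: measurable_symmxD. Qed.

Let sum_law P Q := fun B : set S =>
  (P \x Q)%E ((fun xy : S * S => xy.1 + xy.2) @^-1` B).

Let sum_lawE P Q B : measurable B -> sum_law P Q B = convolution P Q B.
Proof.
move=> mB.
have mA : measurable ((fun xy : S * S => xy.1 + xy.2) @^-1` B).
  by rewrite -[X in measurable X]setTI; exact: measurable_sum_prod.
etransitivity.
  exact: (@product_measure_unique _ _ _ _ _ P Q (product_measure2 P Q)
    (@product_measure2E _ _ _ _ _ P Q) _ mA).
apply: eq_integral => y _; congr (P _).
by apply/seteqP; split => x; rewrite /ysection/= inE.
Qed.

(** The law of a sum of independent variables, as image of the product measure. *)
Lemma convolution_exists P Q :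
  exists M, forall B, measurable B -> M B = convolution P Q B.
Proof.
pose PQ : probability (S * S)%type R := HB.pack_for (probability (S * S)%type R)
  (P \x Q)%E (Measure_isProbability.Build _ _ _ _ (product_measure_setT P Q)).
have [M ME] := law_exists PQ measurable_sum_prod.
by exists M => B mB; rewrite ME -sum_lawE.
Qed.

Lemma exp_convolution P Q M (f : S -> R) :
  (forall B, measurable B -> M B = convolution P Q B) -> bmeas f ->
  \int[M]_x f x = \int[Q]_y \int[P]_x f (x + y).
Proof.
move=> ME bf; have madd := measurable_sum_prod.
have bF : bmeas (fun xy : S * S => f (xy.1 + xy.2)) by exact: bmeas_comp madd bf.
rewrite -(exp_fubini P Q bF).
have iF := bmeas_prod_integrable P Q bF.
transitivity (fine (\int[P \x Q]_z (f (z.1 + z.2))%:E)).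
  rewrite /Rintegral; congr fine; have [mf _] := bf.
  rewrite (@eq_measure_integral _ _ _ _ (pushforward (P \x Q)%E (fun xy : S * S => xy.1 + xy.2))).
    rewrite integral_pushforward ?preimage_setT//.
    exact/measurable_EFinP.
  by move=> A mA _; rewrite [LHS](ME _ mA) -sum_lawE.
rewrite -(integral12_prod_meas1 iF) /Rintegral; congr fine.
apply: eq_integral => x _; rewrite fineK//; apply: integrable_fin_num => //.
exact: (bmeas_integrable Q (bmeas_sectionr x bF)).
Qed.

Lemma charfun_convolution P Q M Z :
  (forall B, measurable B -> M B = convolution P Q B) ->
  charfun M Z = charfun P Z * charfun Q Z.
Proof.
move=> ME; rewrite !charfunE.
have bc := bmeas_cos_trform Z; have bs := bmeas_sin_trform Z.
rewrite (exp_convolution ME bc) (exp_convolution ME bs).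
set cP := \int[P]_x cos _; set sP := \int[P]_x sin _.
have innerc y : \int[P]_x cos (trform (x + y) Z) =
    cP * cos (trform y Z) - sP * sin (trform y Z).
  under eq_Rintegral do rewrite trformDl cosD.
  rewrite expB; last 2 first.
  - by apply: bmeasM => //; exact: bmeas_cst.
  - by apply: bmeasM => //; exact: bmeas_cst.
  congr (_ - _).
    by under eq_Rintegral do rewrite mulrC; rewrite expZ// mulrC.
  by under eq_Rintegral do rewrite mulrC; rewrite expZ// mulrC.
have inners y : \int[P]_x sin (trform (x + y) Z) =
    sP * cos (trform y Z) + cP * sin (trform y Z).
  under eq_Rintegral do rewrite trformDl sinD.
  rewrite expD; last 2 first.
  - by apply: bmeasM => //; exact: bmeas_cst.
  - by apply: bmeasM => //; exact: bmeas_cst.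
  congr (_ + _).
    by under eq_Rintegral do rewrite mulrC; rewrite expZ// mulrC.
  by under eq_Rintegral do rewrite mulrC; rewrite expZ// mulrC.
under eq_Rintegral do rewrite innerc.
rewrite expB; [|exact: bmeasZ..]; rewrite !expZ//.
under [X in _ +i* X = _]eq_Rintegral do rewrite inners.
rewrite expD; [|exact: bmeasZ..]; rewrite !expZ//.
by rewrite /GRing.mul/= addrC [X in _ +i* X]addrC.
Qed.

Lemma convolution_power_exists P n : exists M,
  (forall B, measurable B -> M B = convolution_power P n B) /\
  forall Z, charfun M Z = charfun P Z ^+ n.
Proof.
elim: n => [|n [N [NE Nc]]].
  exists (\d_(0 : S) : probability S R); split=> // Z; rewrite expr0 charfunE.
  rewrite /Rintegral !integral_dirac//; try by
    apply/measurable_EFinP; have [] := bmeas_cos_trform Z; have [] := bmeas_sin_trform Z.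
  by rewrite trform0l cos0 sin0 !diracT !mul1e.
have [M ME] := convolution_exists N P.
exists M; split=> [B mB|Z]; first by rewrite ME//=; exact: convolution_ext.
by rewrite (charfun_convolution Z ME) Nc exprSr.
Qed.

End charfun.

Lemma ae_sub (R : realType) (dT : measure_display) (T : measurableType dT)
    (P : probability T R) (A B : T -> Prop) : (forall x, A x -> B x) ->
  {ae P, forall x, A x} -> {ae P, forall x, B x}.
Proof. by move=> AB; apply: filterS. Qed.

(** ** The continuity theorem *)

Section tightness.
Context (R : realType) (d : nat).
Local Notation S := (symmx R d).
Local Notation unif := (uniform_prob (@ltr01 R)).

Lemma uniform01_ae : {ae unif, forall u, 0 <= u <= 1}.
Proof.
have h : unif `[0, 1]%classic = 1%E.
  apply/eqP; rewrite eq_le probability_le1//=.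
  rewrite -[leLHS](_ : unif `[0, 1[%classic = 1%E).
    by rewrite le_measure ?inE//; apply: subset_itvl; rewrite bnd_simp.
  by rewrite uniform_itv ?subr0.
apply: (@ae_sub _ _ _ unif `[0, 1]%classic); first by move=> u /=; rewrite in_itv.
by apply: probability1_ae => //; exact: measurable_itv.
Qed.

Lemma exp_uniform_cos (a : R) : a != 0 ->
  \int[unif]_u (1 - cos (a * u)) = 1 - sin a / a.
Proof.
move=> a0; rewrite /Rintegral integral_uniform; last 2 first.
- apply/measurable_EFinP; apply: measurable_funB => //.
  by have [] := @bmeas_cos R _ _ (fun u : R => a * u); first exact: measurable_funM.
- by move=> u; rewrite lee_fin subr_ge0 cos_le1.
rewrite subr0 invr1 mul1e.
pose F (u : R) : R := u - a^-1 * sin (a * u).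
have dF (u : R) : is_derive u (1 : R) F (1 - cos (a * u)).
  have d1 : is_derive u (1 : R) (fun v : R => a * v) a.
    have := @is_deriveZ _ _ _ (@id R) a u 1 1 (is_derive_id u 1).
    by move=> /is_derive_eq; apply; rewrite /GRing.scale/= mulr1.
  have d2 : is_derive u (1 : R) (fun v : R => sin (a * v)) (a * cos (a * u)).
    have := @is_derive1_comp _ sin (fun v : R => a * v) u _ _ (is_derive_sin _) d1.
    by move=> /is_derive_eq; apply; rewrite mulrC.
  have d3 := @is_deriveZ _ _ _ _ a^-1 u 1 _ d2.
  have := @is_deriveB _ _ _ _ _ u 1 _ _ (is_derive_id u 1) d3.
  move=> /is_derive_eq; apply.
  by rewrite /GRing.scale/= mulrA mulVf// mul1r.
have cF : continuous F.
  move=> u; apply: differentiable_continuous; apply/derivable1_diffP.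
  by have [] := dF u.
rewrite (@continuous_FTC2 R _ F)//.
- by rewrite /F mulr0 sin0 mulr0 subr0 mulr1 -EFinB/= subr0 mulrC.
- apply: continuous_subspaceT => u; apply: cvgB; first exact: cvg_cst.
  apply: (@continuous_comp _ _ _ (fun u => a * u) cos); last exact: continuous_cos.
  exact: mulrl_continuous.
- split.
  + by move=> u _; have [] := dF u.
  + by apply: cvg_at_right_filter; exact: cF.
  + by apply: cvg_at_left_filter; exact: cF.
- by move=> u _; rewrite derive1E; have [_ ->] := dF u.
Qed.

(** Because [`|sin a / a| <= 1 / `|a|]. Averaging over frequencies in a window
    thus bounds a tail probability by values of the characteristic function
    near the origin. *)
Lemma uniform_cos_ge (a : R) : 2 <= `|a| ->
  2^-1 <= \int[unif]_u (1 - cos (a * u)).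
Proof.
move=> a2; have a0 : a != 0 by rewrite -normr_gt0; lra.
rewrite exp_uniform_cos//.
have : `|sin a / a| <= 2^-1.
  rewrite normrM normfV ler_pdivrMr ?normr_gt0//.
  have : `|sin a| <= 1 by rewrite ler_norml sin_geN1 sin_le1.
  lra.
by rewrite ler_norml => /andP[]; lra.
Qed.

Variables (Pn : nat -> probability S R) (c : S -> R).
Hypothesis Pnc : forall Z,
  (fun n => \int[Pn n]_X cos (trform X Z)) @ \oo --> c Z.
Hypothesis c0 : forall e, 0 < e -> exists2 del, 0 < del &
  forall Z, `|Z| <= del -> 1 - c Z <= e.

(** Markov's inequality for the mean of [1 - cos (r u tr(X D))] over [u] in the
    unit interval, computed in either order by Fubini. *)
Lemma tight_direction (D : S) (e : R) : 0 < e -> exists2 M, 0 <= M &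
  \forall n \near \oo, fine (Pn n [set X | M < `|trform X D|]) <= e.
Proof.
move=> e0; have [del del0 cdel] := c0 (divr_gt0 e0 (ltr0n R 8)).
(* The frequencies [r u] with [u <= 1] keep [(r u) D] in the ball of radius [del]. *)
pose r := del / (`|D| + 1).
have D1 : 0 < `|D| + 1 by have := normr_ge0 D; lra.
have r0 : 0 < r by rewrite divr_gt0.
exists (2 / r); first by rewrite divr_ge0// ltW.
pose F (p : S * R) : R := 1 - cos (r * p.2 * trform p.1 D).
have bF : bmeas F.
  apply: bmeasB; first exact: bmeas_cst.
  apply: bmeas_cos; apply: measurable_funM; first exact: measurable_funM.
  exact: measurable_trform.
pose phi n u := \int[Pn n]_X F (X, u).
have phiE n u : phi n u = 1 - \int[Pn n]_X cos (trform X ((r * u) *: D)).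
  rewrite /phi /F/= expB; [|exact: bmeas_cst|].
    rewrite exp_cst; congr (_ - _); apply: eq_Rintegral => X _.
    by rewrite trformZr.
  apply: bmeas_cos; apply: measurable_funM => //; exact: measurable_trform.
have cphi u : phi n u @[n --> \oo] --> 1 - c ((r * u) *: D).
  under eq_fun do rewrite phiE.
  by apply: cvgB; [exact: cvg_cst|exact: Pnc].
have mphi n : measurable_fun setT (phi n).
  by have [] := bmeas_fubinir (Pn n) unif bF.
have F2 p : 0 <= F p <= 2.
  rewrite /F; have := cos_le1 (r * p.2 * trform p.1 D).
  by have := cos_geN1 (r * p.2 * trform p.1 D); lra.
have phi2 n u : `|phi n u| <= 2.
  apply: exp_normr; first exact: (bmeas_sectionl u bF).
  by move=> X; have /andP[F0 ?] := F2 (X, u); rewrite ger0_norm.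
have mlim : measurable_fun setT (fun u => 1 - c ((r * u) *: D)).
  exact: (@measurable_fun_cvg _ _ _ setT phi).
have lim2 u : `|1 - c ((r * u) *: D)| <= 2.
  by apply: (ler_cvg_to (cvg_norm (cphi u)) (@cvg_cst _ _ _ _ _)); exact: nearW.
have := @exp_cvg _ _ _ unif phi _ 2 mphi mlim phi2 cphi.
have lim_le : \int[unif]_u (1 - c ((r * u) *: D)) <= e / 8.
  rewrite -[leRHS](@exp_cst _ _ _ unif); apply: le_exp_ae => //.
  - by split => //; exists 2.
  - exact: bmeas_cst.
  - apply: (ae_sub _ uniform01_ae) => u /andP[u0 u1]; apply: cdel.
    rewrite normrZ ger0_norm; last by rewrite mulr_ge0// ltW.
    have rD : r * (`|D| + 1) = del by rewrite /r mulfVK// gt_eqF.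
    rewrite -rD -mulrA ler_pM2l//.
    by have := ler_wpM2r (normr_ge0 D) u1; lra.
move=> /cvgrPdist_le /(_ (e / 8)) h; near=> n.
have h2 : `|\int[unif]_u (1 - c ((r * u) *: D)) - \int[unif]_u phi n u| <= e / 8.
  by near: n; apply: h; rewrite divr_gt0.
have EI : \int[unif]_u phi n u <= e / 2.
  have gen (a b : R) : `|a - b| <= e / 8 -> a <= e / 8 -> b <= e / 2.
    by rewrite ler_norml => /andP[? ?] ?; lra.
  exact: gen h2 lim_le.
move: EI; rewrite -(exp_fubini (Pn n) unif bF) => EI.
have mA : measurable [set X : S | 2 / r < `|trform X D|].
  rewrite (_ : [set _ | _] = (fun X : S => `|trform X D|) @^-1` `]2 / r, +oo[).
    rewrite -[X in measurable X]setTI.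
    by apply: (measurableT_comp (@normr_measurable R setT)) => //; exact: measurable_trform.
  by apply/seteqP; split => X /=; rewrite in_itv/= andbT.
suff : fine (Pn n [set X | 2 / r < `|trform X D|]) / 2 <= e / 2 by lra.
apply: le_trans EI; rewrite -exp_indic// mulrC -expZ; last exact: bmeas_indic.
apply: le_exp.
- by apply: bmeasZ; exact: bmeas_indic.
- exact: (bmeas_fubinil (Pn n) unif bF).
- move=> X; have I0 : 0 <= \int[unif]_u F (X, u).
    by apply: exp_ge0 => u; have /andP[] := F2 (X, u).
  rewrite indicE; have [XA|XA] := boolP (_ \in _); last by rewrite mulr0.
  rewrite mulr1; rewrite inE/= in XA.
  have := @uniform_cos_ge (r * trform X D); rewrite normrM (gtr0_norm r0).
  rewrite (_ : (fun u => _) = (fun u => F (X, u))); last first.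
    by apply/funext => u; rewrite /F/= mulrAC.
  by apply; rewrite mulrC -ler_pdivrMr// ltW.
Unshelve. all: by end_near. Qed.

(** Each entry is a linear form, so finitely many directions suffice. *)
Lemma charfun_tight (e : R) : 0 < e -> exists2 M, 0 <= M &
  \forall n \near \oo, fine (Pn n [set X | M < `|X|]) <= e.
Proof.
move=> e0.
pose D (ij : 'I_d * 'I_d) : S :=
  symmetric_part (fun i j => ((i, j) == ij)%:R).
have DE X ij : trform X (D ij) = X ij.1 ij.2.
  rewrite trform_symmetric_part pair_big/= (bigD1 ij)//= big1 => [|[i j] /negbTE].
    by rewrite -surjective_pairing eqxx mul1r addr0.
  by move=> h; rewrite /= h mul0r.
pose N : R := #|{: 'I_d * 'I_d}|%:R + 1.
have N0 : 0 < N by rewrite ltr_wpDl.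
have H ij : {M | 0 <= M /\
    \forall n \near \oo, fine (Pn n [set X | M < `|trform X (D ij)|]) <= e / N}.
  apply: cid; have [M M0 MP] := tight_direction (D ij) (divr_gt0 e0 N0).
  by exists M.
pose M ij := sval (H ij).
have M0 ij : 0 <= M ij by have [] := svalP (H ij).
have MP : \forall n \near \oo, forall ij,
    fine (Pn n [set X | M ij < `|trform X (D ij)|]) <= e / N.
  by apply: filter_forall => ij; have [] := svalP (H ij).
exists (\sum_ij M ij); first exact: sumr_ge0.
move: MP; apply: filterS => n MP.
have mA K Z : measurable [set X : S | K < `|trform X Z|].
  rewrite (_ : [set _ | _] = (fun X : S => `|trform X Z|) @^-1` `]K, +oo[).
    rewrite -[X in measurable X]setTI.
    by apply: (measurableT_comp (@normr_measurable R setT)) => //; exact: measurable_trform.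
  by apply/seteqP; split => X /=; rewrite in_itv/= andbT.
have mN K : measurable [set X : S | K < `|X|].
  rewrite (_ : [set _ | _] = (fun X : S => `|X|) @^-1` `]K, +oo[).
    by rewrite -[X in measurable X]setTI; exact: measurable_symmx_norm.
  by apply/seteqP; split => X /=; rewrite in_itv/= andbT.
rewrite -exp_indic//.
have bI ij : bmeas (\1_[set X : S | M ij < `|trform X (D ij)|] : S -> R).
  exact: bmeas_indic.
apply: (@le_trans _ _ (\int[Pn n]_X \sum_ij \1_[set X : S | M ij < `|trform X (D ij)|] X)).
  apply: le_exp; [exact: bmeas_indic|exact: bmeas_sum|move=> X].
  rewrite indicE; have [XA|_] := boolP (_ \in _); last first.
    by apply: sumr_ge0 => ij _; rewrite indicE.
  rewrite inE/= in XA.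
  have [ij Xij] : exists ij : 'I_d * 'I_d, \sum_ij M ij < `|X ij.1 ij.2|.
    apply/not_existsP => h; move: XA; apply/negP; rewrite -leNgt.
    apply: symmx_norm_le => [|i j]; first exact: sumr_ge0.
    by rewrite leNgt; apply/negP; exact: (h (i, j)).
  rewrite (bigD1 ij)//= indicE mem_set/=; last first.
    rewrite DE (le_lt_trans _ Xij)// (bigD1 ij)//= lerDl.
    exact: sumr_ge0.
  by rewrite lerDl; apply: sumr_ge0 => k _; rewrite indicE.
rewrite exp_sum//; apply: (@le_trans _ _ (\sum_(ij : 'I_d * 'I_d) e / N)).
  by apply: ler_sum => ij _; rewrite exp_indic//; exact: MP.
rewrite sumr_const -mulr_natl mulrCA ger_pMr// ler_pdivrMr// mul1r.
by rewrite /N lerDl.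
Qed.

End tightness.

Section levy_continuity.
Context (R : realType) (d : nat).
Local Notation S := (symmx R d).

Lemma derive_lipschitz (f f' : R -> R) (K : R) :
  (forall x, is_derive x (1 : R) f (f' x)) -> (forall x, `|f' x| <= K) ->
  forall a b, `|f a - f b| <= K * `|a - b|.
Proof.
move=> df f'K.
have H a b : a < b -> `|f a - f b| <= K * `|a - b|.
  move=> ab; have [|c _ fE] := MVT ab (fun x _ => df x).
    apply: continuous_subspaceT => x; apply: differentiable_continuous.
    by apply/derivable1_diffP; have [] := df x.
  by rewrite distrC fE normrM (distrC a); apply: ler_wpM2r.
move=> a b; case: (ltgtP a b) => [ab|ba|->]; first exact: H.
  by rewrite distrC (distrC a); exact: H.
by rewrite !subrr normr0 mulr0.
Qed.

Lemma blip_cos_trform (Z : S) : blip (fun X => cos (trform X Z)).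
Proof.
split; first by exists 1 => X; rewrite ler_norml cos_geN1 cos_le1.
exists (d%:R ^+ 2 * `|Z|) => [|X Y]; first by rewrite mulr_ge0// sqr_ge0.
apply: le_trans (trform_le (X - Y) Z); rewrite trformBl -[leRHS]mul1r.
apply: (@derive_lipschitz _ (fun x => - sin x)) => x.
by rewrite normrN ler_norml sin_geN1 sin_le1.
Qed.

Lemma blip_sin_trform (Z : S) : blip (fun X => sin (trform X Z)).
Proof.
split; first by exists 1 => X; rewrite ler_norml sin_geN1 sin_le1.
exists (d%:R ^+ 2 * `|Z|) => [|X Y]; first by rewrite mulr_ge0// sqr_ge0.
apply: le_trans (trform_le (X - Y) Z); rewrite trformBl -[leRHS]mul1r.
apply: (@derive_lipschitz _ cos) => x; rewrite ler_norml.
by rewrite cos_geN1 cos_le1.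
Qed.

(** Tightness yields a limit along an ultrafilter, whose characteristic function
    is [phi] because the whole sequence of characteristic functions converges.
    The limit inherits the inequalities between means of test functions,
    through which properties of the support pass to the limit. *)
Theorem levy_continuity (Pn : nat -> probability S R) (phi : S -> R[i]) :
  (forall Z, (fun n => complex.Re (charfun (Pn n) Z)) @ \oo --> complex.Re (phi Z)) ->
  (forall Z, (fun n => complex.Im (charfun (Pn n) Z)) @ \oo --> complex.Im (phi Z)) ->
  (forall e, 0 < e -> exists2 del, 0 < del &
    forall Z, `|Z| <= del -> 1 - complex.Re (phi Z) <= e) ->
  exists Q : probability S R, (forall Z, charfun Q Z = phi Z) /\
    forall g a, blip g -> (forall n, \int[Pn n]_X g X <= a) ->
      \int[Q]_X g X <= a.
Proof.
move=> cvgRe cvgIm phi0.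
have [U [UU ooU]] := ultraFilterLemma (eventually_filter : ProperFilter \oo).
have Rec Z : (fun n => \int[Pn n]_X cos (trform X Z)) @ \oo --> complex.Re (phi Z).
  by have := cvgRe Z; under eq_fun do rewrite charfunE/=.
have Imc Z : (fun n => \int[Pn n]_X sin (trform X Z)) @ \oo --> complex.Im (phi Z).
  by have := cvgIm Z; under eq_fun do rewrite charfunE/=.
have tU e : 0 < e -> exists2 M, 0 <= M &
    \forall n \near U, fine (Pn n [set X | M < `|X|]) <= e.
  move=> e0; have [M M0 MP] := charfun_tight Rec phi0 e0.
  by exists M => //; exact: ooU.
have toU (u : nat -> R) (l : R) : u @ \oo --> l -> u @ U --> l.
  by move=> h A /h; exact: ooU.
have [Q QP] := prokhorov tU; exists Q; split => [Z|g a bg ga].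
  rewrite charfunE.
  rewrite (cvg_unique (@Rhausdorff R) (QP _ (blip_cos_trform Z)) (toU _ _ (Rec Z))).
  rewrite (cvg_unique (@Rhausdorff R) (QP _ (blip_sin_trform Z)) (toU _ _ (Imc Z))).
  by case: (phi Z).
by apply: (ler_cvg_to (QP _ bg) (@cvg_cst _ _ _ _ _)); exact: filterE.
Qed.

End levy_continuity.

(** * Matrix exponentials *)

Section exponential_generating_function.
Context (R : realType).

(** Entries of matrix exponentials and of exponentials of operators on matrices
    are both of this form; differentiation shifts the coefficients. *)
Definition egf (a : nat -> R) (t : R) : R :=
  limn (pseries (fun n => a n / n`!%:R) t).

(** Growth that makes the exponential generating series converge everywhere. *)
Definition geometric_growth (a : nat -> R) :=
  exists K C, 0 <= C /\ forall n, `|a n| <= K * C ^+ n.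

Lemma geometric_growth_shift a : geometric_growth a ->
  geometric_growth (fun n => a n.+1).
Proof.
move=> [K [C [C0 aK]]]; exists (K * C), C; split => // n.
by rewrite -mulrA -exprS.
Qed.

Lemma is_cvg_egf a t : geometric_growth a ->
  cvgn (pseries (fun n => a n / n`!%:R) t).
Proof.
move=> [K [C [C0 aK]]]; apply: normed_cvg.
have K0 : 0 <= K by have := aK 0%N; rewrite expr0 mulr1; exact: le_trans.
apply: (@series_le_cvg _ _ (K *: exp_coeff (C * `|t|))).
- by move=> n; exact: normr_ge0.
- by move=> n; rewrite /GRing.scale/= mulr_ge0// exp_coeff_ge0// mulr_ge0.
- move=> n; rewrite /GRing.scale/= /exp_coeff/= !normrM normfV normrX exprMn.
  rewrite [X in _ <= X](_ : _ = K * C ^+ n * (n`!%:R)^-1 * `|t| ^+ n); last first.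
    by rewrite /GRing.scale/=; ring.
  apply: ler_wpM2r; first exact: exprn_ge0.
  by rewrite (ger0_norm (ler0n _ _)); apply: ler_wpM2r; rewrite ?invr_ge0.
- by apply: is_cvg_seriesZ; exact: is_cvg_series_exp_coeff.
Qed.

Lemma diffs_egf (a : nat -> R) : pseries_diffs (fun n => a n / n`!%:R) =
  (fun n => a n.+1 / n`!%:R).
Proof.
apply/funext => n; rewrite /pseries_diffs factS natrM.
by field; rewrite pnatr_eq0 -lt0n fact_gt0/= gt_eqF.
Qed.

Lemma is_derive_egf a t : geometric_growth a ->
  is_derive t (1 : R) (egf a) (egf (fun n => a n.+1) t).
Proof.
move=> ga; have := @pseries_snd_diffs _ (fun n => a n / n`!%:R) (`|t| + 1) t.
rewrite !diffs_egf; apply.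
- exact: is_cvg_egf.
- by apply: is_cvg_egf; exact: geometric_growth_shift.
- apply: is_cvg_egf; apply: (@geometric_growth_shift (fun n => a n.+1)).
  exact: geometric_growth_shift.
- by rewrite [ltRHS]ger0_norm ?ltrDl// addr_ge0.
Qed.

Lemma egf0 a : egf a 0 = a 0%N.
Proof.
rewrite /egf; apply/cvg_lim => //; rewrite -(@cvg_shiftS _).
rewrite (_ : [sequence _]_n = cst (a 0%N)); first exact: cvg_cst.
apply/funext => n; rewrite /pseries /series/= big_nat_recl//= expr0 mulr1.
by rewrite divr1 big1 ?addr0// => i _; rewrite expr0n mulr0.
Qed.

Lemma egfD (a b : nat -> R) t : geometric_growth a -> geometric_growth b ->
  egf (fun n => a n + b n) t = egf a t + egf b t.
Proof.
move=> ga gb; apply/cvg_lim => //.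
have -> : pseries (fun n => (a n + b n) / n`!%:R) t =
    fun N => pseries (fun n => a n / n`!%:R) t N + pseries (fun n => b n / n`!%:R) t N.
  apply/funext => N; rewrite /pseries /series/= -big_split.
  by apply: eq_bigr => n _ /=; rewrite -mulrDl -mulrDl.
exact: (@cvgD _ _ _ \oo eventually_filter _ _ _ _
  (is_cvg_egf (t := t) ga) (is_cvg_egf (t := t) gb)).
Qed.

Lemma egf_sum (I : finType) (c : I -> R) (a : I -> nat -> R) t :
  (forall i, geometric_growth (a i)) ->
  egf (fun n => \sum_i c i * a i n) t = \sum_i c i * egf (a i) t.
Proof.
move=> ga; apply/cvg_lim => //.
rewrite (_ : pseries _ t = fun N =>
    \sum_i c i * pseries (fun n => a i n / n`!%:R) t N).
  by apply: cvg_sum_seq => i; apply: cvgMr; exact: is_cvg_egf.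
apply/funext => N; rewrite /pseries /series/=.
under [RHS]eq_bigr do rewrite mulr_sumr.
rewrite exchange_big; apply: eq_bigr => n _ /=.
by rewrite mulr_suml mulr_suml; apply: eq_bigr => i _; rewrite !mulrA.
Qed.

End exponential_generating_function.

Section matrix_limits.
Context (R : realType).

Lemma cvg_mx m n (T : Type) (F : set_system T) {FF : Filter F}
    (f : T -> 'M[R]_(m, n)) (L : 'M[R]_(m, n)) :
  (forall i j, (fun t => f t i j) @ F --> L i j) -> f @ F --> L.
Proof.
move=> fL; apply/cvg_ballP => e e0.
have h : \forall t \near F, forall ij : 'I_m * 'I_n,
    ball (L ij.1 ij.2) e (f t ij.1 ij.2).
  apply: filter_forall => ij; have := fL ij.1 ij.2.
  by move=> /cvg_ballP; exact.
by apply: filterS h => t h; split=> // i j; exact: (h (i, j)).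
Qed.

Lemma cvg_symmx d (T : Type) (F : set_system T) {FF : Filter F}
    (f : T -> symmx R d) (L : symmx R d) :
  (forall i j, (fun t => f t i j) @ F --> L i j) -> f @ F --> L.
Proof.
move=> fL; apply/cvg_ballP => e e0.
have h : \forall t \near F, forall ij : 'I_d * 'I_d,
    `|L ij.1 ij.2 - f t ij.1 ij.2| < e.
  apply: filter_forall => ij; have := fL ij.1 ij.2.
  by move=> /cvgrPdist_lt; exact.
apply: filterS h => t h; rewrite -ball_normE/=.
apply: symmx_norm_lt => // i j; rewrite symmxD symmxN.
exact: (h (i, j)).
Qed.

End matrix_limits.

Section matrix_derivatives.
Context (R : realType).

(** Differentiating entrywise treats matrices of all shapes alike and reduces
    the product rule to that of the entries. *)
Definition mx_derive m n (F : R -> 'M[R]_(m, n)) (t : R) (F' : 'M[R]_(m, n)) :=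
  forall i j, is_derive t (1 : R) (fun s => F s i j) (F' i j).

Lemma mx_derive_cst m n (M : 'M[R]_(m, n)) t : mx_derive (fun=> M) t 0.
Proof. by move=> i j; rewrite mxE; exact: is_derive_cst. Qed.

Lemma mx_derive_mul m n p (F : R -> 'M[R]_(m, n)) (G : R -> 'M[R]_(n, p)) t F' G' :
  mx_derive F t F' -> mx_derive G t G' ->
  mx_derive (fun s => F s *m G s) t (F' *m G t + F t *m G').
Proof.
move=> dF dG i j.
have h k : is_derive t (1 : R) (fun s => F s i k * G s k j)
    (F' i k * G t k j + F t i k * G' k j).
  have := @is_deriveM _ _ _ _ t 1 _ _ (dF i k) (dG k j).
  by move=> /is_derive_eq; apply; rewrite /GRing.scale/= addrC mulrC.
have := is_derive_sum h; rewrite (_ : \sum_(k < n) _ = fun s => (F s *m G s) i j).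
  by move=> /is_derive_eq; apply; rewrite !mxE -big_split.
by apply/funext => s; rewrite mxE fct_sumE.
Qed.

Lemma mx_derive_tr m n (F : R -> 'M[R]_(m, n)) t F' :
  mx_derive F t F' -> mx_derive (fun s => (F s)^T) t F'^T.
Proof.
move=> dF i j; rewrite mxE.
by rewrite (_ : (fun s => _) = fun s => F s j i)//; apply/funext => s; rewrite mxE.
Qed.

Lemma mx_derive_affine m n (F : R -> 'M[R]_(m, n)) (a b t : R) F' :
  mx_derive F (a * t + b) F' -> mx_derive (fun s => F (a * s + b)) t (a *: F').
Proof.
move=> dF i j; rewrite mxE.
have d1 : is_derive t (1 : R) (fun s : R => a * s + b) a.
  have h := @is_deriveZ _ _ _ (@id R) a t 1 1 (is_derive_id t 1).
  have := @is_deriveD _ _ _ _ _ t 1 _ _ h (is_derive_cst b t 1).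
  by move=> /is_derive_eq; apply; rewrite /GRing.scale/= mulr1 addr0.
have := @is_derive1_comp _ (fun u => F u i j) _ t _ _ (dF i j) d1.
by move=> /is_derive_eq; apply; rewrite mulrC.
Qed.

Lemma mx_derive_eq m n (F : R -> 'M[R]_(m, n)) t F1 F2 :
  mx_derive F t F1 -> F1 = F2 -> mx_derive F t F2.
Proof. by move=> dF <-. Qed.

Lemma mx_derive0 m n (F : R -> 'M[R]_(m, n)) :
  (forall t, mx_derive F t 0) -> forall s t, F s = F t.
Proof.
move=> dF s t; apply/matrixP => i j.
apply: (@is_derive_0_is_cst _ (fun s => F s i j)) => x.
by have := dF x i j; rewrite mxE.
Qed.

End matrix_derivatives.

Section matrix_exponential.
Context (R : realType) (d : nat).
Local Notation S := (symmx R d).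
Implicit Types (A : 'M[R]_d) (X Z : S).

Definition mxflow A (t : R) : 'M[R]_d := mexp (t *: A).

Lemma mx_entry_le m n (M : 'M[R]_(m, n)) i j : `|M i j| <= `|M|.
Proof.
rewrite [leRHS]mx_normrE.
exact: (le_bigmax _ (fun ij : 'I_m * 'I_n => `|M ij.1 ij.2|) (i, j)).
Qed.

Lemma geometric_growth_expmx A i j : geometric_growth (fun n => (A ^+ n) i j).
Proof.
exists 1, (d%:R * `|A|); split; first exact: mulr_ge0.
move=> n; rewrite mul1r; elim: n i j => [|n IH] i j.
  by rewrite !expr0 mxE; case: (i == j); rewrite ?normr1 ?normr0.
rewrite exprS mxE (le_trans (ler_norm_sum _ _ _))//.
have -> : (d%:R * `|A|) ^+ n.+1 = \sum_(k < d) `|A| * (d%:R * `|A|) ^+ n.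
  by rewrite sumr_const card_ord -[RHS]mulr_natl exprS mulrA.
apply: ler_sum => k _; rewrite normrM; apply: ler_pM => //.
exact: mx_entry_le.
Qed.

Lemma exprZmx A (t : R) n : (t *: A) ^+ n = t ^+ n *: A ^+ n.
Proof.
elim: n => [|n IH]; first by rewrite !expr0 scale1r.
rewrite !exprS IH -[LHS]/((t *: A) *m (t ^+ n *: A ^+ n)).
by rewrite -scalemxAl -scalemxAr scalerA.
Qed.

Lemma mxflowE A t i j : mxflow A t i j = egf (fun n => (A ^+ n) i j) t.
Proof.
have h : series (fun n => n`!%:R^-1 *: (t *: A) ^+ n) @ \oo -->
    (\matrix_(i, j) egf (fun n => (A ^+ n) i j) t : 'M[R]_d).
  apply: cvg_mx => a b; rewrite mxE.
  rewrite (_ : (fun n => _) = pseries (fun n => (A ^+ n) a b / n`!%:R) t).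
    by apply: is_cvg_egf; exact: geometric_growth_expmx.
  apply/funext => N; rewrite /pseries /series/= summxE; apply: eq_bigr => n _.
  by rewrite exprZmx !mxE; ring.
by rewrite /mxflow /mexp (cvg_lim (@norm_hausdorff _ _) h) mxE.
Qed.

Lemma mxflow0 A : mxflow A 0 = 1%:M.
Proof. by apply/matrixP => i j; rewrite mxflowE egf0 expr0. Qed.

Lemma egf_shiftl A t i j :
  egf (fun n => (A ^+ n.+1) i j) t = (A *m mxflow A t) i j.
Proof.
rewrite mxE; under [RHS]eq_bigr do rewrite mxflowE.
rewrite -egf_sum; last by move=> k; exact: geometric_growth_expmx.
by congr egf; apply/funext => n; rewrite exprS mxE.
Qed.

Lemma egf_shiftr A t i j :
  egf (fun n => (A ^+ n.+1) i j) t = (mxflow A t *m A) i j.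
Proof.
rewrite mxE; under [RHS]eq_bigr do rewrite mxflowE mulrC.
rewrite -egf_sum; last by move=> k; exact: geometric_growth_expmx.
congr egf; apply/funext => n; rewrite exprSr mxE.
by apply: eq_bigr => k _; rewrite mulrC.
Qed.

Lemma mxflow_comm A t : A *m mxflow A t = mxflow A t *m A.
Proof. by apply/matrixP => i j; rewrite -egf_shiftl egf_shiftr. Qed.

Lemma mxflow_derive A t : mx_derive (mxflow A) t (A *m mxflow A t).
Proof.
move=> i j; rewrite -egf_shiftl.
rewrite (_ : (fun s => _) = egf (fun n => (A ^+ n) i j)).
  by apply: is_derive_egf; exact: geometric_growth_expmx.
by apply/funext => s; rewrite mxflowE.
Qed.

Lemma mxflow_deriveN A t :
  mx_derive (fun s => mxflow A (- s)) t (- (A *m mxflow A (- t))).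
Proof.
have := @mx_derive_affine _ _ _ (mxflow A) (-1) 0 t (A *m mxflow A (- t)).
rewrite mulN1r addr0 scaleN1r => /(_ (mxflow_derive A _)).
rewrite (_ : (fun s => mxflow A (-1 * s + 0)) = fun s => mxflow A (- s))//.
by apply/funext => s; rewrite mulN1r addr0.
Qed.

(** The left-hand side has derivative zero in [s]. *)
Lemma mxflowND A s t : mxflow A (- s) *m mxflow A (s + t) = mxflow A t.
Proof.
pose G u := mxflow A (- u) *m mxflow A (u + t).
have dG u : mx_derive G u 0.
  have h : mx_derive (fun v => mxflow A (v + t)) u (A *m mxflow A (u + t)).
    have := @mx_derive_affine _ _ _ (mxflow A) 1 t u (A *m mxflow A (u + t)).
    rewrite mul1r scale1r => /(_ (mxflow_derive A _)).
    rewrite (_ : (fun s => mxflow A (1 * s + t)) = fun s => mxflow A (s + t))//.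
    by apply/funext => v; rewrite mul1r.
  apply: mx_derive_eq (mx_derive_mul (mxflow_deriveN A u) h) _.
  by rewrite mulNmx mulmxA -mxflow_comm addNr.
have := mx_derive0 dG s 0.
by rewrite /G oppr0 mxflow0 mul1mx add0r.
Qed.

Lemma mxflowN A s : mxflow A (- s) *m mxflow A s = 1%:M.
Proof. by have := mxflowND A s 0; rewrite addr0 mxflow0. Qed.

Lemma mxflowV A s : mxflow A s *m mxflow A (- s) = 1%:M.
Proof. by have := mxflowN A (- s); rewrite opprK. Qed.

Lemma mxflowD A s t : mxflow A (s + t) = mxflow A s *m mxflow A t.
Proof. by rewrite -(mxflowND A s t) mulmxA mxflowV mul1mx. Qed.

Lemma mexp_tr A (t : R) : mexp (t *: A^T) = (mxflow A t)^T.
Proof.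
apply/matrixP => i j; rewrite -/(mxflow A^T t) mxE !mxflowE.
congr egf; apply/funext => n.
have -> : A^T ^+ n = (A ^+ n)^T.
  elim: n => [|n IH]; first by rewrite !expr0 [RHS]trmx1.
  by rewrite exprSr IH exprS [RHS]trmx_mul.
by rewrite mxE.
Qed.

Lemma congruence_subproof (M : 'M[R]_d) X : symmetric_pred (M *m X *m M^T).
Proof.
rewrite /symmetric_pred !trmx_mul trmxK mulmxA.
by rewrite (eqP (symmx_valP X)).
Qed.

Definition congruence (M : 'M[R]_d) X : S := SymMx (congruence_subproof M X).

Lemma congruenceM M N X : congruence (M *m N) X = congruence M (congruence N X).
Proof. by apply: val_inj; rewrite /= trmx_mul !mulmxA. Qed.

Lemma congruence1 X : congruence 1%:M X = X.
Proof. by apply: val_inj; rewrite /= trmx1 mul1mx mulmx1. Qed.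

Lemma congruence0 M : congruence M 0 = 0.
Proof. by apply: val_inj; rewrite /= mulmx0 mul0mx. Qed.

Lemma trform_congruence M X Z :
  trform (congruence M X) Z = trform X (congruence M^T Z).
Proof.
rewrite /trform /= trmxK -!mulmxA mxtrace_mulC.
by rewrite -!mulmxA.
Qed.

Lemma quadform_congruence M X v :
  quadform v (congruence M X) = quadform (M^T *m v) X.
Proof. by rewrite /quadform /= trmx_mul trmxK !mulmxA. Qed.

Lemma psd_congruence M X : psd_cone X -> psd_cone (congruence M X).
Proof.
by move=> Xp v; rewrite -/(quadform v _) quadform_congruence; exact: Xp.
Qed.

Lemma measurable_congruence (dU : measure_display) (V : measurableType dU)
    (f : V -> S) M : measurable_fun setT f ->
  measurable_fun setT (fun u => congruence M (f u)).
Proof.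
move=> mf; apply: measurable_symmx => i j.
rewrite (_ : (fun u => _) = fun u => \sum_k \sum_l M i l * f u l k * M j k).
  apply: measurable_sum => k; apply: measurable_sum => l.
  apply: measurable_funM => //; apply: measurable_funM => //.
  exact: (measurableT_comp (measurable_entry l k)).
apply/funext => u; rewrite /= mxE; apply: eq_bigr => k _.
by rewrite mxE mxE mulr_suml.
Qed.

(** *** The exponential of the Lyapunov operator *)

Section lyapunov.
Variables (bA : {linear S -> S}) (A : 'M[R]_d).
Hypothesis bAE : forall X, bA X = A *m X + X *m A^T :> 'M[R]_d.

Lemma iter_lyapunov_le X n i j :
  `|iter n bA X i j| <= `|X| * (d%:R * `|A| *+ 2) ^+ n.
Proof.
apply: (le_trans (symmx_entry_le _ _ _)).
elim: n => [|n IH]; first by rewrite expr0 mulr1.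
have step Y : `|bA Y| <= (d%:R * `|A| *+ 2) * `|Y|.
  apply: symmx_norm_le => [|a b].
    by rewrite mulr_ge0// mulrn_wge0// mulr_ge0.
  rewrite bAE mxE (le_trans (ler_normD _ _))// mulr2n mulrDl.
  have -> : d%:R * `|A| * `|Y| = \sum_(k < d) `|A| * `|Y|.
    by rewrite sumr_const card_ord -[RHS]mulr_natl mulrA.
  apply: lerD; rewrite mxE (le_trans (ler_norm_sum _ _ _))//;
    apply: ler_sum => k _; rewrite normrM.
    by apply: ler_pM => //; [exact: mx_entry_le|exact: symmx_entry_le].
  by rewrite mxE mulrC; apply: ler_pM => //; [exact: mx_entry_le|exact: symmx_entry_le].
rewrite iterS (le_trans (step _))// exprSr mulrA mulrC.
by apply: ler_wpM2r => //; rewrite mulrn_wge0// mulr_ge0.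
Qed.

Lemma geometric_growth_lyapunov X i j :
  geometric_growth (fun n => iter n bA X i j).
Proof.
exists `|X|, (d%:R * `|A| *+ 2); split; first by rewrite mulrn_wge0// mulr_ge0.
by move=> n; exact: iter_lyapunov_le.
Qed.

(** The exponential of [X |-> A X + X A^T] is [X |-> E_t X E_t^T]: undoing the
    congruence gives a curve with derivative zero. *)
Lemma opexpE t X : opexp bA t X = congruence (mxflow A t) X.
Proof.
pose Y u : 'M[R]_d := \matrix_(i, j) egf (fun n => iter n bA X i j) u.
have YE : Y t = congruence (mxflow A t) X :> 'M[R]_d.
  have dY u : mx_derive Y u (A *m Y u + Y u *m A^T).
    move=> i j; have := is_derive_egf u (geometric_growth_lyapunov X i j).
    rewrite (_ : (fun s => Y s i j) = egf (fun n => iter n bA X i j)); last first.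
      by apply/funext => s; rewrite mxE.
    move=> /is_derive_eq; apply.
    have gsum (c : 'I_d -> R) (k l : 'I_d -> 'I_d) :
        geometric_growth (fun n => \sum_p c p * iter n bA X (k p) (l p)).
      have [K [C [C0 H]]] : exists K C, 0 <= C /\ forall n p,
          `|iter n bA X (k p) (l p)| <= K * C ^+ n.
        exists `|X|, (d%:R * `|A| *+ 2); split.
          by rewrite mulrn_wge0// mulr_ge0.
        by move=> n p; exact: iter_lyapunov_le.
      exists ((\sum_p `|c p|) * K), C; split=> // n.
      rewrite (le_trans (ler_norm_sum _ _ _))// -mulrA mulr_suml.
      by apply: ler_sum => p _; rewrite normrM; exact: ler_wpM2l.
    rewrite (_ : (fun n => _) = fun n => \sum_p A i p * iter n bA X p j +
        \sum_p A j p * iter n bA X i p); last first.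
      apply/funext => n; rewrite iterS bAE !mxE; congr (_ + _).
      by apply: eq_bigr => p _; rewrite mxE mulrC.
    rewrite (egfD _ (gsum (A i) id (fun=> j)) (gsum (A j) (fun=> i) id)).
    rewrite !egf_sum; [|by move=> p; exact: geometric_growth_lyapunov..].
    rewrite !mxE; congr (_ + _); apply: eq_bigr => p _; rewrite !mxE//.
    by rewrite mulrC.
  (* The congruence undone; [H] is constant and equals [X] at zero. *)
  pose H u := mxflow A (- u) *m Y u *m (mxflow A (- u))^T.
  have dH u : mx_derive H u 0.
    have dE := mxflow_deriveN A u.
    apply: mx_derive_eq (mx_derive_mul (mx_derive_mul dE (dY u)) (mx_derive_tr dE)) _.
    rewrite mulNmx mxflow_comm mulmxDr linearN/= trmx_mul mulmxN !mulmxA.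
    by rewrite addKr subrr.
  have := mx_derive0 dH t 0; rewrite /H oppr0 mxflow0 mul1mx trmx1 mulmx1.
  have -> : Y 0 = X by apply/matrixP => i j; rewrite mxE egf0.
  move=> E; rewrite /= -E !mulmxA mxflowV mul1mx -mulmxA -trmx_mul mxflowV.
  by rewrite trmx1 mulmx1.
have h : series (fun n => (t ^+ n / n`!%:R) *: iter n bA X) @ \oo -->
    congruence (mxflow A t) X.
  apply: cvg_symmx => a b; rewrite -YE mxE.
  rewrite (_ : (fun n => _) = pseries (fun n => iter n bA X a b / n`!%:R) t).
    by apply: is_cvg_egf; exact: geometric_growth_lyapunov.
  apply/funext => N; rewrite /pseries /series/=.
  elim: N => [|N IH]; first by rewrite !big_geq//= mxE.
  by rewrite !big_nat_recr//= mxE IH symmxZ; congr (_ + _); ring.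
by rewrite /opexp (cvg_lim (@norm_hausdorff _ _) h).
Qed.

End lyapunov.

End matrix_exponential.

(** * The dual flow and the exponent along it *)

Lemma mean_value (R : realType) (f df : R -> R) (a b : R) : a <= b ->
  (forall x, is_derive x (1 : R) f (df x)) ->
  exists2 c, a <= c <= b & f b - f a = df c * (b - a).
Proof.
move=> ab fdf; have [c cab E] := @MVT_segment _ f df a b ab (fun x _ => fdf x)
  (derivable_within_continuous (fun x _ => @ex_derive _ _ _ _ _ _ _ (fdf x))).
by exists c => //; move: cab; rewrite in_itv.
Qed.

Section dual_flow.
Context (R : realType) (d : nat).
Local Notation S := (symmx R d).
Variable A : 'M[R]_d.
Implicit Types (X Z : S) (t : R).

Lemma is_derive_symmx (f : R -> S) t (D : S) :
  mx_derive f t D -> is_derive t (1 : R) f D.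
Proof.
move=> fD.
have h : h^-1 *: (f (h *: (1 : R) + t) - f t) @[h --> 0^'] --> D.
  apply: cvg_symmx => i j; have [df <-] := fD i j.
  rewrite (_ : (fun h : R => _) =
    (fun h : R => h^-1 *: (f (h *: (1 : R) + t) i j - f t i j))); first exact: df.
  by apply/funext => h; rewrite symmxZ symmxD symmxN.
split; first by apply/cvg_ex; exists D.
by apply/cvg_lim => //; exact: norm_hausdorff.
Qed.

(** Adjoint, for [trform], of the congruence by the matrix exponential: it moves
    the flow from the variable to the argument of the characteristic function. *)
Definition dual_flow t Z : S := congruence (mxflow A t)^T Z.

Lemma dual_flow0 Z : dual_flow 0 Z = Z.
Proof. by rewrite /dual_flow mxflow0 trmx1 congruence1. Qed.

Lemma dual_flowD s t Z : dual_flow (s + t) Z = dual_flow t (dual_flow s Z).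
Proof. by rewrite /dual_flow mxflowD trmx_mul congruenceM. Qed.

Lemma dual_flowz t : dual_flow t 0 = 0.
Proof. exact: congruence0. Qed.

Lemma dual_flow_eq0 t Z : (dual_flow t Z == 0) = (Z == 0).
Proof.
apply/eqP/eqP => [h|->]; last exact: dual_flowz.
by rewrite -(dual_flow0 Z) -(subrr t) dual_flowD h dual_flowz.
Qed.

Lemma trform_flow t X Z :
  trform (congruence (mxflow A t) X) Z = trform X (dual_flow t Z).
Proof. exact: trform_congruence. Qed.

Lemma dual_flow_mx_derive t Z :
  mx_derive (fun s => dual_flow s Z) t (adj_lyapunov A (dual_flow t Z)).
Proof.
have h := mx_derive_mul (mx_derive_mul (mx_derive_tr (mxflow_derive A t))
  (mx_derive_cst Z t)) (mxflow_derive A t).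
rewrite (_ : (fun s => _) =
    (fun s => (mxflow A s)^T *m Z *m mxflow A s)); last first.
  by apply/funext => s; rewrite /= trmxK.
apply: mx_derive_eq h _.
rewrite /= trmxK mulmx0 addr0 [in RHS]mulmxA [in X in _ + X]mxflow_comm.
by rewrite !mulmxA -trmx_mul -mxflow_comm.
Qed.

Lemma dual_flow_derive t Z :
  is_derive t (1 : R) (fun s => dual_flow s Z) (adj_lyapunov A (dual_flow t Z)).
Proof. exact/is_derive_symmx/dual_flow_mx_derive. Qed.

Lemma mxflow_continuous i j : continuous (fun t => mxflow A t i j).
Proof.
move=> t; apply: differentiable_continuous; apply/derivable1_diffP.
by have [] := mxflow_derive A t i j.
Qed.

(** The quadratic forms of [E_t gamma E_t^T] decrease in [t], because their
    derivatives are quadratic forms of [A gamma + gamma A^T]. *)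
Lemma psd_drift (gamma : S) t : psd_cone (neg_lyapunov A gamma) -> 0 <= t ->
  psd_cone (gamma - congruence (mxflow A t) gamma).
Proof.
move=> drift t0 v; rewrite -/(quadform v _) quadformD quadformN.
pose q s := quadform v (congruence (mxflow A s) gamma).
have dq s : is_derive s (1 : R) q
    (- quadform v (congruence (mxflow A s) (neg_lyapunov A gamma))).
  have h := mx_derive_mul (mx_derive_mul (mx_derive_cst v^T s)
    (mx_derive_mul (mx_derive_mul (mxflow_derive A s) (mx_derive_cst gamma s))
     (mx_derive_tr (mxflow_derive A s)))) (mx_derive_cst v s).
  have := h 0 0 => /is_derive_eq; apply.
  rewrite mulmx0 addr0 mul0mx add0r mulmx0 addr0 /quadform /=.
  set E := mxflow A s; have -> : A *m E *m gamma *m E^T + E *m gamma *m (A *m E)^T =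
      - (E *m (- (A *m gamma) - gamma *m A^T) *m E^T).
    rewrite trmx_mul mxflow_comm -/E mulmxBr mulmxN mulmxBl mulNmx opprB opprK.
    by rewrite addrC !mulmxA -!(mulmxA (E *m gamma)) -!trmx_mul mxflow_comm.
  by rewrite mulmxN mulNmx [LHS]mxE.
have q0 : q 0 = quadform v gamma by rewrite /q mxflow0 congruence1.
rewrite -q0 -/(q t).
have [c _ qE] := mean_value t0 dq.
rewrite -opprB qE -mulNr opprK subr0 mulr_ge0//.
exact: psd_congruence.
Qed.

Variable psi : S -> R[i].
Hypothesis psi_diff : forall Z, Z != 0 -> cdifferentiable psi Z.

(** By definition of [psi_L], the chain rule along the dual flow; the flow never
    reaches the origin, where [psi] need not be differentiable, unless it starts there. *)
Lemma is_derive_psi_flow Z t :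
  is_derive t (1 : R) (fun s => complex.Re (psi (dual_flow s Z)))
    (- complex.Re (psi_L A psi (dual_flow t Z))) /\
  is_derive t (1 : R) (fun s => complex.Im (psi (dual_flow s Z)))
    (- complex.Im (psi_L A psi (dual_flow t Z))).
Proof.
have [->|Z0] := eqVneq Z 0.
  rewrite dual_flowz /psi_L eqxx /= oppr0.
  split.
    rewrite (_ : (fun s => _) = cst (complex.Re (psi 0))); first exact: is_derive_cst.
    by apply/funext => s; rewrite dual_flowz.
  rewrite (_ : (fun s => _) = cst (complex.Im (psi 0))); first exact: is_derive_cst.
  by apply/funext => s; rewrite dual_flowz.
have Zt0 : dual_flow t Z != 0 by rewrite dual_flow_eq0.
have [dZ DZ] := dual_flow_derive t Z.
have dZ' : differentiable (fun s => dual_flow s Z) t by apply/derivable1_diffP.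
have dpsi := psi_diff Zt0.
pose p : S -> (R^o * R^o)%type := fun Y => plane (psi Y).
have dp : differentiable p (dual_flow t Z) := dpsi.
have dg := differentiable_comp dZ' dp.
have Dg : 'D_1 (p \o (fun s => dual_flow s Z)) t =
    'd p (dual_flow t Z) (adj_lyapunov A (dual_flow t Z)).
  by rewrite -DZ (deriveE _ dg) (deriveE _ dZ') diff_comp.
have cg : h^-1 *: ((p \o (fun s => dual_flow s Z)) (h *: (1:R) + t) -
    (p \o (fun s => dual_flow s Z)) t) @[h --> 0^'] -->
    'd p (dual_flow t Z) (adj_lyapunov A (dual_flow t Z)).
  by rewrite -Dg; apply/derivable1_diffP.
rewrite /psi_L (negbTE Zt0) /cdiff /= -/p.
set w := 'd p _ _ in cg *; rewrite !opprK.
have c1 := cvg_comp _ _ cg (@cvg_fst _ _ (nbhs w.1) (nbhs w.2) (nbhs_filter _)).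
have c2 := cvg_comp _ _ cg (@cvg_snd _ _ (nbhs w.1) (nbhs w.2) (nbhs_filter _)).
split.
  split; first by apply/cvg_ex; exists w.1.
  exact/cvg_lim.
split; first by apply/cvg_ex; exists w.2.
exact/cvg_lim.
Qed.

End dual_flow.

(** * Poisson approximation of infinitely divisible distributions *)

Lemma probability_of_measure (R : realType) (dT : measure_display)
    (T : measurableType dT) (x0 : T) (m : {measure set T -> \bar R}) :
  m setT = 1%E -> exists Q : probability T R, forall A, Q A = m A.
Proof.
move=> m1; exists (mnormalize m \d_x0) => A.
by rewrite /= /mnormalize m1 onee_eq0 /= invr1 mule1.
Qed.

Section atom_mixture.
Context (R : realType) (dT : measure_display) (T : measurableType dT).
Variables (nu : {measure set T -> \bar R}) (D : set T) (x0 : T).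
Hypotheses (mD : measurable D) (nuD : (nu D < +oo)%E).

Lemma bmeas_integrable_in (f : T -> R) : bmeas f -> nu.-integrable D (EFin \o f).
Proof.
move=> [mf [K fK]]; apply: measurable_bounded_integrable => //.
  exact: measurable_funS mf.
exists K; split; first exact: num_real.
by move=> M KM x _; exact: le_trans (fK x) (ltW KM).
Qed.

Lemma integral_restriction (f : T -> \bar R) : measurable_fun setT f ->
  (forall x, 0 <= f x)%E ->
  (\int[mrestr nu mD]_x f x = \int[nu]_(x in D) f x)%E.
Proof.
move=> mf f0; rewrite -(setUv D) ge0_integral_setU//; last 3 first.
- exact: measurableC.
- by rewrite setUv.
- exact/disj_setPCl.
rewrite [X in (_ + X)%E](_ : _ = 0%E) ?adde0; last first.
  apply: null_set_integral; first exact: measurableC.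
    exact: measurable_funS mf.
  by rewrite /= /mrestr setICl measure0.
apply: eq_measure_integral => A mA AD.
by rewrite /= /mrestr; congr (nu _); apply/setIidl.
Qed.

(** The law [(1 - nu D / N) delta + nu / N] on [D], one factor of a compound
    Poisson approximation. *)
Lemma atom_mixture (N : R) : 0 < N -> fine (nu D) <= N ->
  exists Q : probability T R, forall f, bmeas f ->
    \int[Q]_x f x = f x0 + N^-1 * \int[nu]_(x in D) (f x - f x0).
Proof.
move=> N0 nuN; set c := fine (nu D).
have nuDE : nu D = c%:E by rewrite fineK// ge0_fin_numE.
have c0 : 0 <= c by rewrite fine_ge0.
have p0 : 0 <= 1 - c / N by rewrite subr_ge0 ler_pdivrMr// mul1r.
have Ni0 : 0 <= N^-1 by rewrite invr_ge0 ltW.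
pose m : {measure set T -> \bar R} :=
  measure_add (mscale (NngNum p0) \d_x0) (mscale (NngNum Ni0) (mrestr nu mD)).
have m1 : m setT = 1%E.
  have -> : m setT = ((1 - c / N)%:E * \d_x0 setT + N^-1%:E * nu (setT `&` D))%E.
    exact: measure_addE.
  rewrite setTI nuDE diracT mule1 -EFinM -EFinD.
  by congr EFin; rewrite mulrC subrK.
have [Q QE] := probability_of_measure x0 m1.
have ge0 (g : T -> R) : bmeas g -> (forall x, 0 <= g x) ->
    \int[Q]_x g x = (1 - c / N) * g x0 + N^-1 * \int[nu]_(x in D) g x.
  move=> bg g0; have [mg _] := bg.
  have mg' : measurable_fun setT (EFin \o g) by exact/measurable_EFinP.
  have iD := integrable_fin_num mD (bmeas_integrable_in bg).
  have g0' x : (0 <= (EFin \o g) x)%E by rewrite lee_fin.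
  rewrite /Rintegral (eq_measure_integral m) => [|A _ _]; last exact: QE.
  rewrite /m ge0_integral_measure_add//; last by move=> x _; rewrite lee_fin.
  have g0'' x : setT x -> (0 <= (EFin \o g) x)%E by move=> _; exact: g0'.
  rewrite (ge0_integral_mscale _ measurableT _ mg' g0'').
  rewrite (ge0_integral_mscale _ measurableT _ mg' g0'').
  rewrite integral_dirac// diracT mul1e.
  by rewrite (integral_restriction mg' g0') -(fineK iD).
exists Q => f bf; have [mf [K fK]] := bf.
have bfK : bmeas (fun x => f x + K) := bmeasD bf (bmeas_cst _ K).
have h := ge0 _ bfK _; rewrite (expD Q bf (bmeas_cst _ K)) exp_cst in h.
have K0 x : 0 <= f x + K.
  by have := fK x; rewrite ler_norml => /andP[? _]; rewrite -lerBlDr sub0r.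
have {}h := h K0.
have i1 := bmeas_integrable_in (bmeasB bf (bmeas_cst _ (f x0))).
have i2 := bmeas_integrable_in (bmeas_cst _ (f x0 + K)).
have E : \int[nu]_(x in D) (f x + K) =
    \int[nu]_(x in D) (f x - f x0) + (f x0 + K) * c.
  rewrite -(Rintegral_cst nu mD (f x0 + K)) -(RintegralD mD i1 i2).
  by apply: eq_Rintegral => x _; ring.
apply: (@addIr _ K); rewrite h E; field.
by rewrite gt_eqF.
Qed.

End atom_mixture.

Section convolution_power.
Context (R : realType) (d : nat).
Local Notation S := (symmx R d).

(** Supermultiplicative functions, such as [exp (- s `|X|)] and the indicator of
    the cone, bound means under convolution powers from below. *)
Lemma exp_convolution_power_ge (P M : probability S R) n (f : S -> R) :
  (forall B, measurable B -> M B = convolution_power P n B) -> bmeas f ->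
  (forall X, 0 <= f X) -> 1 <= f 0 -> (forall X Y, f X * f Y <= f (X + Y)) ->
  (\int[P]_X f X) ^+ n <= \int[M]_X f X.
Proof.
move=> + bf f0 f1 fM; elim: n M => [|n IH] M ME.
  rewrite expr0 /Rintegral.
  rewrite (eq_measure_integral (\d_(0 : S))); last by move=> B mB _; exact: ME.
  rewrite integral_dirac//; last by apply/measurable_EFinP; have [] := bf.
  by rewrite diracT mul1e.
have [N [NE _]] := convolution_power_exists P n.
rewrite (@exp_convolution _ _ N P M f _ bf); last first.
  by move=> B mB; rewrite ME//=; apply: convolution_ext => // A mA; rewrite NE.
have bsum := bmeas_comp (@measurable_sum_prod R d) bf.
rewrite exprSr -expZ//; apply: le_exp; first exact: bmeasZ.
  exact: (bmeas_fubinir N P bsum).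
move=> y; rewrite (le_trans (ler_wpM2r (f0 y) (IH _ NE)))//.
rewrite mulrC -expZ//; apply: le_exp; [exact: bmeasZ| |].
  exact: (bmeas_sectionl _ bsum).
by move=> x; rewrite mulrC.
Qed.

End convolution_power.

(** ** The complex exponential *)

Section complex_exponential.
Context (R : realType).
Implicit Types z w : R[i].

Lemma Re_add z w : complex.Re (z + w) = complex.Re z + complex.Re w.
Proof. by case: z w => [? ?] [? ?]. Qed.

Lemma Im_add z w : complex.Im (z + w) = complex.Im z + complex.Im w.
Proof. by case: z w => [? ?] [? ?]. Qed.

Lemma complex_eq z w : complex.Re z = complex.Re w ->
  complex.Im z = complex.Im w -> z = w.
Proof. by case: z w => [? ?] [? ?] /= -> ->. Qed.

Lemma cexp0 : cexp (0 : R[i]) = 1.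
Proof. by rewrite /cexp /= expR0 cos0 sin0 mulr0 mulr1. Qed.

Lemma cexpD z w : cexp (z + w) = cexp z * cexp w.
Proof.
rewrite /cexp Re_add Im_add expRD cosD sinD.
by apply: complex_eq; rewrite /=; ring.
Qed.

Lemma cexp_neq0 z : cexp z != 0.
Proof.
apply/eqP => z0; have := cexpD z (- z); rewrite subrr cexp0 z0 mul0r.
by move/eqP; rewrite oner_eq0.
Qed.

Lemma cexpM_natl z n : cexp (z *+ n) = cexp z ^+ n.
Proof.
elim: n => [|n IH]; first by rewrite mulr0n expr0 cexp0.
by rewrite mulrS cexpD IH exprS.
Qed.

Definition rscale (a : R) z : R[i] := (a * complex.Re z) +i* (a * complex.Im z).

Lemma rscale_natl z n : rscale n%:R z = z *+ n.
Proof.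
elim: n => [|n IH]; first by rewrite /rscale !mul0r.
by rewrite [RHS]mulrS -IH; apply: complex_eq; case: z {IH} => x y /=; rewrite -natr1; ring.
Qed.

Lemma rscaleA a b z : rscale a (rscale b z) = rscale (a * b) z.
Proof. by rewrite /rscale /= !mulrA. Qed.

Lemma rscale1 z : rscale 1 z = z.
Proof. by case: z => x y; rewrite /rscale /= !mul1r. Qed.

Lemma cexp_derive z (t : R) :
  is_derive t (1 : R) (fun s => complex.Re (cexp (rscale s z)))
    (complex.Re (z * cexp (rscale t z))) /\
  is_derive t (1 : R) (fun s => complex.Im (cexp (rscale s z)))
    (complex.Im (z * cexp (rscale t z))).
Proof.
case: z => x y; rewrite /cexp /=.
have lin (a : R) : is_derive t (1 : R) (fun s : R => s * a) a.
  have h := @is_deriveZ _ _ _ (@id R) a t 1 1 (is_derive_id t 1).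
  rewrite (_ : (fun s => s * a) = a \*: (@id R)).
    by move: h => /is_derive_eq; apply; rewrite /GRing.scale/= mulr1.
  by apply/funext => s /=; rewrite mulrC.
have dE := @is_derive1_comp _ (@expR R) (fun s => s * x) t _ _ (is_derive_expR _) (lin x).
have dC := @is_derive1_comp _ (@cos R) (fun s => s * y) t _ _ (is_derive_cos _) (lin y).
have dS := @is_derive1_comp _ (@sin R) (fun s => s * y) t _ _ (is_derive_sin _) (lin y).
split.
  have := @is_deriveM _ _ _ _ t 1 _ _ dE dC => /is_derive_eq; apply.
  by rewrite /GRing.scale/=; ring.
have := @is_deriveM _ _ _ _ t 1 _ _ dE dS => /is_derive_eq; apply.
by rewrite /GRing.scale/=; ring.
Qed.

Lemma cexp_Re_le1 z : complex.Re z <= 0 -> `|complex.Re (cexp z)| <= 1.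
Proof.
move=> z0; rewrite /cexp /= normrM ger0_norm ?expR_ge0//.
rewrite -[1]mulr1; apply: ler_pM => //; first by rewrite -expR0 ler_expR.
by rewrite ler_norml cos_geN1 cos_le1.
Qed.

Lemma cexp_Im_le1 z : complex.Re z <= 0 -> `|complex.Im (cexp z)| <= 1.
Proof.
move=> z0; rewrite /cexp /= normrM ger0_norm ?expR_ge0//.
rewrite -[1]mulr1; apply: ler_pM => //; first by rewrite -expR0 ler_expR.
by rewrite ler_norml sin_geN1 sin_le1.
Qed.

Lemma ler_mulB (a b c e M N : R) : `|a| <= M -> `|b| <= N -> `|c| <= M ->
  `|e| <= N -> `|a * b - c * e| <= M * N *+ 2.
Proof.
move=> aM bN cM eN; rewrite mulr2n (le_trans (ler_normB _ _))// !normrM.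
by apply: lerD; exact: ler_pM.
Qed.

Lemma ler_mulD (a b c e M N : R) : `|a| <= M -> `|b| <= N -> `|c| <= M ->
  `|e| <= N -> `|a * b + c * e| <= M * N *+ 2.
Proof.
move=> aM bN cM eN; rewrite mulr2n (le_trans (ler_normD _ _))// !normrM.
by apply: lerD; exact: ler_pM.
Qed.

(** Two applications of the mean value theorem along [s |-> exp (s z)], whose
    modulus is at most one. *)
Lemma cexp_taylor1 z (M : R) : complex.Re z <= 0 ->
  `|complex.Re z| <= M -> `|complex.Im z| <= M ->
  `|complex.Re (cexp z - 1 - z)| <= M ^+ 2 *+ 4 /\
  `|complex.Im (cexp z - 1 - z)| <= M ^+ 2 *+ 4.
Proof.
move=> z0 zR zI; have M0 : 0 <= M := le_trans (normr_ge0 _) zR.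
have tz t : 0 <= t -> complex.Re (rscale t z) <= 0.
  by move=> t0; rewrite /= mulr_ge0_le0.
have ReM (w : R[i]) : complex.Re (z * w) =
    complex.Re z * complex.Re w - complex.Im z * complex.Im w.
  by case: z w {z0 zR zI tz} => ? ? [? ?].
have ImM (w : R[i]) : complex.Im (z * w) =
    complex.Re z * complex.Im w + complex.Im z * complex.Re w.
  by case: z w {z0 zR zI tz ReM} => ? ? [? ?].
have e0 : cexp (rscale 0 z) = 1 by rewrite /rscale !mul0r cexp0.
have first t : 0 <= t <= 1 ->
    `|complex.Re (cexp (rscale t z)) - 1| <= M *+ 2 /\
    `|complex.Im (cexp (rscale t z))| <= M *+ 2.
  move=> /andP[t0 t1].
  have [c /andP[c0 _] E] := mean_value t0 (fun s => (cexp_derive z s).1).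
  have [c' /andP[c'0 _] E'] := mean_value t0 (fun s => (cexp_derive z s).2).
  have e0R : complex.Re (cexp (rscale 0 z)) = 1 by rewrite e0.
  have e0I : complex.Im (cexp (rscale 0 z)) = 0 by rewrite e0.
  rewrite e0R !subr0 in E; rewrite e0I !subr0 in E'; rewrite E E' !normrM.
  rewrite (ger0_norm t0); split; rewrite -[leRHS]mulr1; apply: ler_pM => //.
    rewrite ReM -(mulr1 M); apply: ler_mulB => //.
      by apply: cexp_Re_le1; exact: tz.
    by apply: cexp_Im_le1; exact: tz.
  rewrite ImM -(mulr1 M); apply: ler_mulD => //.
    by apply: cexp_Im_le1; exact: tz.
  by apply: cexp_Re_le1; exact: tz.
have lin (a t : R) : is_derive t (1 : R) (fun s : R => s * a) a.
  have h := @is_deriveZ _ _ _ (@id R) a t 1 1 (is_derive_id t 1).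
  rewrite (_ : (fun s => s * a) = a \*: (@id R)).
    by move: h => /is_derive_eq; apply; rewrite /GRing.scale/= mulr1.
  by apply/funext => s /=; rewrite mulrC.
have [c c01 E] : exists2 c, 0 <= c <= 1 &
    (complex.Re (cexp (rscale 1 z)) - 1 * complex.Re z) -
    (complex.Re (cexp (rscale 0 z)) - 0 * complex.Re z) =
    (complex.Re (z * cexp (rscale c z)) - complex.Re z) * (1 - 0) :=
  mean_value (@ler01 R)
  (fun s => @is_deriveB _ _ _ _ _ s 1 _ _ (cexp_derive z s).1 (lin (complex.Re z) s)).
have [c' c'01 E'] : exists2 c, 0 <= c <= 1 &
    (complex.Im (cexp (rscale 1 z)) - 1 * complex.Im z) -
    (complex.Im (cexp (rscale 0 z)) - 0 * complex.Im z) =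
    (complex.Im (z * cexp (rscale c z)) - complex.Im z) * (1 - 0) :=
  mean_value (@ler01 R)
  (fun s => @is_deriveB _ _ _ _ _ s 1 _ _ (cexp_derive z s).2 (lin (complex.Im z) s)).
have sq : M ^+ 2 *+ 4 = M * (M *+ 2) *+ 2.
  by rewrite -[RHS]mulr_natl -[M *+ 2]mulr_natl -[LHS]mulr_natl; ring.
have [cR cI] := first c c01; have [cR' cI'] := first c' c'01.
rewrite sq; split.
  have -> : complex.Re (cexp z - 1 - z) = complex.Re z *
      (complex.Re (cexp (rscale c z)) - 1) - complex.Im z * complex.Im (cexp (rscale c z)).
    rewrite e0 rscale1 ReM in E; move: E.
    have -> : complex.Re (cexp z - 1 - z) = complex.Re (cexp z) - 1 - complex.Re z.
      by case: (cexp z) => a b; case: {+}z.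
    rewrite [complex.Re 1]/=; set u := cexp (rscale c z).
    move: (complex.Re u) (complex.Im u) (complex.Re (cexp z)) => C1 C2 C3 E; lra.
  exact: ler_mulB.
have -> : complex.Im (cexp z - 1 - z) = complex.Re z *
    complex.Im (cexp (rscale c' z)) + complex.Im z * (complex.Re (cexp (rscale c' z)) - 1).
  rewrite e0 rscale1 ImM in E'; move: E'.
  have -> : complex.Im (cexp z - 1 - z) = complex.Im (cexp z) - complex.Im z.
    by case: (cexp z) => a b; case: {+}z => a' b' /=; rewrite subr0.
  rewrite [complex.Im 1]/=; set u := cexp (rscale c' z).
  move: (complex.Re u) (complex.Im u) (complex.Im (cexp z)) => C1 C2 C3 EI; lra.
exact: ler_mulD.
Qed.

Lemma complex_normE z : `|z| = (Num.sqrt (complex.Re z ^+ 2 + complex.Im z ^+ 2))%:C.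
Proof. by case: z. Qed.

Lemma Re_le_norm z (a : R) : `|z| <= a%:C -> `|complex.Re z| <= a.
Proof.
rewrite complex_normE lecR => h; apply: le_trans h.
by rewrite -sqrtr_sqr ler_wsqrtr// lerDl sqr_ge0.
Qed.

Lemma Im_le_norm z (a : R) : `|z| <= a%:C -> `|complex.Im z| <= a.
Proof.
rewrite complex_normE lecR => h; apply: le_trans h.
by rewrite -sqrtr_sqr ler_wsqrtr// lerDr sqr_ge0.
Qed.

Lemma norm_le_ReIm z (a : R) : `|complex.Re z| <= a -> `|complex.Im z| <= a ->
  `|z| <= (a *+ 2)%:C.
Proof.
move=> za zb; have a0 : 0 <= a := le_trans (normr_ge0 _) za.
rewrite complex_normE lecR -[leRHS]ger0_norm ?mulrn_wge0// -sqrtr_sqr.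
apply: ler_wsqrtr; rewrite -(real_normK (num_real (complex.Re z))).
rewrite -(real_normK (num_real (complex.Im z))).
have h1 : `|complex.Re z| ^+ 2 <= a ^+ 2 by rewrite lerXn2r// nnegrE.
have h2 : `|complex.Im z| ^+ 2 <= a ^+ 2 by rewrite lerXn2r// nnegrE.
apply: (le_trans (lerD h1 h2)); rewrite exprMn_n -mulr2n.
by rewrite (_ : 2 ^ 2 = 2 + 2)%N// mulrnDr lerDl mulrn_wge0// sqr_ge0.
Qed.

Lemma cexp_norm z : `|cexp z| = (expR (complex.Re z))%:C.
Proof.
rewrite complex_normE /cexp /= !exprMn -mulrDr cos2Dsin2 mulr1 sqrtr_sqr.
by rewrite ger0_norm// expR_ge0.
Qed.

Lemma ler_norm_subX (K : numDomainType) (a b : K) n : `|a| <= 1 -> `|b| <= 1 ->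
  `|a ^+ n - b ^+ n| <= n%:R * `|a - b|.
Proof.
move=> a1 b1; elim: n => [|n IH]; first by rewrite subrr normr0 mul0r.
have -> : a ^+ n.+1 - b ^+ n.+1 = a * (a ^+ n - b ^+ n) + (a - b) * b ^+ n.
  by rewrite !exprS; ring.
have -> : n.+1%:R = n%:R + 1 :> K by rewrite natr1.
rewrite (le_trans (ler_normD _ _))// [leRHS]mulrDl mul1r !normrM; apply: lerD.
  by rewrite -[leRHS]mul1r; apply: ler_pM.
rewrite -[leRHS]mulr1; apply: ler_pM => //.
by rewrite normrX exprn_ile1.
Qed.

(** Compares [(1 + w / n) ^ n] with [exp (w / n) ^ n]; both bases lie in the unit
    disc, so the error is at most [n] times that of one factor. *)
Lemma cexp_euler (q w : R[i]) (n : nat) (M : R) : (0 < n)%N ->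
  q = 1 + rscale n%:R^-1 w -> `|q| <= 1 -> complex.Re w <= 0 ->
  `|complex.Re w| <= M -> `|complex.Im w| <= M ->
  `|complex.Re (q ^+ n - cexp w)| <= M ^+ 2 *+ 8 / n%:R /\
  `|complex.Im (q ^+ n - cexp w)| <= M ^+ 2 *+ 8 / n%:R.
Proof.
move=> n0 qE q1 w0 wR wI; pose z := rscale n%:R^-1 w.
have n0' : n%:R != 0 :> R by rewrite pnatr_eq0 -lt0n.
have ni0 : 0 <= n%:R^-1 :> R by rewrite invr_ge0.
have nz : w = z *+ n by rewrite -rscale_natl rscaleA divff// rscale1.
have z0 : complex.Re z <= 0 by rewrite /= mulr_ge0_le0.
have zR : `|complex.Re z| <= n%:R^-1 * M.
  by rewrite /= normrM ger0_norm// ler_wpM2l.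
have zI : `|complex.Im z| <= n%:R^-1 * M.
  by rewrite /= normrM ger0_norm// ler_wpM2l.
have [tR tI] := cexp_taylor1 z0 zR zI.
have b1 : `|cexp z| <= 1.
  by rewrite cexp_norm -(rmorph1 (real_complex R)) lecR -expR0 ler_expR.
have H : `|q ^+ n - cexp w| <= (M ^+ 2 *+ 8 / n%:R)%:C.
  rewrite nz cexpM_natl (le_trans (ler_norm_subX _ q1 b1))//.
  have := norm_le_ReIm tR tI.
  have -> : q - cexp z = - (cexp z - 1 - z) by rewrite qE -/z; ring.
  rewrite normrN => h; apply: (le_trans (ler_wpM2l (ler0n _ _) h)).
  rewrite -(rmorph_nat (real_complex R)) -rmorphM lecR le_eqVlt; apply/orP; left.
  apply/eqP; rewrite exprMn -mulrnA -[in LHS]mulr_natl -[in RHS]mulr_natl.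
  by field.
by split; [exact: Re_le_norm|exact: Im_le_norm].
Qed.

End complex_exponential.

(** ** Compound Poisson approximation *)

Section jump_measure.
Context (R : realType) (d : nat).
Local Notation S := (symmx R d).
Variable nu : {measure set S -> \bar R}.
Hypothesis nuI : (\int[nu]_X (Num.min 1 `|X|)%:E < +oo)%E.

(** Integrands such as [cos (trform X Z) - 1] and [sin (trform X Z)] are
    dominated by multiples of it. *)
Definition jump_bound (X : S) : R := Num.min 1 `|X|.

Lemma jump_bound_ge0 X : 0 <= jump_bound X.
Proof. by rewrite /jump_bound le_min ler01 normr_ge0. Qed.

Lemma measurable_jump_bound : measurable_fun setT jump_bound.
Proof. by apply: measurable_minr => //; exact: measurable_symmx_norm. Qed.

Lemma jump_bound_integrable : nu.-integrable setT (EFin \o jump_bound).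
Proof.
apply/integrableP; split.
  by apply/measurable_EFinP; exact: measurable_jump_bound.
rewrite (eq_integral (fun X => (jump_bound X)%:E)) => [|X _]; first exact: nuI.
by rewrite /= ger0_norm// jump_bound_ge0.
Qed.

Lemma jump_integrable (f : S -> R) (K : R) : measurable_fun setT f ->
  (forall X, `|f X| <= K * jump_bound X) -> nu.-integrable setT (EFin \o f).
Proof.
move=> mf fK; have iK := integrableZl measurableT K jump_bound_integrable.
apply: (le_integrable measurableT _ _ iK); first exact/measurable_EFinP.
by move=> X _; rewrite /= lee_fin (le_trans (fK X))// ler_norm.
Qed.

Lemma jump_cvg (fn : nat -> S -> R) (f : S -> R) (K : R) :
  (forall n, measurable_fun setT (fn n)) -> measurable_fun setT f ->
  (forall n X, `|fn n X| <= K * jump_bound X) ->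
  (forall X, fn n X @[n --> \oo] --> f X) ->
  \int[nu]_X fn n X @[n --> \oo] --> \int[nu]_X f X.
Proof.
move=> mfn mf fnK fnf.
have [] := @dominated_convergence _ _ _ nu setT measurableT
  (fun n => EFin \o fn n) (EFin \o f) (EFin \o (fun X => K * jump_bound X)).
- by move=> n; exact/measurable_EFinP.
- exact/measurable_EFinP.
- by apply: aeW => x _; apply: cvg_comp (fnf x) _; exact: cvg_refl.
- apply: (@jump_integrable _ `|K|).
    by apply: measurable_funM => //; exact: measurable_jump_bound.
  by move=> X; rewrite normrM (ger0_norm (jump_bound_ge0 _)).
- by apply: aeW => x n _; rewrite /= lee_fin.
move=> intf _ cvgI; rewrite /Rintegral.
apply: fine_cvg; rewrite fineK; last exact: integrable_fin_num.
exact: cvgI.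
Qed.

Definition big_jumps (j : nat) : set S := [set X | j.+1%:R^-1 < `|X|].

Lemma measurable_big_jumps j : measurable (big_jumps j).
Proof.
rewrite (_ : big_jumps j = (fun X : S => `|X|) @^-1` `]j.+1%:R^-1, +oo[%classic).
  by rewrite -[X in measurable X]setTI; apply: measurable_symmx_norm.
by apply/seteqP; split => X; rewrite /big_jumps /= in_itv/= andbT.
Qed.

Lemma big_jumps_finite j : (nu (big_jumps j) < +oo)%E.
Proof.
have mD := measurable_big_jumps j.
apply: (@le_lt_trans _ _ (\int[nu]_X (j.+1%:R * jump_bound X)%:E)%E); last first.
  have : nu.-integrable setT (EFin \o (fun X => j.+1%:R * jump_bound X)).
    apply: (@jump_integrable _ j.+1%:R).
      by apply: measurable_funM => //; exact: measurable_jump_bound.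
    by move=> X; rewrite ger0_norm// mulr_ge0// jump_bound_ge0.
  move=> /integrableP[_]; apply: le_lt_trans; apply: ge0_le_integral => //.
  - by move=> X _; rewrite lee_fin mulr_ge0// jump_bound_ge0.
  - apply/measurable_EFinP; apply: measurable_funM => //; exact: measurable_jump_bound.
  - apply: measurableT_comp => //; apply/measurable_EFinP.
    by apply: measurable_funM => //; exact: measurable_jump_bound.
  - by move=> X _; rewrite /= lee_fin ler_norm.
rewrite -(setIT (big_jumps j)) -integral_indic//; apply: ge0_le_integral => //.
- exact/measurable_EFinP/measurable_indic.
- apply/measurable_EFinP; apply: measurable_funM => //; exact: measurable_jump_bound.
move=> X _; rewrite lee_fin indicE; have [|_] := boolP (X \in _); last first.
  by rewrite mulr_ge0// jump_bound_ge0.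
rewrite inE /big_jumps /= => jX; rewrite /jump_bound minEle.
case: ifPn => [_|_]; first by rewrite mulr1 ler1n.
by rewrite -ler_pdivrMl// mulr1 ltW.
Qed.

Lemma big_jumps_cvg (f : S -> R) (K : R) : measurable_fun setT f ->
  (forall X, `|f X| <= K * jump_bound X) ->
  \int[nu]_(X in big_jumps j) f X @[j --> \oo] --> \int[nu]_X f X.
Proof.
move=> mf fK.
rewrite (_ : (fun j => _) = fun j => \int[nu]_X ((f \_ (big_jumps j)) X)); last first.
  by apply/funext => j; rewrite Rintegral_mkcond.
apply: (@jump_cvg _ _ K) => //.
- move=> j; apply/(measurable_restrictT f (measurable_big_jumps j)).
  exact: measurable_funS mf.
- move=> j X; rewrite patchE; case: ifP => // _.
  by rewrite normr0 (le_trans (normr_ge0 (f X))).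
move=> X; have [->|X0] := eqVneq X 0.
  have f0 : f 0 = 0.
    by apply/eqP; rewrite -normr_le0 (le_trans (fK 0))// /jump_bound normr0 min_r// mulr0.
  rewrite f0 (_ : (fun j => _) = cst 0); first exact: cvg_cst.
  by apply/funext => j; rewrite patchE f0 if_same.
apply: cvg_near_cst.
have Xp : 0 < `|X| by rewrite normr_gt0.
have h := @near_infty_natSinv_lt _ (PosNum Xp).
near=> j; rewrite patchE ifT// inE /big_jumps /=.
by near: j.
Unshelve. all: by end_near. Qed.

Lemma Rintegral_normr_le (D : set S) (f : S -> R) (K : R) : measurable D ->
  (nu D < +oo)%E -> bmeas f -> (forall X, `|f X| <= K) ->
  `|\int[nu]_(X in D) f X| <= K * fine (nu D).
Proof.
move=> mD nuD bf fK; have iK := bmeas_integrable_in mD nuD (bmeas_cst S K).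
have iN := bmeas_integrable_in mD nuD (bmeas_cst S (- K)).
have jf := bmeas_integrable_in mD nuD bf.
rewrite -(Rintegral_cst nu mD) ler_norml; apply/andP; split; last first.
  by apply: le_Rintegral => // X _; rewrite (le_trans (ler_norm _)).
have -> : - (\int[nu]_(X in D) K) = \int[nu]_(X in D) (- K).
  by rewrite !Rintegral_cst// mulNr.
by apply: le_Rintegral => // X _; have := fK X; rewrite ler_norml => /andP[].
Qed.

Lemma exp_sqr_le (P : probability S R) (f : S -> R) : bmeas f ->
  (\int[P]_X f X) ^+ 2 <= \int[P]_X (f X ^+ 2).
Proof.
move=> bf; set m := \int[P]_X f X.
have : 0 <= \int[P]_X (f X - m) ^+ 2 by apply: exp_ge0 => X; exact: sqr_ge0.
have -> : (fun X => (f X - m) ^+ 2) = fun X => f X ^+ 2 + (- (m *+ 2) * f X + m ^+ 2).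
  by apply/funext => X; rewrite -mulr_natl; ring.
have bX := bmeasX 2 bf; have bZ := bmeasZ (- (m *+ 2)) bf.
rewrite expD//; last by apply: bmeasD => //; exact: bmeas_cst.
rewrite (expD P bZ (bmeas_cst S (m ^+ 2))) expZ// exp_cst -/m.
move: (\int[P]_X f X ^+ 2) => e; rewrite -mulr_natl => h.
have -> : e = m ^+ 2 + (e + (- (2 * m) * m + m ^+ 2)) by ring.
by rewrite lerDl.
Qed.

Lemma charfun_norm_le1 (P : probability S R) (Z : S) : `|charfun P Z| <= 1.
Proof.
have bc := bmeas_cos_trform Z; have bs := bmeas_sin_trform Z.
rewrite charfunE complex_normE /= -(rmorph1 (real_complex R)) lecR.
rewrite -[leRHS]sqrtr1; apply: ler_wsqrtr.
rewrite (le_trans (lerD (exp_sqr_le P bc) (exp_sqr_le P bs)))//.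
rewrite -(expD P (bmeasX 2 bc) (bmeasX 2 bs)).
rewrite (_ : (fun X => _) = cst 1); first by rewrite exp_cst.
by apply/funext => X; rewrite cos2Dsin2.
Qed.

(** Logarithm of the characteristic function of the compound Poisson law with jumps in [D]. *)
Definition jump_exponent (D : set S) (Z : S) : R[i] :=
  (\int[nu]_(X in D) (cos (trform X Z) - 1)) +i* (\int[nu]_(X in D) sin (trform X Z)).

(** The [n]-th convolution power of [(1 - nu D / n) delta_0 + nu / n]. The lower
    bound on means uses [1 - y >= exp (- 2 y)] for [y <= 1 / 2]. *)
Lemma compound_poisson (D : set S) (e : R) : measurable D -> (nu D < +oo)%E ->
  0 < e -> exists M : probability S R,
  (forall Z,
    `|complex.Re (charfun M Z - cexp (jump_exponent D Z))| <= e /\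
    `|complex.Im (charfun M Z - cexp (jump_exponent D Z))| <= e) /\
  (forall f : S -> R, bmeas f -> (forall X, 0 <= f X <= 1) -> f 0 = 1 ->
    (forall X Y, f X * f Y <= f (X + Y)) ->
    expR (- (2 * \int[nu]_(X in D) (1 - f X))) <= \int[M]_X f X).
Proof.
move=> mD nuD e0; set c := fine (nu D).
have c0 : 0 <= c by rewrite fine_ge0.
(* Large enough for [atom_mixture], for [y <= 1 / 2] below, and for the error
   [32 c^2 / n] of [cexp_euler] to be at most [e]. *)
pose x := 2 * c + 32 * c ^+ 2 / e + 1.
have x1 : 0 <= 32 * c ^+ 2 / e.
  by rewrite divr_ge0 ?(ltW e0)// mulr_ge0// sqr_ge0.
have x0 : 0 <= x by rewrite /x; lra.
pose n := Num.bound x; have xn : x < n%:R := archi_boundP x0.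
have n0' : 0 < n%:R :> R by apply: le_lt_trans xn.
have n0 : (0 < n)%N by rewrite ltr0n in n0'.
have cn : c <= n%:R by rewrite /x in xn; lra.
have cn2 : 2 * c <= n%:R by rewrite /x in xn; lra.
have [Q QE] := atom_mixture (0 : S) mD nuD n0' cn.
have [M [ME Mc]] := convolution_power_exists Q n.
exists M; split=> [Z|f bf f01 f0 fM].
  have bc := bmeas_cos_trform Z; have bs := bmeas_sin_trform Z.
  have bc1 := bmeasB bc (bmeas_cst S 1).
  have qE : charfun Q Z = 1 + rscale n%:R^-1 (jump_exponent D Z).
    rewrite charfunE !QE// trform0l cos0 sin0.
    apply: complex_eq => //=; congr (_ + _ * _).
    by apply: eq_Rintegral => X _; rewrite subr0.
  have w0 : complex.Re (jump_exponent D Z) <= 0.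
    rewrite /= -oppr_ge0; have := @Rintegral_ge0 _ _ _ nu D (fun X => 1 - cos (trform X Z)).
    rewrite (_ : \int[nu]_(X in D) (1 - _) = - (\int[nu]_(X in D) (cos (trform X Z) - 1))).
      by apply => X _; rewrite subr_ge0 cos_le1.
    rewrite -[RHS]mulN1r -RintegralZl//; last exact: bmeas_integrable_in.
    by apply: eq_Rintegral => X _; ring.
  have wR : `|complex.Re (jump_exponent D Z)| <= 2 * c.
    apply: Rintegral_normr_le => // X; rewrite (le_trans (ler_normB _ _))// normr1.
    by rewrite -[leRHS]/(1 + 1 : R) lerD2r ler_norml cos_geN1 cos_le1.
  have wI : `|complex.Im (jump_exponent D Z)| <= 2 * c.
    apply: Rintegral_normr_le => // X.
    by rewrite (@le_trans _ _ 1)// ?ler1n// ler_norml sin_geN1 sin_le1.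
  have [hR hI] := cexp_euler n0 qE (charfun_norm_le1 Q Z) w0 wR wI.
  have be : (2 * c) ^+ 2 *+ 8 / n%:R <= e.
    rewrite ler_pdivrMr// -ler_pdivrMl// (le_trans _ (ltW xn))// /x.
    rewrite [leLHS](_ : _ = 32 * c ^+ 2 / e); first by lra.
    by rewrite -mulr_natl; field; rewrite gt_eqF.
  by rewrite Mc; split; [exact: le_trans hR be|exact: le_trans hI be].
have f0' X : 0 <= f X by have /andP[] := f01 X.
have f1' X : f X <= 1 by have /andP[] := f01 X.
have f11 : 1 <= f 0 by rewrite f0.
have := exp_convolution_power_ge ME bf f0' f11 fM; apply: le_trans.
set a := \int[nu]_(X in D) (1 - f X).
have bf1 : bmeas (fun X => 1 - f X) := bmeasB (bmeas_cst S 1) bf.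
have -> : \int[Q]_X f X = 1 - a / n%:R.
  rewrite QE// f0; congr (_ + _); rewrite mulrC -mulNr; congr (_ * _).
  rewrite /a -[RHS]mulN1r -RintegralZl//; last exact: bmeas_integrable_in.
  by apply: eq_Rintegral => X _; ring.
have a0 : 0 <= a by apply: Rintegral_ge0 => X _; rewrite subr_ge0.
have ac : a <= c.
  rewrite -[leRHS]mul1r (le_trans (ler_norm _))//.
  by apply: Rintegral_normr_le => // X; rewrite ger0_norm ?subr_ge0// lerBlDr lerDl.
pose y := a / n%:R; have y0 : 0 <= y by rewrite divr_ge0// ltW.
have y12 : y <= 2^-1 by rewrite ler_pdivrMr// ler_pdivlMl//; lra.
have step : expR (- (2 * y)) <= 1 - y.
  have h := expR_ge1Dx (2 * y); rewrite expRN.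
  have p : 0 < 1 + 2 * y by lra.
  apply: (@le_trans _ _ (1 + 2 * y)^-1); first by rewrite lef_pV2// posrE ?expR_gt0.
  by rewrite -[leLHS]mul1r ler_pdivrMr//; nra.
rewrite [leLHS](_ : _ = expR (- (2 * y)) ^+ n).
  by apply: lerXn2r => //; rewrite nnegrE ?expR_ge0//; apply: le_trans step; exact: expR_ge0.
rewrite -expRM_natl; congr expR; rewrite /y; field.
by rewrite gt_eqF.
Qed.

End jump_measure.

(** * Supports *)

Section supports.
Context (R : realType) (d : nat).
Local Notation S := (symmx R d).
Implicit Types P Q : probability S R.

Lemma charfun_continuous0 P (e : R) : 0 < e -> exists2 del, 0 < del &
  forall Z, `|Z| <= del -> 1 - complex.Re (charfun P Z) <= e.
Proof.
move=> e0; pose C : R := d%:R ^+ 2.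
have C0 : 0 <= C by rewrite sqr_ge0.
pose g (n : nat) (X : S) : R := Num.min 2 (C * n.+1%:R^-1 * `|X|).
have mg n : measurable_fun setT (g n).
  apply: measurable_minr => //; apply: measurable_funM => //.
  exact: measurable_symmx_norm.
have g0 n X : 0 <= g n X by rewrite le_min ler0n !mulr_ge0.
have bg n X : `|g n X| <= 2 by rewrite ger0_norm// ge_min lexx.
have gcvg X : g n X @[n --> \oo] --> (0 : R).
  have h : C * n.+1%:R^-1 * `|X| @[n --> \oo] --> (0 : R).
    rewrite -(mul0r `|X|) -(mulr0 C); apply: cvgMl; apply: cvgMr.
    exact: (@cvg_harmonic R).
  apply: (squeeze_cvgr _ (@cvg_cst _ (0 : R) _ \oo _) h).
  by apply: filterE => n; rewrite g0 ge_min lexx orbT.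
have := @exp_cvg _ _ _ P g (cst 0) 2 mg (@measurable_cst _ _ _ _ _ _) bg gcvg.
rewrite exp_cst => /cvgr0_norm_le /(_ e e0) [N _ gN'].
have gN : `|\int[P]_X g N X| <= e := gN' N (leqnn N).
exists N.+1%:R^-1 => [|Z ZN]; first by rewrite invr_gt0.
have bc := bmeas_cos_trform Z.
have bgN : bmeas (g N) by split => //; exists 2.
rewrite charfunE [complex.Re _]/= -[X in X - _](exp_cst P 1).
rewrite -expB//; last exact: bmeas_cst.
apply: le_trans (le_trans (ler_norm _) gN); apply: le_exp => //.
  by apply: bmeasB => //; exact: bmeas_cst.
move=> X; rewrite /g le_min; apply/andP; split.
  by rewrite lerBlDr -lerBlDl; have := cos_geN1 (trform X Z); lra.
have lip : `|cos (trform X Z) - cos 0| <= 1 * `|trform X Z - 0|.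
  apply: (@derive_lipschitz _ _ (fun x => - sin x)) => x.
  by rewrite normrN ler_norml sin_geN1 sin_le1.
rewrite mul1r subr0 cos0 distrC in lip.
apply: (le_trans (ler_norm _)); apply: (le_trans lip).
apply: (le_trans (trform_le X Z)); apply: ler_wpM2r => //.
by rewrite ler_wpM2l.
Qed.

(** A test function that vanishes exactly on the half-space of [v]. *)
Definition negative_part (v : 'cV[R]_d) (X : S) : R :=
  Num.min 1 (Num.max 0 (- quadform v X)).

Lemma negative_part_ge0 v X : 0 <= negative_part v X.
Proof. by rewrite /negative_part le_min ler01 le_max lexx. Qed.

Lemma negative_part_eq0 v X : negative_part v X = 0 -> 0 <= quadform v X.
Proof.
rewrite /negative_part; move: (quadform v X) => q.
by rewrite /Num.min /Num.max; case: ltP => h1; case: ltP => h2 h; lra.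
Qed.

Lemma negative_part0 v X : psd_cone X -> negative_part v X = 0.
Proof.
move=> /(_ v); rewrite -/(quadform v X) /negative_part => q0.
by rewrite max_l ?oppr_le0// min_r.
Qed.

Lemma blip_negative_part v : blip (negative_part v).
Proof.
split.
  by exists 1 => X; rewrite ger0_norm ?negative_part_ge0// ge_min lexx.
exists (\sum_i \sum_j `|v i 0| * `|v j 0|) => [|X Y].
  by apply: sumr_ge0 => i _; apply: sumr_ge0 => j _; rewrite mulr_ge0.
apply: le_trans (quadform_le v (X - Y)).
have -> : quadform v (X - Y) = quadform v X - quadform v Y.
  by rewrite -quadformN -quadformD.
apply: (le_trans (dist_clamp _ _ _ _)).
by rewrite opprK addrC distrC.
Qed.

(** The cone is the common zero set of the countably many test functions
    [negative_part v] with rational [v]. *)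
Lemma psd_cone_limit (Pn : nat -> probability S R) Q :
  (forall n, Pn n psd_cone = 1%E) ->
  (forall g a, blip g -> (forall n, \int[Pn n]_X g X <= a) -> \int[Q]_X g X <= a) ->
  Q psd_cone = 1%E.
Proof.
move=> Pn1 QP; have mcone := @measurable_psd_cone R d.
apply: ae_probability1 => //.
have qv (v : 'cV[rat]_d) : {ae Q, forall X : S, 0 <= quadform (map_mx ratr v) X}.
  have bh := blip_negative_part (map_mx ratr v).
  have := exp0_ae (blip_bmeas bh) (negative_part_ge0 _).
  move=> /(_ Q) h; apply: ae_sub (h _) => [X|]; first exact: negative_part_eq0.
  apply/eqP; rewrite eq_le exp_ge0 ?andbT//; last exact: negative_part_ge0.
  apply: QP => // n; rewrite (@exp_ae_cst _ _ _ _ _ 0)//.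
    by have [] := blip_bmeas bh.
  apply: ae_sub (probability1_ae mcone (Pn1 n)) => X.
  exact: negative_part0.
have : {ae Q, forall X : S, forall n, 0 <=
    quadform (map_mx ratr (odflt 0 (unpickle n) : 'cV[rat]_d)) X}.
  by apply/ae_foralln => n; exact: qv.
apply: ae_sub => X h; apply: psd_cone_rat => v.
by have := h (pickle v); rewrite pickleK.
Qed.

Lemma indic_psd_coneM (X Y : S) :
  (\1_(psd_cone : set S) X : R) * \1_(psd_cone : set S) Y <= \1_(psd_cone : set S) (X + Y).
Proof.
rewrite !indicE; case: (boolP (X \in _)) => [|_]; last by rewrite mul0r.
case: (boolP (Y \in _)) => [|_]; last by rewrite mulr0.
by rewrite !inE => Yp Xp; rewrite mem_set ?mulr1//; exact: psd_coneD.
Qed.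

Lemma indic_psd_cone0 : (\1_(psd_cone : set S) 0 : R) = 1.
Proof. by rewrite indicE mem_set//; exact: psd_cone0. Qed.

Lemma psd_cone_expP P : 1 <= \int[P]_X (\1_(psd_cone : set S) X) -> P psd_cone = 1%E.
Proof.
have mcone := @measurable_psd_cone R d; rewrite exp_indic// => h.
have f : P psd_cone \is a fin_num by exact: fin_num_measure.
apply/eqP; rewrite eq_le probability_le1//=.
by rewrite -(fineK f) lee_fin.
Qed.

(** The indicator of the cone is supermultiplicative, the cone being closed under sums. *)
Lemma convolution_power_psd P (M : probability S R) n : P psd_cone = 1%E ->
  (forall B, measurable B -> M B = convolution_power P n B) -> M psd_cone = 1%E.
Proof.
move=> P1 ME; have mcone := @measurable_psd_cone R d.
apply: psd_cone_expP.
apply: le_trans (exp_convolution_power_ge ME (bmeas_indic _ mcone) _ _ _).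
- by rewrite exp_indic// P1 expr1n.
- by move=> X; rewrite indicE.
- by rewrite indic_psd_cone0.
- exact: indic_psd_coneM.
Qed.

End supports.

Section subordinator_support.
Context (R : realType) (d : nat).
Local Notation S := (symmx R d).
Variable nu : {measure set S -> \bar R}.
Hypothesis nuI : (\int[nu]_X (Num.min 1 `|X|)%:E < +oo)%E.
Hypothesis nu_psd : nu (~` psd_cone) = 0%E.

Let D := @big_jumps R d.
Let mD := @measurable_big_jumps R d.
Let nuD := big_jumps_finite nuI.

Lemma cos_jump_bound (Z X : S) :
  `|cos (trform X Z) - 1| <= (2 + d%:R ^+ 2 * `|Z|) * jump_bound X.
Proof.
set C := d%:R ^+ 2 * `|Z|; have C0 : 0 <= C by rewrite mulr_ge0// sqr_ge0.
have lip : `|cos (trform X Z) - cos 0| <= 1 * `|trform X Z - 0|.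
  apply: (@derive_lipschitz _ _ (fun x => - sin x)) => x.
  by rewrite normrN ler_norml sin_geN1 sin_le1.
rewrite mul1r subr0 cos0 in lip.
rewrite /jump_bound minEle; case: ifPn => _.
  rewrite mulr1 (le_trans (ler_normB _ _))// normr1.
  have : `|cos (trform X Z)| <= 1 by rewrite ler_norml cos_geN1 cos_le1.
  by move: (`|cos _|) => u; lra.
apply: (le_trans lip); apply: (le_trans (trform_le X Z)).
by rewrite ler_wpM2r// lerDr.
Qed.

Lemma sin_jump_bound (Z X : S) :
  `|sin (trform X Z)| <= (2 + d%:R ^+ 2 * `|Z|) * jump_bound X.
Proof.
set C := d%:R ^+ 2 * `|Z|; have C0 : 0 <= C by rewrite mulr_ge0// sqr_ge0.
have lip : `|sin (trform X Z) - sin 0| <= 1 * `|trform X Z - 0|.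
  apply: (@derive_lipschitz _ _ cos) => x.
  by rewrite ler_norml cos_geN1 cos_le1.
rewrite mul1r sin0 !subr0 in lip.
rewrite /jump_bound minEle; case: ifPn => _.
  rewrite mulr1; have : `|sin (trform X Z)| <= 1 by rewrite ler_norml sin_geN1 sin_le1.
  by move: (`|sin _|) => u; lra.
apply: (le_trans lip); apply: (le_trans (trform_le X Z)).
by rewrite ler_wpM2r// lerDr.
Qed.

Lemma cexp_cvg (T : Type) (F : set_system T) {FF : Filter F} (u : T -> R[i]) (l : R[i]) :
  (fun n => complex.Re (u n)) @ F --> complex.Re l ->
  (fun n => complex.Im (u n)) @ F --> complex.Im l ->
  (fun n => complex.Re (cexp (u n))) @ F --> complex.Re (cexp l) /\
  (fun n => complex.Im (cexp (u n))) @ F --> complex.Im (cexp l).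
Proof.
move=> uR uI; have e := cvg_comp _ _ uR (@continuous_expR R (complex.Re l)).
have c := cvg_comp _ _ uI (@continuous_cos R (complex.Im l)).
have s := cvg_comp _ _ uI (@continuous_sin R (complex.Im l)).
by split; rewrite /cexp /=; [exact: cvgM e c|exact: cvgM e s].
Qed.

Lemma jump_exponent_cvg Z :
  (fun j => complex.Re (jump_exponent nu (D j) Z)) @ \oo -->
    complex.Re (jump_exponent nu setT Z) /\
  (fun j => complex.Im (jump_exponent nu (D j) Z)) @ \oo -->
    complex.Im (jump_exponent nu setT Z).
Proof.
split; rewrite /jump_exponent /=.
  apply: (big_jumps_cvg nuI) (cos_jump_bound Z).
  by apply: measurable_funB => //; have [] := bmeas_cos_trform Z.
apply: (big_jumps_cvg nuI) (sin_jump_bound Z).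
by have [] := bmeas_sin_trform Z.
Qed.

(** Supermultiplicative by the triangle inequality. *)
Definition laplace (n : nat) (X : S) : R := expR (- (n.+1%:R * `|X|)).

Lemma laplace_bounds n X : 0 <= laplace n X <= 1.
Proof. by rewrite /laplace expR_ge0 -expR0 ler_expR oppr_le0 mulr_ge0. Qed.

Lemma blip_laplace n : blip (laplace n).
Proof.
split; first by exists 1 => X; have /andP[? ?] := laplace_bounds n X; rewrite ger0_norm.
exists n.+1%:R => // X Y; rewrite /laplace.
have mono (a b : R) : 0 <= a -> a <= b ->
    `|expR (- (n.+1%:R * a)) - expR (- (n.+1%:R * b))| <= n.+1%:R * (b - a).
  move=> a0 ab; set x := n.+1%:R * a; set y := n.+1%:R * b.
  have xy : x <= y by rewrite ler_wpM2l.
  have x0 : 0 <= x by rewrite mulr_ge0.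
  have -> : n.+1%:R * (b - a) = y - x by rewrite mulrBr.
  rewrite ger0_norm ?subr_ge0 ?ler_expR ?lerN2//.
  have -> : expR (- y) = expR (- x) * expR (- (y - x)) by rewrite -expRD; congr expR; ring.
  have h := expR_ge1Dx (- (y - x)).
  have ex1 : expR (- x) <= 1 by rewrite -expR0 ler_expR oppr_le0.
  have ex0 : 0 <= expR (- x) by exact: expR_ge0.
  rewrite -[X in X - _]mulr1 -mulrBr.
  have yx : 0 <= y - x by rewrite subr_ge0.
  rewrite -[leRHS]mul1r; apply: (@le_trans _ _ (expR (- x) * (y - x))).
    by apply: ler_wpM2l => //; rewrite lerBlDr -lerBlDl; rewrite addrC in h; lra.
  exact: ler_wpM2r.
have dist := ler_dist_dist X Y.
case: (leP `|X| `|Y|) => h.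
  apply: (le_trans (mono _ _ (normr_ge0 X) h)); apply: ler_wpM2l => //.
  by apply: le_trans dist; rewrite distrC ler_norm.
rewrite distrC; apply: (le_trans (mono _ _ (normr_ge0 Y) (ltW h))); apply: ler_wpM2l => //.
by apply: le_trans dist; rewrite ler_norm.
Qed.

Lemma laplace_jump_bound n X : `|(1 - laplace n X) / n.+1%:R| <= 1 * jump_bound X.
Proof.
have /andP[l0 l1] := laplace_bounds n X.
rewrite ger0_norm ?divr_ge0 ?subr_ge0// mul1r /jump_bound le_min.
rewrite !ler_pdivrMr// mul1r; apply/andP; split.
  by apply: (@le_trans _ _ 1); [rewrite lerBlDr lerDl|rewrite ler1n].
rewrite lerBlDr -lerBlDl mulrC.
by have := expR_ge1Dx (- (n.+1%:R * `|X|)); rewrite -/(laplace n X); lra.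
Qed.

(** Big jumps give compound Poisson laws carried by the cone. The mean of
    [laplace n] under the limit is at least [exp (- 2 (n + 1) a_n)] with
    [a_n] tending to zero, whereas it would be at most [exp (- (n + 1) e)]
    if no mass lay within [e] of the origin. *)
Lemma compound_limit (Q : probability S R) : (forall Z, charfun Q Z = cexp (jump_exponent nu setT Z)) ->
  Q psd_cone = 1%E /\ forall e, 0 < e -> Q [set X : S | `|X| < e] != 0%E.
Proof.
move=> Qc; have mcone := @measurable_psd_cone R d.
have M_ j : {M : probability S R |
  (forall Z,
    `|complex.Re (charfun M Z - cexp (jump_exponent nu (D j) Z))| <= j.+1%:R^-1 /\
    `|complex.Im (charfun M Z - cexp (jump_exponent nu (D j) Z))| <= j.+1%:R^-1) /\
  (forall f : S -> R, bmeas f -> (forall X, 0 <= f X <= 1) -> f 0 = 1 ->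
    (forall X Y, f X * f Y <= f (X + Y)) ->
    expR (- (2 * \int[nu]_(X in D j) (1 - f X))) <= \int[M]_X f X)}.
  by apply: cid; apply: compound_poisson; rewrite ?invr_gt0//; exact: nuD.
pose Pn j := sval (M_ j).
have Pc j := (svalP (M_ j)).1; have Pf j := (svalP (M_ j)).2.
have near (u w : nat -> R) (l : R) : (forall j, `|u j - w j| <= j.+1%:R^-1) ->
    w @ \oo --> l -> u @ \oo --> l.
  move=> uw wl; have h : (fun j => u j - w j) @ \oo --> (0 : R).
    apply/cvgr0Pnorm_le => e e0.
    have := @cvg_harmonic R => /cvgr0_norm_le /(_ e e0); apply: filterS => j /= je.
    by apply: (le_trans (uw j)); apply: le_trans je; rewrite ler_norm.
  rewrite (_ : u = fun j => (u j - w j) + w j); last by apply/funext => j; rewrite subrK.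
  by rewrite -[l]add0r; exact: (@cvgD _ _ _ \oo eventually_filter _ _ _ _ h wl).
have ReB (z w : R[i]) : complex.Re (z - w) = complex.Re z - complex.Re w.
  by case: z w => ? ? [? ?].
have ImB (z w : R[i]) : complex.Im (z - w) = complex.Im z - complex.Im w.
  by case: z w => ? ? [? ?].
have cR Z : (fun n => complex.Re (charfun (Pn n) Z)) @ \oo --> complex.Re (charfun Q Z).
  have [jR jI] := jump_exponent_cvg Z; rewrite Qc.
  apply: near (cexp_cvg jR jI).1 => j; rewrite -ReB; exact: (Pc j Z).1.
have cI Z : (fun n => complex.Im (charfun (Pn n) Z)) @ \oo --> complex.Im (charfun Q Z).
  have [jR jI] := jump_exponent_cvg Z; rewrite Qc.
  apply: near (cexp_cvg jR jI).2 => j; rewrite -ImB; exact: (Pc j Z).2.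
have [Q' [Q'c Q'P]] := levy_continuity cR cI (@charfun_continuous0 _ _ Q).
have QQ' := charfun_inj Q'c.
have QP (g : S -> R) a : blip g -> (forall n, \int[Pn n]_X g X <= a) -> \int[Q]_X g X <= a.
  move=> bg ga; rewrite /Rintegral (eq_measure_integral Q'); first exact: Q'P.
  by move=> B mB _; apply: esym; exact: QQ'.
split.
  apply: (psd_cone_limit _ QP) => j; apply: psd_cone_expP.
  apply: le_trans (Pf j _ (bmeas_indic _ mcone) _ (@indic_psd_cone0 R d) (@indic_psd_coneM R d)).
    rewrite (_ : \int[nu]_(X in D j) _ = 0) ?mulr0 ?oppr0 ?expR0//.
    rewrite (@eq_Rintegral _ _ _ nu (D j) (\1_(~` (psd_cone : set S)))); last first.
      by move=> X _; rewrite !indicE in_setC; case: (X \in _); rewrite ?subrr ?subr0.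
    rewrite /Rintegral integral_indic//; last exact: measurableC.
    rewrite (@subset_measure0 _ _ _ nu _ (~` psd_cone))//.
      by apply: measurableI; [exact: measurableC|exact: mD].
    exact: measurableC.
  by move=> X; rewrite indicE; case: (X \in _); rewrite ?lexx ler01.
move=> e e0; apply/negP => /eqP Qe.
(* After division by [n + 1] the integrands are dominated by [jump_bound]. *)
pose a n := \int[nu]_X ((1 - laplace n X) / n.+1%:R).
have bl n := blip_bmeas (blip_laplace n).
have ml n : measurable_fun setT (fun X => (1 - laplace n X) / n.+1%:R).
  apply: measurable_funM => //; apply: measurable_funB => //.
  by have [] := bl n.
have a0 : a @ \oo --> (0 : R).
  have := @jump_cvg _ _ _ nuI _ (cst 0) 1 ml (@measurable_cst _ _ _ _ _ _) laplace_jump_bound.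
  rewrite (_ : \int[nu]_X cst 0 X = 0); last first.
    by rewrite /Rintegral integral0.
  apply => X; apply: (squeeze_cvgr _ (@cvg_cst _ (0 : R) _ \oo _) (@cvg_harmonic R)).
  apply: filterE => n; have /andP[l0 l1] := laplace_bounds n X.
  rewrite divr_ge0 ?subr_ge0//= /harmonic -[leRHS]mul1r; apply: ler_wpM2r => //.
  by rewrite lerBlDr lerDl.
have low n : expR (- (2 * (n.+1%:R * a n))) <= \int[Q]_X laplace n X.
  rewrite -lerN2.
  have -> : - (\int[Q]_X laplace n X) = \int[Q]_X (-1 * laplace n X).
    by rewrite expZ// mulN1r.
  apply: QP => [|j].
    have [[K lK] [L L0 lL]] := blip_laplace n; split.
      by exists K => X; rewrite mulN1r normrN.
    by exists L => // X Y; rewrite !mulN1r -opprD normrN.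
  rewrite expZ// mulN1r lerN2.
  apply: le_trans (Pf j _ (bl n) (laplace_bounds n) _ _).
  - rewrite ler_expR lerN2 ler_wpM2l//.
    have -> : n.+1%:R * a n = \int[nu]_X (1 - laplace n X).
      rewrite /a -RintegralZl//; last exact: (jump_integrable nuI (ml n) (laplace_jump_bound n)).
      by apply: eq_Rintegral => X _; rewrite mulrC divfK// pnatr_eq0.
    have i1 : nu.-integrable setT (EFin \o (fun X => 1 - laplace n X)).
      apply: (@jump_integrable _ _ nu nuI _ n.+1%:R).
        by apply: measurable_funB => //; have [] := bl n.
      move=> X; have := laplace_jump_bound n X.
      rewrite normrM (ger0_norm (_ : 0 <= n.+1%:R^-1))// mul1r ler_pdivrMr//.
      by rewrite mulrC.
    have i2 := integrableS measurableT (mD j) (@subsetT _ _) i1.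
    apply: fine_le; [exact: integrable_fin_num i2|exact: integrable_fin_num i1|].
    apply: ge0_subset_integral => //.
      by have /integrableP[] := i1.
    by move=> X _; rewrite /= lee_fin subr_ge0; have /andP[] := laplace_bounds n X.
  - by rewrite /laplace normr0 mulr0 oppr0 expR0.
  - move=> X Y; rewrite /laplace -expRD ler_expR -opprD lerN2 -mulrDr.
    by rewrite ler_wpM2l// ler_normD.
have high n : \int[Q]_X laplace n X <= expR (- (n.+1%:R * e)).
  rewrite -[leRHS](exp_cst Q); apply: le_exp_ae => //; first exact: bmeas_cst.
  exists [set X | `|X| < e]; split => //.
    rewrite (_ : [set X | _] = (fun X : S => `|X|) @^-1` `]-oo, e[%classic).
      by rewrite -[X in measurable X]setTI; apply: measurable_symmx_norm.
    by apply/seteqP; split => X; rewrite /= in_itv.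
  move=> X /= h; rewrite ltNge; apply/negP => eX; apply: h.
  by rewrite /laplace ler_expR lerN2 ler_wpM2l.
have ae n : e / 2 <= a n.
  have := le_trans (low n) (high n); rewrite ler_expR lerN2 mulrCA ler_pM2l//.
  by rewrite ler_pdivrMr// mulrC.
have /cvgr0_norm_lt /(_ _ (divr_gt0 e0 (ltr0n R 2))) [N _ /(_ N (leqnn N))] /= := a0.
by rewrite ltNge => /negP; apply; apply: le_trans (ae N) (ler_norm _).
Qed.

End subordinator_support.

(** * The factors of a self-decomposable law and the law of the driving process *)

Lemma indic_preimage (R : realType) (T U : Type) (f : T -> U) (G : set U) :
  (\1_(f @^-1` G) : T -> R) = fun x => \1_G (f x).
Proof.
by apply/funext => x; rewrite !indicE; congr (_%:R).
Qed.

Section selfdecomposable.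
Context (R : realType) (d : nat).
Local Notation S := (symmx R d).
Variables (bA : {linear S -> S}) (A : 'M[R]_d).
Hypothesis bAE : forall X : S, bA X = A *m X + X *m A^T :> 'M[R]_d.
Variable mu : probability S R.
Hypothesis mu_osd : operator_selfdecomposable bA mu.
Variables (gamma : S) (nu : {measure set S -> \bar R}).
Hypothesis nu_levy : levy_measure nu.
Hypothesis nu_psd : nu (~` psd_cone) = 0%E.
Hypothesis nu_fv : (\int[nu]_(X in [set X : S | (`|X| <= 1)%R]) `|X|%:E < +oo)%E.
Hypothesis mu_charfun : forall Z : S,
  charfun mu Z = cexp (subordinator_exponent gamma nu Z).
Variable psi : S -> R[i].
Hypothesis psi_cumulant : cumulant_transform mu psi.
Hypothesis drift_psd : psd_cone (neg_lyapunov A gamma).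
Hypothesis psi_diff : forall Z : S, Z != 0 -> cdifferentiable psi Z.
Hypothesis psi_L_cont : ccontinuous_at (psi_L A psi) 0.

Lemma jump_bound_finite : (\int[nu]_X (Num.min 1 `|X|)%:E < +oo)%E.
Proof.
have [_ nu2] := nu_levy.
pose B := [set X : S | `|X| <= 1].
have mB : measurable B.
  rewrite (_ : B = (fun X : S => `|X|) @^-1` `]-oo, 1%R]%classic).
    by rewrite -[X in measurable X]setTI; apply: measurable_symmx_norm.
  by apply/seteqP; split => X; rewrite /B /= in_itv.
have mN : measurable_fun setT (fun X : S => (`|X|)%:E).
  by apply/measurable_EFinP; exact: measurable_symmx_norm.
have m1 : measurable_fun setT (fun X : S => (Num.min 1 (`|X| ^+ 2))%:E).
  apply/measurable_EFinP; apply: measurable_minr => //.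
  by apply: measurable_funX; exact: measurable_symmx_norm.
have m2 : measurable_fun setT ((fun X : S => (`|X|)%:E) \_ B).
  by apply/(measurable_restrictT _ mB); exact: measurable_funS mN.
apply: (@le_lt_trans _ _ (\int[nu]_X
    ((Num.min 1 (`|X| ^+ 2))%:E + ((fun X : S => (`|X|)%:E) \_ B) X))%E).
  apply: ge0_le_integral => //.
  - apply/measurable_EFinP; apply: measurable_minr => //.
    exact: measurable_symmx_norm.
  - exact: emeasurable_funD.
  move=> X _; rewrite patchE; case: ifPn => [_|].
    rewrite -EFinD lee_fin; apply: (@le_trans _ _ `|X|); first by rewrite ge_min lexx orbT.
    by rewrite lerDr le_min ler01 sqr_ge0.
  rewrite notin_setE /B /= => /negP; rewrite -ltNge => X1.
  have X2 : 1 < `|X| ^+ 2 by rewrite exprn_egt1.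
  by rewrite adde0 lee_fin (min_l (ltW X1)) (min_l (ltW X2)).
rewrite ge0_integralD//; last by move=> X _; rewrite patchE; case: ifP.
by rewrite lte_add_pinfty// -integral_mkcond.
Qed.

Let nuI := jump_bound_finite.

Lemma subordinator_exponentE Z : subordinator_exponent gamma nu Z =
  (0 +i* trform gamma Z) + jump_exponent nu setT Z.
Proof.
rewrite /subordinator_exponent /jump_exponent /cintegral; congr (_ + _).
by apply: complex_eq => /=; apply: eq_Rintegral => X _; rewrite /= expR0 mul1r ?subr0.
Qed.

(** [mu] is the translate by [gamma] of a law with jump exponent only. *)
Lemma mu_support : mu [set X | psd_cone (X - gamma)] = 1%E /\
  forall e, 0 < e -> mu [set X | `|X - gamma| < e] != 0%E.
Proof.
have msh : measurable_fun setT (fun X : S => X - gamma).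
  by apply: measurable_symmxB.
have [Q QE] := law_exists mu msh.
have Qc Z : charfun Q Z = cexp (jump_exponent nu setT Z).
  have QmM B : measurable B -> Q B = mu ((fun X => X - gamma) @^-1` B) by move=> _; exact: QE.
  have bc := bmeas_cos_trform Z; have bs := bmeas_sin_trform Z.
  have E1 : charfun Q Z = charfun mu Z * cexp (0 +i* (- trform gamma Z)).
    rewrite cexp_im cosN sinN !charfunE.
    rewrite !(@exp_pushforward _ _ _ _ _ mu Q _ _ msh _ QmM)//.
    set c := cos (trform gamma Z); set s := sin (trform gamma Z).
    have eC : (fun X => cos (trform (X - gamma) Z)) =
        (fun X => c * cos (trform X Z) + s * sin (trform X Z)).
      by apply/funext => X; rewrite trformBl cosB /c /s; ring.
    have eS : (fun X => sin (trform (X - gamma) Z)) =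
        (fun X => c * sin (trform X Z) + (- s) * cos (trform X Z)).
      by apply/funext => X; rewrite trformBl sinB /c /s; ring.
    rewrite eC eS (expD mu (bmeasZ c bc) (bmeasZ s bs)).
    rewrite (expD mu (bmeasZ c bs) (bmeasZ (- s) bc)) !expZ//.
    move: (\int[mu]_X cos _) (\int[mu]_X sin _) => C1 S1.
    by apply: complex_eq => /=; ring.
  rewrite E1 mu_charfun -cexpD subordinator_exponentE; congr cexp.
  by apply: complex_eq; case: (jump_exponent _ _ _) => a b /=; ring.
have [Q1 Q0] := compound_limit nuI nu_psd Qc.
split; first by rewrite -Q1 QE.
by move=> e e0; have := Q0 e e0; rewrite QE.
Qed.

Lemma flow_law t : exists P : probability S R,
  (forall B, P B = pushforward mu (opexp bA t) B) /\
  forall f, bmeas f -> \int[P]_X f X = \int[mu]_X f (congruence (mxflow A t) X).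
Proof.
have mf : measurable_fun setT (fun X : S => congruence (mxflow A t) X).
  exact: measurable_congruence.
have [P PE] := law_exists mu mf; exists P; split=> [B|f bf].
  rewrite PE /pushforward; congr (mu _); apply/seteqP; split=> X /=;
    by rewrite (opexpE bAE).
by apply: (@exp_pushforward _ _ _ _ _ mu P _ _ mf bf) => B _; exact: PE.
Qed.

(** Let [E = e^(tA)]. For almost every [y] under the factor [N], the map
    [X |-> E X E^T + y] sends almost every [X] into [gamma + cone], in particular
    points arbitrarily close to [gamma]; hence [y - (gamma - E gamma E^T)] lies
    in the cone, and [gamma - E gamma E^T] does by psd_drift. *)
Lemma selfdecomposable_factor t : 0 <= t -> exists N : probability S R,
  N psd_cone = 1%E /\
  forall Z, charfun N Z = cexp (psi Z - psi (dual_flow A t Z)).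
Proof.
move=> t0; have [N NE] := mu_osd t0; have [P [PE Pexp]] := flow_law t.
have ME B : measurable B -> mu B = convolution P N B.
  move=> mB; rewrite NE//; apply: convolution_ext => // C mC; by rewrite PE.
have [_ _ psiE] := psi_cumulant.
have mcone := @measurable_psd_cone R d.
exists N; split; last first.
  move=> Z; have := charfun_convolution Z ME.
  have -> : charfun P Z = charfun mu (dual_flow A t Z).
    rewrite !charfunE (Pexp _ (bmeas_cos_trform Z)) (Pexp _ (bmeas_sin_trform Z)).
    by congr (_ +i* _); apply: eq_Rintegral => X _; rewrite trform_flow.
  rewrite -!psiE => E; apply: (mulfI (cexp_neq0 (psi (dual_flow A t Z)))).
  by rewrite -E -cexpD addrC subrK.
pose G := [set X : S | psd_cone (X - gamma)].
have mG : measurable G.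
  have msh : measurable_fun setT (fun X : S => X - gamma) by apply: measurable_symmxB.
  by rewrite -[G]setTI; exact: msh.
have [mu1 mu0] := mu_support.
have bG := @bmeas_indic R _ S G mG.
(* [g y] is the probability that [y] plus a variable of law [P] lies in
   [gamma + cone]; its mean is [mu G = 1]. *)
pose g y := \int[P]_X (\1_G (X + y) : R).
have bsum := bmeas_comp (@measurable_sum_prod R d) bG.
have bg : bmeas g := bmeas_fubinir P N bsum.
have g1 y : g y <= 1.
  rewrite -(exp_cst P 1); apply: le_exp; last 1 first.
  - by move=> X; rewrite indicE; case: (_ \in _); rewrite ?ler01.
  - exact: (bmeas_sectionl _ bsum).
  - exact: bmeas_cst.
have Eg : \int[N]_y g y = 1.
  by rewrite /g -(exp_convolution ME bG) exp_indic// mu1.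
have ae1 : {ae N, forall y, 1 - g y = 0}.
  apply: exp0_ae; first by apply: bmeasB => //; exact: bmeas_cst.
    by move=> y; rewrite subr_ge0.
  by rewrite expB// ?exp_cst ?Eg ?subrr//; exact: bmeas_cst.
apply: ae_probability1 => //; apply: ae_sub ae1 => y /eqP.
rewrite subr_eq0 => /eqP gy.
set E := mxflow A t in PE Pexp *.
pose H := (fun X : S => congruence E X + y) @^-1` G.
have mH : measurable H.
  have mh : measurable_fun setT (fun X : S => congruence E X + y).
    by apply: measurable_symmxD => //; exact: measurable_congruence.
  by rewrite -[H]setTI; exact: mh.
have muH : mu H = 1%E.
  have : fine (mu H) = 1.
    rewrite -(exp_indic mu mH) indic_preimage.
    apply: etrans (esym gy).
    exact: esym (Pexp (fun X => \1_G (X + y)) (bmeas_sectionl y bsum)).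
  have f : mu H \is a fin_num by exact: fin_num_measure.
  by move=> h; rewrite -(fineK f) h.
suff yp : psd_cone (y - (gamma - congruence E gamma)).
  rewrite -[y](subrK (gamma - congruence E gamma)); apply: psd_coneD => //.
  exact: psd_drift.
move=> v; rewrite -/(quadform v _); apply/ler_addgt0Pl => e e0.
pose C := \sum_i \sum_j `|(E^T *m v) i 0| * `|(E^T *m v) j 0|.
have C0 : 0 <= C by apply: sumr_ge0 => i _; apply: sumr_ge0 => j _; rewrite mulr_ge0.
have C1 : 0 < C + 1 by rewrite ltr_wpDl.
(* [gamma] itself need not be in [H], but [H] has full measure and neighbourhoods
   of [gamma] are charged. *)
have [X XG XH] : exists2 X, `|X - gamma| < e / (C + 1) & H X.
  apply: contrapT => h; have := mu0 _ (divr_gt0 e0 C1); apply/negP; rewrite negbK.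
  apply/eqP; apply: (@subset_measure0 _ _ _ mu _ (~` H)) => //.
  - have msh : measurable_fun setT (fun X : S => `|X - gamma|).
      by apply: (measurableT_comp (@measurable_symmx_norm R d)); apply: measurable_symmxB.
    rewrite (_ : [set X | _] = (fun X => `|X - gamma|) @^-1` `]-oo, e / (C + 1)[%classic).
      by rewrite -[X in measurable X]setTI; exact: msh.
    by apply/seteqP; split => X; rewrite /= in_itv.
  - exact: measurableC.
  - by move=> X /= XG XH; apply: h; exists X.
  by have := probability_setC mu mH; rewrite muH subee.
have := XH v; rewrite -/(quadform v _) => q0.
have -> : quadform v (y - (gamma - congruence E gamma)) =
    quadform v (congruence E X + y - gamma) - quadform (E^T *m v) (X - gamma).
  rewrite !quadformD !quadformN !quadformD !quadformN -!quadform_congruence.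
  by ring.
have := quadform_le (E^T *m v) (X - gamma); rewrite -/C => /(le_trans (ler_norm _)) h.
have : C * `|X - gamma| <= e.
  apply: (@le_trans _ _ ((C + 1) * `|X - gamma|)); first by rewrite ler_wpM2r// lerDl.
  by rewrite -ler_pdivlMl// mulrC ltW.
move: h q0; move: (quadform _ _) (quadform _ _) (C * _) => a b c; lra.
Qed.

(** With [t = s / (n + 1)], the power [n + 1] of the factor at time [t] has
    exponent [(n + 1) (psi Z - psi Z_t)], a difference quotient along the dual
    flow [Z_t] that tends to [s] times [psi_L]. Continuity of [psi_L] at
    the origin is what the continuity theorem requires. *)
Lemma driving_law (s : R) : 0 < s -> exists rho : probability S R,
  rho psd_cone = 1%E /\ forall Z, charfun rho Z = cexp (rscale s (psi_L A psi Z)).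
Proof.
move=> s0; pose tn n : R := s / n.+1%:R.
have tn0 n : 0 <= tn n by rewrite divr_ge0// ltW.
have P_ n : {M : probability S R | M psd_cone = 1%E /\
    forall Z, charfun M Z = cexp ((psi Z - psi (dual_flow A (tn n) Z)) *+ n.+1)}.
  apply: cid; have [N [N1 Nc]] := selfdecomposable_factor (tn0 n).
  have [M [ME Mc]] := convolution_power_exists N n.+1; exists M; split.
    exact: convolution_power_psd N1 ME.
  by move=> Z; rewrite Mc Nc cexpM_natl.
pose Pn n := sval (P_ n).
have Pn1 n := (svalP (P_ n)).1; have Pnc n := (svalP (P_ n)).2.
have tcvg : tn @ \oo --> (0 : R)^'.
  have t0 : tn @ \oo --> (0 : R).
    by rewrite -(mulr0 s); apply: cvgMr; exact: (@cvg_harmonic R).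
  move=> B /= /nbhs_ballP[e /= e0 eB].
  have [N _ NB] := t0 (ball (0 : R) e) (nbhsx_ballx _ _ e0).
  exists N => // n Nn; apply: eB; first exact: NB.
  by rewrite gt_eqF// divr_gt0.
have lim (f : R -> R) (l : R) : is_derive (0 : R) (1 : R) f l ->
    (fun n => n.+1%:R * (f 0 - f (tn n))) @ \oo --> - s * l.
  move=> [df <-]; have h := cvg_comp _ _ tcvg df.
  rewrite (_ : (fun n => _) = (fun n => - s * ((tn n)^-1 * (f (tn n) - f 0)))).
    apply: cvgMr; rewrite (_ : (fun n => _) = (fun h : R => h^-1 *:
      ((f \o shift 0) (h *: 1) - f 0)) \o tn); first exact: h.
    by apply/funext => n; rewrite /GRing.scale/= mulr1 addr0.
  apply/funext => n; rewrite /tn; field.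
  by rewrite nat1r pnatr_eq0/= (gt_eqF s0).
have expC Z : (fun n => complex.Re (charfun (Pn n) Z)) @ \oo -->
      complex.Re (cexp (rscale s (psi_L A psi Z))) /\
    (fun n => complex.Im (charfun (Pn n) Z)) @ \oo -->
      complex.Im (cexp (rscale s (psi_L A psi Z))).
  have [dR dI] := is_derive_psi_flow A psi_diff Z 0.
  have := lim _ _ dR; have := lim _ _ dI; rewrite !dual_flow0 !mulrNN => lI lR.
  pose u n := (psi Z - psi (dual_flow A (tn n) Z)) *+ n.+1.
  have uE n : u n = rscale n.+1%:R (psi Z - psi (dual_flow A (tn n) Z)).
    by rewrite rscale_natl.
  have uR : (fun n => complex.Re (u n)) @ \oo --> complex.Re (rscale s (psi_L A psi Z)).
    rewrite (_ : (fun n => complex.Re (u n)) = (fun n => n.+1%:R *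
      (complex.Re (psi Z) - complex.Re (psi (dual_flow A (tn n) Z))))); first exact: lR.
    by apply/funext => n; rewrite uE; case: (psi Z) (psi (dual_flow _ _ _)) => ? ? [].
  have uI : (fun n => complex.Im (u n)) @ \oo --> complex.Im (rscale s (psi_L A psi Z)).
    rewrite (_ : (fun n => complex.Im (u n)) = (fun n => n.+1%:R *
      (complex.Im (psi Z) - complex.Im (psi (dual_flow A (tn n) Z))))); first exact: lI.
    by apply/funext => n; rewrite uE; case: (psi Z) (psi (dual_flow _ _ _)) => ? ? [].
  have [cR cI] := cexp_cvg uR uI.
  rewrite (_ : (fun n => complex.Re (charfun (Pn n) Z)) =
    (fun n => complex.Re (cexp (u n)))); last by apply/funext => n; rewrite -Pnc.
  rewrite (_ : (fun n => complex.Im (charfun (Pn n) Z)) =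
    (fun n => complex.Im (cexp (u n)))); last by apply/funext => n; rewrite -Pnc.
  by split.
have phi0 e : 0 < e -> exists2 del, 0 < del &
    forall Z, `|Z| <= del -> 1 - complex.Re (cexp (rscale s (psi_L A psi Z))) <= e.
  move=> e0.
  have pL0 : psi_L A psi 0 = 0 by rewrite /psi_L eqxx.
  have cL : (fun Z => plane (psi_L A psi Z)) @ (0 : S) --> plane (psi_L A psi 0) := psi_L_cont.
  have c1 : (fun Z : S => complex.Re (psi_L A psi Z)) @ (0 : S) -->
      complex.Re (psi_L A psi 0).
    exact: cvg_comp _ _ cL (@cvg_fst _ _ (nbhs _) (nbhs _) (nbhs_filter _)).
  have c2 : (fun Z : S => complex.Im (psi_L A psi Z)) @ (0 : S) -->
      complex.Im (psi_L A psi 0).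
    exact: cvg_comp _ _ cL (@cvg_snd _ _ (nbhs _) (nbhs _) (nbhs_filter _)).
  rewrite pL0 in c1 c2.
  have c1' : (fun Z : S => complex.Re (rscale s (psi_L A psi Z))) @ (0 : S) -->
      complex.Re (rscale s (0 : R[i])).
    exact: cvgM (@cvg_cst _ s _ _ _) c1.
  have c2' : (fun Z : S => complex.Im (rscale s (psi_L A psi Z))) @ (0 : S) -->
      complex.Im (rscale s (0 : R[i])).
    exact: cvgM (@cvg_cst _ s _ _ _) c2.
  have [cR _] := cexp_cvg c1' c2'.
  rewrite {2}/rscale /= !mulr0 expR0 cos0 mulr1 in cR.
  move: cR => /cvgrPdist_lt /(_ e e0) /nbhs_ballP[r /= r0 rB].
  exists (r / 2) => [|Z Zr]; first by rewrite divr_gt0.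
  have /rB /= : ball (0 : S) r Z.
    by rewrite -ball_normE /= sub0r normrN (le_lt_trans Zr)// ltr_pdivrMr// ltr_pMr// ltr1n.
  by move=> h; apply: le_trans (ler_norm _) (ltW h).
have [rho [rhoc rhoP]] := levy_continuity (fun Z => (expC Z).1) (fun Z => (expC Z).2) phi0.
by exists rho; split => //; exact: psd_cone_limit Pn1 rhoP.
Qed.

(** The laws with exponents [psi_L / n] are the convolution roots. *)
Theorem driving_law_exists : exists mu_L : probability S R,
  [/\ mu_L psd_cone = 1%E, infinitely_divisible mu_L
    & forall Z, charfun mu_L Z = cexp (psi_L A psi Z)].
Proof.
have [mu_L [mu_L1 mu_Lc]] := driving_law ltr01.
exists mu_L; split=> //; last by move=> Z; rewrite mu_Lc rscale1.
move=> n n0; have n0' : 0 < n%:R^-1 :> R by rewrite invr_gt0 ltr0n.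
have [rho [_ rhoc]] := driving_law n0'.
have [M [ME Mc]] := convolution_power_exists rho n.
exists rho => B mB; rewrite -ME//; apply: charfun_inj => // Z.
rewrite Mc rhoc mu_Lc -cexpM_natl -rscale_natl rscaleA divff//.
by rewrite pnatr_eq0 -lt0n.
Qed.

End selfdecomposable.

(** * Riemann-Stieltjes integrals against paths increasing in the cone *)

Section scalar_stieltjes.
Context (R : realType).

Lemma uniform_continuity (f : R -> R) (a b e : R) : continuous f -> 0 < e ->
  exists2 del, 0 < del & forall x y, a <= x <= b -> `|x - y| < del -> `|f x - f y| < e.
Proof.
move=> cf e0.
have /compact_near_coveringP K := @segment_compact R a b.
have := K R (0 : R)^'+ (fun del x => forall y, `|x - y| < del -> `|f x - f y| < e) _.
have cov (x : R) : `[a, b]%classic x -> \forall x' \near x & del \near (0 : R)^'+,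
    forall y, `|x' - y| < del -> `|f x' - f y| < e.
  move=> _; have e2 : 0 < e / 2 by rewrite divr_gt0.
  have := cf x => /cvgrPdist_lt /(_ _ e2) /nbhs_ballP[r /= r0 rB].
  have r2 : 0 < r / 2 by rewrite divr_gt0.
  exists (ball x (r / 2), [set del | 0 < del < r / 2]) => /=.
    split; first exact: nbhsx_ballx.
    near=> del; apply/andP; split; near: del; first exact: nbhs_right_gt.
    exact: nbhs_right_lt.
  move=> [x' del] /= [xx' /andP[d0 dr]] y x'y.
  have h1 : ball x r x' by apply: (le_ball _ xx'); rewrite ler_pdivrMr// ler_pMr// ler1n.
  have h2 : ball x r y.
    move: xx'; rewrite -!ball_normE /ball_ /= => xx'.
    rewrite (splitr r) (le_lt_trans (ler_distD x' _ _))// ltrD//.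
    exact: lt_trans x'y dr.
  have := rB _ h1; have := rB _ h2; rewrite /= => hy hx.
  by rewrite (splitr e) (le_lt_trans (ler_distD (f x) _ _))// ltrD// distrC.
move=> /(_ _ cov) [del /= d0 H].
exists (del / 2) => [|x y xab]; first by rewrite divr_gt0.
have := H (del / 2); rewrite /ball_ /= sub0r normrN ger0_norm ?divr_ge0 ?ltW//.
rewrite ltr_pdivrMr// ltr_pMr// ltr1n => /(_ isT); rewrite divr_gt0// => /(_ isT x) h.
by apply: h; rewrite /= in_itv.
Unshelve. all: by end_near. Qed.

Lemma stieltjes_sum_cons (V W : normedModType R) (F : R -> V -> W) (X : R -> V)
    a y s xi : stieltjes_sum F X a (y :: s) xi =
  F (xi 0%N) (X y - X a) + stieltjes_sum F X y s (fun k => xi k.+1).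
Proof. by rewrite /stieltjes_sum big_ord_recl. Qed.

Lemma stieltjes_sum_nil (V W : normedModType R) (F : R -> V -> W) (X : R -> V)
    a xi : stieltjes_sum F X a [::] xi = 0.
Proof. by rewrite /stieltjes_sum big_ord0. Qed.

(** The integrand as a family of linear maps of the line. *)
Definition rmul (f : R -> R) (u : R) (x : R^o) : R^o := f u * x.

Section measure.
Variables (mu : {measure set (measurableTypeR R) -> \bar R}) (H : R -> R).
Hypothesis muH : forall x y, x <= y -> mu `]x, y]%classic = (H y - H x)%:E.
Variable f : R -> R.
Hypothesis cf : continuous f.

Lemma continuous_itv_integrable x y : x <= y ->
  mu.-integrable `]x, y]%classic (EFin \o f).
Proof.
move=> xy; have [c _ fc] := @EVT_max R f x y xy (continuous_subspaceT cf).
have [c' _ fc'] := @EVT_min R f x y xy (continuous_subspaceT cf).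
apply: measurable_bounded_integrable.
- exact: measurable_itv.
- by rewrite muH// ltry.
- apply: (@measurable_funTS _ _ (measurableTypeR R)).
  exact: continuous_measurable_fun.
exists (`|f c| + `|f c'|); split; first exact: num_real.
move=> M KM z; rewrite /= in_itv/= => /andP[xz zy].
apply: (le_trans _ (ltW KM)).
have zI : z \in `[x, y] by rewrite in_itv/= zy (ltW xz).
have := fc z zI; have := fc' z zI => l u; rewrite ler_norml; apply/andP; split.
  have := ler_norm (- f c'); rewrite normrN; have := normr_ge0 (f c).
  by move: (`|f c|) (`|f c'|) => ? ?; lra.
have := ler_norm (f c); have := normr_ge0 (f c').
by move: (`|f c|) (`|f c'|) => ? ?; lra.
Qed.

(** A Riemann sum is the integral of a step function within [w] of [f]. *)
Lemma stieltjes_sum_dist (a b w : R) s xi : itv_partition a b s ->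
  (forall k, (k < size s)%N -> forall x, (a :: s)`_k < x <= s`_k ->
    `|f (xi k) - f x| <= w) ->
  `|stieltjes_sum (rmul f) H a s xi - \int[mu]_(x in `]a, b]%classic) f x| <=
    w * (H b - H a).
Proof.
elim: s a xi => [|y s IH] a xi sP fw.
  rewrite (itv_partition_nil sP) stieltjes_sum_nil subrr mulr0.
  by rewrite set_itv_ge ?bnd_simp ?ltxx// Rintegral_set0 subrr normr0.
have ay : a < y by have [/=/andP[]] := sP.
have sP' := itv_partition_cons sP; have yb := itv_partition_le sP'.
have := IH y (fun k => xi k.+1) sP' (fun k => fw k.+1) => {}IH.
have ab := le_trans (ltW ay) yb.
have iab := continuous_itv_integrable ab.
have split_itv : `]a, b]%classic = `]a, y] `|` `]y, b] :> set R.
  by rewrite (@itv_bndbnd_setU _ _ (BRight a) (BRight y) (BRight b))//; rewrite bnd_simp// ltW.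
have -> : \int[mu]_(x in `]a, b]%classic) f x =
    \int[mu]_(x in `]a, y]%classic) f x + \int[mu]_(x in `]y, b]%classic) f x.
  rewrite split_itv Rintegral_setU//; try exact: measurable_itv.
    by rewrite -split_itv.
  apply/disj_setPS => z [] /=; rewrite !in_itv/= => /andP[_ zy] /andP[yz _].
  by have := lt_le_trans yz zy; rewrite ltxx.
rewrite stieltjes_sum_cons.
have first : `|rmul f (xi 0%N) (H y - H a) - \int[mu]_(x in `]a, y]%classic) f x| <=
    w * (H y - H a).
  have iay := continuous_itv_integrable (ltW ay).
  have mI : measurable (`]a, y]%classic : set (measurableTypeR R)).
    exact: measurable_itv.
  have ic (c : R) : mu.-integrable `]a, y]%classic (EFin \o (cst c)).
    apply: measurable_bounded_integrable => //; first by rewrite muH ?ltry// ltW.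
    by exists `|c|; split; [exact: num_real|move=> M cM z _; exact: ltW].
  have Ic (c : R) : \int[mu]_(x in `]a, y]%classic) c = c * (H y - H a).
    by rewrite Rintegral_cst// muH// ltW.
  have -> : rmul f (xi 0%N) (H y - H a) = \int[mu]_(x in `]a, y]%classic) f (xi 0%N).
    by rewrite Ic.
  rewrite -(RintegralB mI (ic _) iay).
  rewrite ler_norml -mulNr -!Ic.
  have fw0 x : `]a, y]%classic x -> - w <= f (xi 0%N) - f x <= w.
    by move=> xI; rewrite -ler_norml; apply: (fw 0%N).
  have iB : mu.-integrable `]a, y]%classic (EFin \o (fun x => f (xi 0%N) - f x)).
    exact: (integrableB mI (ic _) iay).
  apply/andP; split.
    by apply: (le_Rintegral mI (ic _) iB) => x /fw0 /andP[].
  by apply: (le_Rintegral mI iB (ic _)) => x /fw0 /andP[].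
have -> : w * (H b - H a) = w * (H y - H a) + w * (H b - H y) by ring.
by rewrite opprD addrACA (le_trans (ler_normD _ _))// lerD.
Qed.

End measure.

(** The integral against the Lebesgue-Stieltjes measure of the integrator, frozen
    outside [[a, b]], is the limit of the Riemann sums by uniform continuity. *)
Lemma stieltjes_integral_monotone (G f : R -> R) (a b : R) : a <= b ->
  (forall x y, a <= x -> x <= y -> y <= b -> G x <= G y) ->
  (forall x, a <= x < b -> G @ x^'+ --> G x) -> continuous f ->
  exists I : R, is_stieltjes_integral (rmul f) (G : R -> R^o) a b I.
Proof.
move=> ab monoG rcG cf.
(* Clamping to [[a, b]] extends [G] to a cumulative function on the line. *)
pose cl x := Num.max a (Num.min b x).
have cl_ge x : a <= cl x by rewrite le_max lexx.
have cl_le x : cl x <= b by rewrite ge_max ab ge_min lexx.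
have clE x : a <= x <= b -> cl x = x.
  by move=> /andP[ax xb]; rewrite /cl min_r// max_r.
pose H x := G (cl x).
have Hnd : nondecreasing H.
  move=> x y xy; apply: monoG => //; rewrite /cl ge_max le_max lexx/= le_max.
  by apply/orP; right; rewrite le_min !ge_min lexx xy orbT.
have Hrc : right_continuous H.
  move=> x; case: (ltP x a) => [xa|ax].
    have E y : y < a -> H y = H x.
      move=> ya; rewrite /H /cl (min_r (le_trans (ltW ya) ab)) (max_l (ltW ya)).
      by rewrite (min_r (le_trans (ltW xa) ab)) (max_l (ltW xa)).
    apply: cvg_near_cst; near=> y; apply: E; near: y.
    exact: nbhs_right_lt.
  case: (ltP x b) => [xb|bx].
    have -> : H x = G x by rewrite /H clE// ax ltW.
    apply: cvg_trans (rcG x _); last by rewrite ax.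
    apply: near_eq_cvg; near=> y; rewrite /H clE//.
    apply/andP; split; first by apply: (le_trans ax); near: y; exact: nbhs_right_ge.
    by near: y; exact: nbhs_right_le.
  apply: cvg_near_cst; near=> y; rewrite /H /cl !min_l//.
  by apply: (le_trans bx); near: y; exact: nbhs_right_ge.
have m0 : 0 <= H b - H a by rewrite subr_ge0; exact: Hnd.
pose Hc : cumulative R R := HB.pack H (isCumulative.Build R _ R H Hnd Hrc).
have muH x y : x <= y -> lebesgue_stieltjes_measure Hc `]x, y]%classic = (H y - H x)%:E.
  move=> xy; rewrite /lebesgue_stieltjes_measure /measure_extension.
  by rewrite measurable_mu_extE/= ?wlength_itv_bnd//; exact: is_ocitv.
exists (\int[lebesgue_stieltjes_measure Hc]_(x in `]a, b]%classic) f x) => e e0.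
pose w := e / (H b - H a + 1).
have w0 : 0 < w by rewrite divr_gt0// ltr_wpDl.
have [del d0 fdel] := @uniform_continuity f a b w cf w0.
exists del => // s xi sP tag.
have ge_a k : (k <= size s)%N -> a <= (a :: s)`_k.
  move=> ks; rewrite (set_nth_default b)//.
  exact: (@itv_partition_nth_ge _ _ a b s k ks sP).
have le_b k : (k <= size s)%N -> (a :: s)`_k <= b.
  move=> ks; rewrite (set_nth_default b)//.
  exact: (@itv_partition_nth_le _ _ a b s k ks sP).
have sumE : stieltjes_sum (rmul f) (G : R -> R^o) a s xi =
    stieltjes_sum (rmul f) (H : R -> R^o) a s xi.
  apply: eq_bigr => k _; congr (rmul f _ (_ - _)).
    by rewrite /H clE// (ge_a k.+1)//= (le_b k.+1).
  by rewrite /H clE// ge_a ?le_b// ltnW.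
rewrite sumE; apply: le_lt_trans (_ : w * (H b - H a) < e).
  apply: (stieltjes_sum_dist muH cf sP) => k ks x /andP[kx xk].
  have [/andP[k1 k2] k3] := tag k ks.
  apply/ltW/fdel.
    rewrite (le_trans (ge_a _ (ltnW ks)) k1)/=.
    exact: le_trans k2 (le_b k.+1 ks).
  apply: le_lt_trans k3; rewrite ler_norml.
  move: k1 k2 kx xk; move: (xi k) (s`_k) ((a :: s)`_k) => u v z *.
  by apply/andP; split; lra.
by rewrite /w mulrAC ltr_pdivrMr ?ltr_wpDl// ltr_pM2l// ltrDl.
Unshelve. all: by end_near. Qed.

End scalar_stieltjes.

Section mesh_filter.
Context (R : realType).

Definition tagged_partition (a b del : R) : set (seq R * (nat -> R)) :=
  [set p | itv_partition a b p.1 /\ forall k, (k < size p.1)%N ->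
    (a :: p.1)`_k <= p.2 k <= p.1`_k /\ p.1`_k - (a :: p.1)`_k < del].

(** Stieltjes integrals are limits along this filter, so that the calculus of
    limits applies to them. *)
Definition mesh_filter (a b : R) : set_system (seq R * (nat -> R)) :=
  [set B | exists2 del, 0 < del & tagged_partition a b del `<=` B].

Global Instance mesh_filter_filter a b : Filter (mesh_filter a b).
Proof.
split; first by exists 1.
- move=> B C [d1 d10 B1] [d2 d20 C2]; exists (Num.min d1 d2).
    by rewrite lt_min d10 d20.
  move=> p [pP tag]; split; [apply: B1|apply: C2]; split=> // k ks;
    by have [? /lt_le_trans h] := tag k ks; split=> //; apply: h; rewrite ge_min lexx ?orbT.
- by move=> B C BC [del d0 Bd]; exists del => // p /Bd; exact: BC.
Qed.

Lemma partition_exists (a b del : R) : a <= b -> 0 < del -> exists2 s : seq R,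
  itv_partition a b s & forall k, (k < size s)%N -> s`_k - (a :: s)`_k < del.
Proof.
move=> ab d0.
have [N NE] : exists N : nat, b - a < N%:R * (del / 2).
  exists (Num.bound ((b - a) / (del / 2))); rewrite -ltr_pdivrMr ?divr_gt0//.
  by apply: archi_boundP; rewrite divr_ge0 ?subr_ge0// ltW// divr_gt0.
elim: N a ab NE => [|N IH] a ab; first by rewrite mul0r subr_lt0 ltNge ab.
move=> NE; have d2 : 0 < del / 2 by rewrite divr_gt0.
have dd : del / 2 < del by rewrite ltr_pdivrMr// ltr_pMr// ltr1n.
case: (ltP (a + del / 2) b) => [lt|ge].
  have [|s sP sd] := IH _ (ltW lt).
    by move: NE; rewrite -natr1 mulrDl mul1r; move: (N%:R * _) => u; lra.
  exists (a + del / 2 :: s); first by have [? ?] := sP; split=> //=; rewrite ltrDl d2.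
  by move=> [_|k ks] /=; [rewrite addrAC subrr add0r|exact: sd].
have [ba|abn] := eqVneq a b; first by exists [::]; rewrite // ba; split=> /=.
exists [:: b]; first by apply: itv_partition1; rewrite lt_neqAle abn ab.
by move=> [_|//] /=; move: ge; lra.
Qed.

Lemma mesh_filter_proper a b : a <= b -> ProperFilter (mesh_filter a b).
Proof.
move=> ab; split; last exact: mesh_filter_filter.
move=> [del d0 H]; have [s sP sd] := partition_exists ab d0.
apply: (H (s, fun k => s`_k)); split=> //= k ks; split; last exact: sd.
rewrite lexx andbT; have [sp _] := sP.
move: k ks; elim: s a {ab sP sd H} sp => [//|y s IH] a /= /andP[ay ys] [_|k ks] /=.
  exact: ltW.
exact: IH.
Qed.

Lemma is_stieltjes_integralP (V W : normedModType R) (F : R -> V -> W) (X : R -> V)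
    a b (I : W) : is_stieltjes_integral F X a b I <->
  stieltjes_sum F X a p.1 p.2 @[p --> mesh_filter a b] --> I.
Proof.
split=> [H|/cvgrPdist_lt H e e0].
  apply/cvgrPdist_lt => e e0; have [del d0 Hd] := H e e0.
  by exists del => // p [pP tag]; rewrite /= distrC; exact: Hd.
have [del d0 Hd] := H e e0; exists del => // s xi sP tag.
by rewrite distrC; exact: (Hd (s, xi)).
Qed.

End mesh_filter.

Section cone_stieltjes.
Context (R : realType) (d : nat).
Local Notation S := (symmx R d).
Variables (A : 'M[R]_d) (t : R).

Definition ou_kernel (s : R) (H : S) : 'M[R]_d :=
  mexp ((t - s) *: A) *m H *m mexp ((t - s) *: A^T).

Lemma ou_kernelE s H : ou_kernel s H = congruence (mxflow A (t - s)) H.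
Proof. by rewrite /ou_kernel mexp_tr. Qed.

Let delta (p : 'I_d) : 'cV[R]_d := delta_mx p 0.

Lemma quadform_delta2 (p q : 'I_d) (X : S) : quadform (delta p + delta q) X =
  X p p + X p q + X q p + X q q.
Proof.
have trD : (delta p + delta q)^T = (delta_mx 0 p : 'rV[R]_d) + delta_mx 0 q.
  by apply/matrixP => a b; rewrite !mxE !(ord1 a) !eqxx /= !andbT.
rewrite /quadform trD /delta !mulmxDl !mulmxDr.
have E (k l : 'I_d) : ((delta_mx 0 k : 'rV[R]_d) *m X *m (delta_mx l 0 : 'cV[R]_d)) 0 0 = X k l.
  by rewrite -rowE -colE !mxE.
have D (M N : 'M[R]_1) : (M + N) 0 0 = M 0 0 + N 0 0 by rewrite mxE.
by rewrite !D !E addrA.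
Qed.

(** Entries of a matrix are combinations of its quadratic forms, which are
    monotone along a path increasing in the cone. *)
Lemma polarization (p q : 'I_d) (X : S) :
  X p q = 2^-1 * quadform (delta p + delta q) X - 8^-1 * quadform (delta p + delta p) X
    - 8^-1 * quadform (delta q + delta q) X.
Proof. by rewrite !quadform_delta2 (symmxC X q p); field. Qed.

(** Each entry of a Riemann sum is, by polarization, a combination of scalar
    Riemann sums with monotone integrators. *)
Lemma cone_stieltjes_integral (X : R -> S) : 0 <= t ->
  (forall s u, 0 <= s -> s <= u -> u <= t -> psd_cone (X u - X s)) ->
  (forall s, 0 <= s < t -> X @ s^'+ --> X s) ->
  exists I : 'M[R]_d, is_stieltjes_integral ou_kernel X 0 t I.
Proof.
move=> t0 monoX rcX.
pose f i j p q (s : R) := mxflow A (t - s) i p * mxflow A (t - s) j q.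
have cf i j p q : continuous (f i j p q).
  have c k l : continuous (fun s => mxflow A (t - s) k l).
    move=> s; apply: (@continuous_comp _ _ _ (fun s => t - s) (fun u => mxflow A u k l)).
      by apply: cvgB; [exact: cvg_cst|exact: cvg_id].
    exact: mxflow_continuous.
  by move=> s; apply: cvgM; exact: c.
have mono v x y : 0 <= x -> x <= y -> y <= t -> quadform v (X x) <= quadform v (X y).
  by move=> x0 xy yt; rewrite -subr_ge0 -quadformN -quadformD; exact: monoX.
have rc v x : 0 <= x < t -> (fun s => quadform v (X s)) @ x^'+ --> quadform v (X x).
  move=> /rcX Xc; apply/cvgrPdist_lt => e e0.
  pose C := \sum_i \sum_j `|v i 0| * `|v j 0|.
  have C0 : 0 <= C by apply: sumr_ge0 => i _; apply: sumr_ge0 => j _; rewrite mulr_ge0.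
  have C1 : 0 < C + 1 by rewrite ltr_wpDl.
  have near_x : \forall y \near x^'+, ball (X x) (e / (C + 1)) (X y).
    by move/cvg_ballP: Xc => /(_ _ (divr_gt0 e0 C1)).
  apply: filterS near_x => y; rewrite -ball_normE /ball_ /= => h.
  have -> : quadform v (X x) - quadform v (X y) = quadform v (X x - X y).
    by rewrite -quadformN -quadformD.
  apply: (le_lt_trans (quadform_le v _)).
  apply: (@le_lt_trans _ _ ((C + 1) * `|X x - X y|)); first by rewrite ler_wpM2r// lerDl.
  by rewrite -ltr_pdivlMl// mulrC.
have RS i j p q v : {I : R | (fun w : seq R * (nat -> R) =>
    stieltjes_sum (rmul (f i j p q)) (fun s => quadform v (X s) : R^o) 0 w.1 w.2)
    @ mesh_filter 0 t --> (I : R^o)}.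
  apply: cid; have [I IP] := stieltjes_integral_monotone t0 (mono v) (rc v) (cf i j p q).
  by exists I; apply/is_stieltjes_integralP.
pose J i j p q v := sval (RS i j p q v).
exists (\matrix_(i, j) \sum_p \sum_q (2^-1 * J i j p q (delta p + delta q)
  - 8^-1 * J i j p q (delta p + delta p) - 8^-1 * J i j p q (delta q + delta q))).
apply/is_stieltjes_integralP; apply: cvg_mx => i j; rewrite mxE.
pose T p q v (w : seq R * (nat -> R)) : R :=
  stieltjes_sum (rmul (f i j p q)) (fun s => quadform v (X s) : R^o) 0 w.1 w.2.
rewrite (_ : (fun w => _) = fun w => \sum_p \sum_q (2^-1 * T p q (delta p + delta q) w
  - 8^-1 * T p q (delta p + delta p) w - 8^-1 * T p q (delta q + delta q) w)).
  apply: cvg_sum_seq => p; apply: cvg_sum_seq => q.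
  have h v := svalP (RS i j p q v).
  by apply: cvgB; [apply: cvgB|]; apply: cvgM; try exact: cvg_cst; exact: h.
apply/funext => -[s xi] /=; rewrite /stieltjes_sum summxE.
rewrite [RHS](_ : _ = \sum_(k < size s) \sum_p \sum_q f i j p q (xi k) *
    (X s`_k - X (0 :: s)`_k) p q).
  apply: eq_bigr => k _; rewrite ou_kernelE /=.
  rewrite mxE [RHS]exchange_big; apply: eq_bigr => q _.
  rewrite mxE mxE mulr_suml; apply: eq_bigr => p _.
  by rewrite /f /=; ring.
rewrite [RHS]exchange_big; apply: eq_bigr => p _.
rewrite [RHS]exchange_big; apply: eq_bigr => q _.
rewrite /T /stieltjes_sum /= !mulr_sumr -!sumrB; apply: eq_bigr => k _.
have qB v (Y Y' : S) : quadform v (Y - Y') = quadform v Y - quadform v Y'.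
  by rewrite -quadformN -quadformD.
by rewrite (polarization p q (X s`_k - X (0 :: s)`_k)) !qB /rmul; ring.
Qed.

End cone_stieltjes.

(** * Expectations of functions of independent variables *)

Section independence.
Context (R : realType) (dO : measure_display) (Omega : measurableType dO)
  (P : probability Omega R).

Section one_variable.
Context (dT : measure_display) (T : measurableType dT).
Variables (G : Omega -> R) (X : Omega -> T) (K : R).
Hypotheses (bG : bmeas G) (mX : measurable_fun setT X).
Hypothesis GX : forall B : set T, measurable B ->
  \int[P]_w (G w * \1_B (X w)) = K * fine (P (X @^-1` B)).

Local Notation unif := (uniform_prob (@ltr01 R)).

(** Layer-cake representation [g = int_0^1 1_(u < g) du] and Fubini, which reduce
    the claim to indicators. *)
Lemma exp_mul_unit (g : T -> R) : measurable_fun setT g ->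
  (forall x, 0 <= g x <= 1) ->
  \int[P]_w (G w * g (X w)) = K * \int[P]_w g (X w).
Proof.
move=> mg g01; have mgX := measurableT_comp mg mX.
pose A : set (Omega * R) := [set p | 0 <= p.2 < g (X p.1)].
have mA : measurable A.
  have -> : A = (snd @^-1` `[0, +oo[%classic) `&`
      ((fun p : Omega * R => g (X p.1) - p.2) @^-1` `]0, +oo[%classic).
    apply/seteqP; split=> p; rewrite /A /= !in_itv/= !andbT subr_gt0.
      by move=> /andP[].
    by move=> [-> ->].
  apply: measurableI.
    by rewrite -[X in measurable X]setTI; exact: (measurable_snd (T1 := Omega)).
  have m2 : measurable_fun setT (fun p : Omega * R => g (X p.1) - p.2).
    by apply: measurable_funB => //; exact: (measurableT_comp mgX).
  by rewrite -[X in measurable X]setTI; exact: m2.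
pose B (u : R) : set T := [set x | 0 <= u < g x].
have mB u : measurable (B u).
  case: (leP 0 u) => u0.
    rewrite (_ : B u = g @^-1` `]u, +oo[%classic).
      by rewrite -[X in measurable X]setTI; exact: mg.
    by apply/seteqP; split=> x; rewrite /B /= in_itv/= andbT u0.
  rewrite (_ : B u = set0) //.
  by apply/seteqP; split=> x //; rewrite /B /= leNgt u0.
have AE w u : \1_A (w, u) = \1_(B u) (X w) :> R by rewrite !indicE.
have gE x : \int[unif]_u (\1_(`[0, g x[%classic : set R) u) = g x.
  have /andP[g0 g1] := g01 x.
  rewrite (exp_indic unif (measurable_itv _)) -[RHS]subr0.
  exact: (congr1 fine (uniform_itv (lexx 0) g0 g1)).
have AE' w u : \1_A (w, u) = \1_(`[0, g (X w)[%classic : set R) u :> R.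
  rewrite !indicE; congr (_%:R); apply/idP/idP; rewrite !inE /A /=;
    by rewrite in_itv.
have bA := bmeas_indic R mA.
have bGA : bmeas (fun p : Omega * R => G p.1 * \1_A p).
  by apply: bmeasM => //; exact: (bmeas_comp (measurable_fst (T2 := R))).
have E1 : \int[P]_w (G w * g (X w)) = \int[P]_w \int[unif]_u (G w * \1_A (w, u)).
  apply: eq_Rintegral => w _; rewrite expZ; last exact: (bmeas_sectionr w bA).
  congr (_ * _); rewrite -[LHS]gE; apply: eq_Rintegral => u _.
  by rewrite AE'.
have E2 : \int[P]_w g (X w) = \int[P]_w \int[unif]_u (\1_A (w, u)).
  by apply: eq_Rintegral => w _; rewrite -[LHS]gE; apply: eq_Rintegral => u _; rewrite AE'.
rewrite E1 E2 (exp_fubini P unif bGA) (exp_fubini P unif bA).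
rewrite -expZ; last exact: (bmeas_fubinir P unif bA).
apply: eq_Rintegral => u _.
have -> : (fun w => G w * \1_A (w, u)) = (fun w => G w * \1_(B u) (X w)).
  by apply/funext => w; rewrite AE.
rewrite GX//; congr (_ * _).
have -> : (fun w => \1_A (w, u) : R) = \1_(X @^-1` B u).
  by rewrite indic_preimage; apply/funext => w; rewrite AE.
rewrite exp_indic// -[X in measurable X]setTI.
exact: mX.
Qed.

Lemma exp_mul_bmeas (g : T -> R) : bmeas g ->
  \int[P]_w (G w * g (X w)) = K * \int[P]_w g (X w).
Proof.
move=> bg; have [mg [M gM]] := bg.
pose N := `|M| + 1; have N0 : 0 < N by rewrite ltr_wpDl.
have gN x : `|g x| <= N.
  by rewrite (le_trans (gM x))// (le_trans (ler_norm _))// lerDl.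
pose h x := (g x + N) / (N *+ 2).
have N20 : 0 < N *+ 2 by rewrite mulrn_wgt0.
have h01 x : 0 <= h x <= 1.
  have := gN x; rewrite ler_norml => /andP[l u].
  rewrite /h divr_ge0 ?(ltW N20)//=; last by rewrite -lerBlDr sub0r.
  by rewrite ler_pdivrMr// mul1r mulr2n lerD2r.
have bh : bmeas h.
  split; last by exists 1 => x; have /andP[? ?] := h01 x; rewrite ger0_norm.
  by apply: measurable_funM => //; apply: measurable_funD.
have gh x : g x = (N *+ 2) * h x - N by rewrite /h mulrC divfK ?gt_eqF// addrK.
have bhX := bmeas_comp mX bh.
have EG : \int[P]_w G w = K.
  have := GX measurableT; rewrite preimage_setT (_ : fine _ = 1) ?mulr1; last first.
    exact: (congr1 fine (probability_setT P)).
  by move=> <-; apply: eq_Rintegral => w _; rewrite indicT mulr1.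
have -> : (fun w => G w * g (X w)) =
    (fun w => (N *+ 2) * (G w * h (X w)) - N * G w).
  by apply/funext => w; rewrite gh -mulr_natl; ring.
have -> : (fun w => g (X w)) = (fun w => (N *+ 2) * h (X w) - N).
  by apply/funext => w; rewrite gh.
rewrite expB; [|exact/bmeasZ/bmeasM|exact: bmeasZ].
rewrite expB; [|exact: bmeasZ|exact: bmeas_cst].
rewrite !expZ//; last exact: bmeasM.
rewrite (exp_mul_unit bh.1 h01) EG exp_cst -mulr_natl; ring.
Qed.

End one_variable.

(** Mean of [exp (i Y)]; a real [Y] keeps measurability and bounds scalar. *)
Definition cexpect (Y : Omega -> R) : R[i] :=
  (\int[P]_w cos (Y w)) +i* (\int[P]_w sin (Y w)).

Section many_variables.
Context (dT : measure_display) (T : measurableType dT).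
Variables (n : nat) (X : nat -> Omega -> T).
Hypothesis mX : forall k, measurable_fun setT (X k).
Hypothesis indepX : forall B : nat -> set T, (forall k, measurable (B k)) ->
  P (\big[setI/setT]_(i < n) (X i @^-1` B i)) = (\prod_(i < n) P (X i @^-1` B i))%E.
Variable theta : nat -> T -> R.
Hypothesis mtheta : forall k, measurable_fun setT (theta k).

Let rest (B : nat -> set T) : Omega -> R :=
  \1_(\big[setI/setT]_(i < n) (X i @^-1` B i)).

Let Theta j w := \sum_(k < j) theta k (X k w).

Let mXB k (B : set T) : measurable B -> measurable (X k @^-1` B).
Proof. by move=> mB; rewrite -[_ @^-1` _]setTI; exact: mX. Qed.

Let mcap (B : nat -> set T) : (forall k, measurable (B k)) ->
  measurable (\big[setI/setT]_(i < n) (X i @^-1` B i)).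
Proof.
move=> mB; elim/big_ind: _ => //; first exact: measurableI.
by move=> i _; exact: mXB.
Qed.

Let mTheta j : measurable_fun setT (Theta j).
Proof.
by apply: measurable_sum => k; exact: measurableT_comp (mtheta k) (mX k).
Qed.

(** Indicators of the events of independent variables are replaced by characters
    one variable at a time; [rest] carries the indicators still to be replaced. *)
Lemma cexpect_indep : cexpect (Theta n) = \prod_(k < n) cexpect (theta k \o X k).
Proof.
pose c j : R[i] := \prod_(k < j) cexpect (theta k \o X k).
pose pr (B : nat -> set T) : R := \prod_(i < n) fine (P (X i @^-1` B i)).
suff claim j : (j <= n)%N -> forall B : nat -> set T, (forall k, measurable (B k)) ->
    (forall k, (k < j)%N -> B k = setT) ->
    \int[P]_w (cos (Theta j w) * rest B w) = complex.Re (c j) * pr B /\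
    \int[P]_w (sin (Theta j w) * rest B w) = complex.Im (c j) * pr B.
  have [] := claim n (leqnn n) (fun=> setT) (fun=> measurableT) (fun _ _ => erefl).
  have -> : pr (fun=> setT) = 1.
    rewrite /pr big1// => i _; rewrite preimage_setT.
    exact: (congr1 fine (probability_setT P)).
  have -> : rest (fun=> setT) = cst 1.
    rewrite /rest big1; first by rewrite indicT.
    by move=> i _; rewrite preimage_setT.
  rewrite !mulr1 => eR eI; apply: complex_eq => /=; rewrite -?eR -?eI;
    by apply: eq_Rintegral => w _; rewrite mulr1.
elim: j => [_ B mB _|j IH jn B mB Bj].
  rewrite /c big_ord0 /=.
  have E : fine (P (\big[setI/setT]_(i < n) (X i @^-1` B i))) = pr B.
    suff -> : P (\big[setI/setT]_(i < n) (X i @^-1` B i)) = (pr B)%:E by [].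
    rewrite indepX// /pr.
    apply: (big_ind2 (fun (x : \bar R) (y : R) => x = y%:E)) => //=.
      by move=> x1 x2 y1 y2 -> ->; rewrite EFinM.
    by move=> i _; rewrite fineK//; apply: fin_num_measure; exact: mXB.
  split.
    rewrite mul1r -E -exp_indic; last exact: mcap.
    by apply: eq_Rintegral => w _; rewrite /Theta big_ord0 cos0 mul1r.
  rewrite mul0r -[RHS](exp_cst P); apply: eq_Rintegral => w _.
  by rewrite /Theta big_ord0 sin0 mul0r.
have jn' : (j < n)%N := jn.
pose upd (C : set T) k := if k == j then C else B k.
have mupd C : measurable C -> forall k, measurable (upd C k).
  by move=> mC k; rewrite /upd; case: ifP.
have updj C k : (k < j)%N -> upd C k = setT.
  by move=> kj; rewrite /upd ltn_eqF// Bj// ltnW// ltnS.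
have BjT : B j = setT by apply: Bj.
have restE C w : rest (upd C) w = rest B w * \1_C (X j w).
  rewrite /rest (bigD1 (Ordinal jn'))//= [in RHS](bigD1 (Ordinal jn'))//=.
  rewrite /upd eqxx BjT preimage_setT setTI.
  rewrite (eq_bigr (fun i : 'I_n => X i @^-1` B i)) => [|i ij]; last first.
    by rewrite ifF//; apply: contraNF ij => /eqP ij; apply/eqP/val_inj.
  by rewrite indicI /= mulrC indic_preimage.
have prE C : pr (upd C) = pr B * fine (P (X j @^-1` C)).
  rewrite /pr (bigD1 (Ordinal jn'))//= [in RHS](bigD1 (Ordinal jn'))//=.
  rewrite /upd eqxx BjT preimage_setT.
  rewrite [X in _ = X * _ * _](congr1 fine (probability_setT P)) mul1r mulrC.
  congr (_ * _); apply: eq_bigr => i ij.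
  by rewrite ifF//; apply: contraNF ij => /eqP ij; apply/eqP/val_inj.
have brest : bmeas (rest B) by apply: bmeas_indic; exact: mcap.
have bC : bmeas (fun w => cos (Theta j w) * rest B w).
  by apply: bmeasM => //; exact: bmeas_cos.
have bS : bmeas (fun w => sin (Theta j w) * rest B w).
  by apply: bmeasM => //; exact: bmeas_sin.
have hC (C : set T) : measurable C ->
    \int[P]_w (cos (Theta j w) * rest B w * \1_C (X j w)) =
    (complex.Re (c j) * pr B) * fine (P (X j @^-1` C)).
  move=> mC; have [h _] := IH (ltnW jn) _ (mupd C mC) (updj C).
  rewrite -mulrA -prE -h; apply: eq_Rintegral => w _.
  by rewrite restE mulrA.
have hS (C : set T) : measurable C ->
    \int[P]_w (sin (Theta j w) * rest B w * \1_C (X j w)) =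
    (complex.Im (c j) * pr B) * fine (P (X j @^-1` C)).
  move=> mC; have [_ h] := IH (ltnW jn) _ (mupd C mC) (updj C).
  rewrite -mulrA -prE -h; apply: eq_Rintegral => w _.
  by rewrite restE mulrA.
have bct := bmeas_cos (mtheta j); have bst := bmeas_sin (mtheta j).
have bctX := bmeas_comp (mX j) bct; have bstX := bmeas_comp (mX j) bst.
have CC := exp_mul_bmeas bC (mX j) hC bct.
have CS := exp_mul_bmeas bC (mX j) hC bst.
have SC := exp_mul_bmeas bS (mX j) hS bct.
have SS := exp_mul_bmeas bS (mX j) hS bst.
have ThS w : Theta j.+1 w = Theta j w + theta j (X j w).
  by rewrite /Theta big_ord_recr.
have cS : c j.+1 = c j * cexpect (theta j \o X j) by rewrite /c big_ord_recr.
have -> : (fun w => cos (Theta j.+1 w) * rest B w) = (fun w =>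
    cos (Theta j w) * rest B w * cos (theta j (X j w)) -
    sin (Theta j w) * rest B w * sin (theta j (X j w))).
  by apply/funext => w; rewrite ThS cosD; ring.
have -> : (fun w => sin (Theta j.+1 w) * rest B w) = (fun w =>
    sin (Theta j w) * rest B w * cos (theta j (X j w)) +
    cos (Theta j w) * rest B w * sin (theta j (X j w))).
  by apply/funext => w; rewrite ThS sinD; ring.
rewrite expB; [|exact: bmeasM|exact: bmeasM].
rewrite expD; [|exact: bmeasM|exact: bmeasM].
rewrite CC SS SC CS cS /cexpect /=.
move: (\int[P]_w cos _) (\int[P]_w sin _) => C1 S1.
by case: (c j) => a b /=; split; ring.
Qed.

End many_variables.

End independence.

(** * Characteristic functions of the increments of a Levy process *)

Section roots_of_unity.
Context (R : realType).

(** [1 + z + ... + z ^ (n - 1)] vanishes at the other roots but is close to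
    [n] near one. *)
Lemma unity_root_isolated (z : R[i]) (n : nat) : (0 < n)%N -> z ^+ n = 1 ->
  `|z| <= 1 -> `|z - 1| < n%:R^-1 -> z = 1.
Proof.
move=> n0 zn z1 zd; apply/eqP; rewrite -subr_eq0; apply/negPn/negP => z0.
have n0' : 0 < n%:R :> R[i] by rewrite ltr0n.
have sum0 : \sum_(k < n) z ^+ k = 0.
  by apply: (mulfI z0); rewrite -subrX1 zn subrr mulr0.
have : `|\sum_(k < n) (z ^+ k - 1)| <= \sum_(k < n) (n%:R * `|z - 1|).
  apply: (le_trans (ler_norm_sum _ _ _)); apply: ler_sum => k _.
  rewrite -[1](expr1n _ k) (le_trans (ler_norm_subX k z1 _)) ?normr1// expr1n.
  by apply: ler_wpM2r => //; rewrite ler_nat ltnW.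
rewrite sumrB sum0 sub0r normrN !sumr_const !card_ord normr_nat => h.
have : n%:R * `|z - 1| *+ n < n%:R.
  by rewrite -[ltLHS]mulr_natr -[ltRHS]mul1r ltr_pM2r// -ltr_pdivlMl// mulr1.
by move=> /(le_lt_trans h); rewrite ltxx.
Qed.

(** A continuous path from one would have to cross a region near one that contains
    no other root; by the intermediate value theorem for the real part. *)
Lemma unity_root_constant (q : R -> R[i]) (n : nat) : (0 < n)%N ->
  (forall u, q u ^+ n = 1) -> (forall u, `|q u| = 1) -> q 0 = 1 ->
  continuous (fun u => complex.Re (q u)) -> q 1 = 1.
Proof.
move=> n0 qn q1 q0 cq.
have sq u : complex.Re (q u) ^+ 2 + complex.Im (q u) ^+ 2 = 1.
  have := q1 u; rewrite complex_normE => /(congr1 (fun z : R[i] => complex.Re z)) /= h.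
  by rewrite -[LHS]sqr_sqrtr ?h ?expr1n// addr_ge0// sqr_ge0.
have dist u : `|q u - 1| = (Num.sqrt (2 - 2 * complex.Re (q u)))%:C.
  rewrite complex_normE; congr ((Num.sqrt _)%:C).
  have := sq u; case: (q u) => a b /=; rewrite subr0 => h.
  have -> : (a - 1) ^+ 2 + b ^+ 2 = (a ^+ 2 + b ^+ 2) + 1 - 2 * a by ring.
  by rewrite h; ring.
have Re1 u : complex.Re (q u) = 1 -> q u = 1.
  move=> h; apply: complex_eq => //=; apply/eqP; rewrite -sqrf_eq0; apply/eqP.
  have := sq u; rewrite h expr1n => /(congr1 (fun x => x - 1)).
  by rewrite addrAC subrr add0r.
have Rele u : complex.Re (q u) <= 1.
  have : `|complex.Re (q u)| <= 1 by apply: Re_le_norm; rewrite q1.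
  by rewrite ler_norml => /andP[].
apply: Re1; apply/eqP/negPn/negP => r1.
have {}r1 : complex.Re (q 1) < 1 by rewrite lt_neqAle r1 Rele.
have ni : 0 < n%:R^-1 :> R by rewrite invr_gt0 ltr0n.
(* If the real part is at least [1 - 1 / (4 n^2)], the distance to one, whose
   square is [2 - 2 Re], is less than [1 / n]. *)
pose v := Num.max (complex.Re (q 1)) (1 - n%:R^-1 ^+ 2 / 4).
have v1 : v < 1 by rewrite gt_max r1/= ltrBlDr ltrDl divr_gt0// exprn_gt0.
have vq : complex.Re (q 1) <= v by rewrite le_max lexx.
have [u _ uv] : exists2 u, u \in `[(0 : R), 1] & complex.Re (q u) = v.
  apply: IVT => //; first exact: continuous_subspaceT.
  by rewrite q0 /= min_r ?Rele// max_l ?Rele// vq ltW.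
have qu1 : q u = 1.
  apply: (unity_root_isolated n0 (qn u)); first by rewrite q1.
  rewrite dist uv -(rmorph_nat (real_complex R)) -fmorphV ltcR.
  rewrite -[ltRHS]ger0_norm ?(ltW ni)// -sqrtr_sqr ltr_sqrt ?exprn_gt0//.
  have : 1 - n%:R^-1 ^+ 2 / 4 <= v by rewrite le_max lexx orbT.
  have : 0 < n%:R^-1 ^+ 2 :> R by rewrite exprn_gt0.
  by move: (_ ^+ 2) => y; lra.
by move: uv v1; rewrite qu1 /= => <-; rewrite ltxx.
Qed.

End roots_of_unity.

Section levy.
Context (R : realType) (d : nat) (dO : measure_display)
  (Omega : measurableType dO) (P : probability Omega R).
Local Notation S := (symmx R d).
Variable L : R -> {RV P >-> S}.

Lemma RV_measurable (Y : {RV P >-> S}) : measurable_fun setT Y.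
Proof. exact: measurable_funPT. Qed.

Lemma charfun_distribution (Y : {RV P >-> S}) Z :
  charfun (distribution P Y) Z = cexpect P (fun w => trform (Y w) Z).
Proof.
have mY := RV_measurable Y.
rewrite charfunE /cexpect; congr (_ +i* _).
  by apply: (exp_pushforward mY (bmeas_cos_trform Z)) => B _.
by apply: (exp_pushforward mY (bmeas_sin_trform Z)) => B _.
Qed.

(** Means of [exp (i .)] of these sums are the joint characteristic functions of
    the increments over the partition [a :: s]. *)
Definition increment_phase (a : R) (s : seq R) (W : nat -> S) (w : Omega) : R :=
  \sum_(k < size s) trform (L s`_k w - L (a :: s)`_k w) (W k).

Lemma increment_phase_cons a y s W w : increment_phase a (y :: s) W w =
  trform (L y w - L a w) (W 0%N) + increment_phase y s (fun k => W k.+1) w.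
Proof. by rewrite /increment_phase big_ord_recl. Qed.

Lemma measurable_trform_RV (Y : {RV P >-> S}) Z :
  measurable_fun setT (fun w => trform (Y w) Z).
Proof. by apply: measurable_trform; exact: RV_measurable. Qed.

Lemma measurable_increment_phase a s W :
  measurable_fun setT (increment_phase a s W).
Proof.
apply: measurable_sum => k; apply: measurable_trform.
by apply: measurable_symmxB; exact: RV_measurable.
Qed.

Definition levy_charfun (s : R) (Z : S) : R[i] :=
  cexpect P (fun w => trform (L s w) Z).

Hypothesis Llevy : levy_process L.

Lemma cexpect_ae (Y Y' : Omega -> R) : measurable_fun setT Y ->
  measurable_fun setT Y' -> {ae P, forall w, Y w = Y' w} ->
  cexpect P Y = cexpect P Y'.
Proof.
move=> mY mY' YY'; have [mc _] := bmeas_cos mY; have [mc' _] := bmeas_cos mY'.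
have [ms _] := bmeas_sin mY; have [ms' _] := bmeas_sin mY'.
rewrite /cexpect; congr (_ +i* _); apply: ae_eq_exp => //;
  by apply: ae_sub YY' => w ->.
Qed.

Lemma cexpect_increment (s h : R) Z : 0 <= s -> 0 <= h ->
  cexpect P (fun w => trform (L (s + h) w - L s w) Z) = levy_charfun h Z.
Proof.
move=> s0 h0; have [L0 _ stat _ _] := Llevy.
have mB a b : measurable_fun setT (fun w => L a w - L b w).
  by apply: measurable_symmxB; exact: RV_measurable.
have [Q QE] := law_exists P (mB (s + h) s).
transitivity (cexpect P (fun w => trform (L h w - L 0 w) Z)).
  have E1 (f : S -> R) : bmeas f ->
      \int[P]_w f (L (s + h) w - L s w) = \int[P]_w f (L h w - L 0 w).
    move=> bf; rewrite -(exp_pushforward (mB (s + h) s) bf (fun B _ => QE B)).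
    apply: (exp_pushforward (mB h 0) bf) => B mBB.
    by etransitivity; [exact: QE|exact: stat].
  by rewrite /cexpect (E1 _ (bmeas_cos_trform Z)) (E1 _ (bmeas_sin_trform Z)).
apply: cexpect_ae.
- by apply: measurable_trform; exact: mB.
- exact: measurable_trform_RV.
by apply: ae_sub L0 => w ->; rewrite subr0.
Qed.

Section joint.
Variable Y : {RV P >-> S}.
Hypothesis Yindep : independent_of_process Y L.

(** Independence of increments is stated for strictly increasing sequences of
    times, so a partition is continued by unit steps. *)
Let grid (a : R) (s : seq R) (k : nat) : R :=
  if (k <= size s)%N then (a :: s)`_k else last a s + (k - size s)%:R.

Let grid_lt a s : path <%R a s -> forall k, grid a s k < grid a s k.+1.
Proof.
move=> sP k; rewrite /grid; case: (ltngtP k (size s)) => ks.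
- by move/(pathP 0): sP => /(_ k ks).
- by rewrite ltrD2l ltr_nat subSn// ltnW.
- by rewrite ks subSnn (last_nth 0) ltrDl.
Qed.

Lemma cexpect_increments s V W : path <%R 0 s ->
  cexpect P (fun w => trform (Y w) V + increment_phase 0 s W w) =
  cexpect P (fun w => trform (Y w) V) *
  \prod_(k < size s) levy_charfun (s`_k - (0 :: s)`_k) (W k).
Proof.
move=> sP; have [_ indep _ _ _] := Llevy.
pose t := grid 0 s; have tlt := grid_lt sP.
have t0 : 0 <= t 0%N by [].
have tE k : (k <= size s)%N -> t k = (0 :: s)`_k by rewrite /t /grid => ->.
have tge k : 0 <= t k by elim: k => // k /le_trans; apply; exact: ltW.
have mB k : measurable_fun setT (fun w => L (t k.+1) w - L (t k) w).
  by apply: measurable_symmxB; exact: RV_measurable.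
pose X k : Omega -> S := if k is k'.+1 then (fun w => L (t k'.+1) w - L (t k') w) else Y.
have mX k : measurable_fun setT (X k).
  by case: k => [|k]; [exact: RV_measurable|exact: mB].
pose theta k (H : S) : R := trform H (if k is k'.+1 then W k' else V).
have mtheta k : measurable_fun setT (theta k) by apply: measurable_trform.
have indepX (B : nat -> set S) : (forall k, measurable (B k)) ->
    P (\big[setI/setT]_(i < (size s).+1) (X i @^-1` B i)) =
    (\prod_(i < (size s).+1) P (X i @^-1` B i))%E.
  move=> mBB; rewrite !big_ord_recl -(indep (size s) t (fun k => B k.+1)) //.
  apply: Yindep => //.
  (* Events of the increments belong to the sigma-algebra of the process. *)
  pose G := \bigcup_(u in `[0, +oo[%classic) preimage_set_system setT (L u) measurable.
  pose Om := g_sigma_algebraType G.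
  have mL u : 0 <= u -> measurable_fun (setT : set Om) (L u : Om -> S).
    move=> u0 _ C mC; apply: sub_sigma_algebra; exists u; first by rewrite /= in_itv/= u0.
    by exists C.
  apply: (@bigsetI_measurable _ Om) => i _.
  have mD : measurable_fun (setT : set Om) (fun w : Om => L (t i.+1) w - L (t i) w).
    by apply: measurable_symmxB; apply: mL.
  by rewrite -[X in measurable X](@setTI Om); apply: mD.
have := cexpect_indep mX indepX mtheta; rewrite big_ord_recl => E.
rewrite (_ : (fun w => trform (Y w) V + increment_phase 0 s W w) =
    (fun w => \sum_(k < (size s).+1) theta k (X k w))); last first.
  apply/funext => w; rewrite big_ord_recl; congr (_ + _).
  apply: eq_bigr => k _.
  transitivity (trform (L (t k.+1) w - L (t k) w) (W k)) => //.
  by rewrite (tE k.+1 (ltn_ord k)) (tE k (ltnW (ltn_ord k))).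
rewrite E; congr (_ * _); apply: eq_bigr => k _.
have k1 := tE k.+1 (ltn_ord k); have k0 := tE k (ltnW (ltn_ord k)).
have dt : 0 <= t k.+1 - t k by rewrite subr_ge0 ltW.
have := @cexpect_increment (t k) (t k.+1 - t k) (W k) (tge k) dt.
rewrite [t k + _]addrC subrK k0 [t k.+1]k1 => <-.
by rewrite !lift0 -k1 -k0.
Qed.

End joint.

End levy.

(** ** The Levy exponent *)

Section right_grid.
Context (R : realType).

(** Every point is reached from the right along multiples of [1 / (j + 1)], where
    the paths are right-continuous. *)
Definition right_grid (s : R) (j : nat) : R :=
  (Num.truncn (s * j.+1%:R)).+1%:R * j.+1%:R^-1.

Lemma right_grid_gt s j : 0 <= s -> s < right_grid s j.
Proof.
move=> s0; have sj0 : 0 <= s * j.+1%:R by rewrite mulr_ge0.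
by have /andP[_ ?] := truncn_itv sj0; rewrite /right_grid ltr_pdivlMr.
Qed.

Lemma right_grid_cvg0 s : 0 <= s -> right_grid s @ \oo --> s.
Proof.
move=> s0; have h : (fun j => s + j.+1%:R^-1) @ \oo --> s + 0.
  by apply: cvgD; [exact: cvg_cst|exact: (@cvg_harmonic R)].
rewrite addr0 in h; apply: (squeeze_cvgr _ (@cvg_cst _ s _ \oo _) h).
apply: filterE => j; rewrite (ltW (right_grid_gt j s0))/=.
have sj0 : 0 <= s * j.+1%:R by rewrite mulr_ge0.
have /andP[? _] := truncn_itv sj0.
by rewrite /right_grid -natr1 mulrDl mul1r lerD2r ler_pdivrMr.
Qed.

Lemma right_grid_cvg s : 0 <= s -> right_grid s @ \oo --> s^'+.
Proof.
move=> s0 B /= [e /= e0 eB].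
have [N _ NB] := right_grid_cvg0 s0 (nbhsx_ballx _ _ e0).
by exists N => // j Nj; apply: eB; [exact: NB|exact: right_grid_gt].
Qed.

End right_grid.

Section levy_exponent.
Context (R : realType) (d : nat).
Local Notation S := (symmx R d).

Lemma exp_cvg_ae (dT : measure_display) (T : measurableType dT)
    (P : probability T R) (fn : nat -> T -> R) (f : T -> R) (K : R) :
  (forall n, measurable_fun setT (fn n)) -> measurable_fun setT f ->
  (forall n x, `|fn n x| <= K) ->
  {ae P, forall x, fn n x @[n --> \oo] --> f x} ->
  \int[P]_x fn n x @[n --> \oo] --> \int[P]_x f x.
Proof.
move=> mfn mf fnK fnf.
have [] := @dominated_convergence _ _ _ P setT measurableT
  (fun n => EFin \o fn n) (EFin \o f) (cst K%:E).
- by move=> n; exact/measurable_EFinP.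
- exact/measurable_EFinP.
- apply: ae_sub fnf => x fx _; apply: cvg_comp fx _; exact: cvg_refl.
- exact: (bmeas_integrable P (bmeas_cst _ K)).
- by apply: aeW => x n _; rewrite /= lee_fin.
move=> intf _ cvgI; rewrite /Rintegral.
apply: fine_cvg; rewrite fineK; last exact: integrable_fin_num.
exact: cvgI.
Qed.

Lemma trform_cvg (T : Type) (F : set_system T) {FF : Filter F} (X : T -> S) (X0 Z : S) :
  X @ F --> X0 -> (fun u => trform (X u) Z) @ F --> trform X0 Z.
Proof.
move=> XX0; apply/cvgrPdist_lt => e e0.
pose C := d%:R ^+ 2 * `|Z|.
have C1 : 0 < C + 1 by rewrite ltr_wpDl// mulr_ge0// sqr_ge0.
have near_x : \forall u \near F, ball X0 (e / (C + 1)) (X u).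
  by move/cvg_ballP: XX0 => /(_ _ (divr_gt0 e0 C1)).
apply: filterS near_x => u; rewrite -ball_normE /ball_ /= => h.
rewrite -trformBl; apply: (le_lt_trans (trform_le _ Z)).
apply: (@le_lt_trans _ _ ((C + 1) * `|X0 - X u|)).
  by rewrite ler_wpM2r// lerDl.
by rewrite -ltr_pdivlMl// mulrC.
Qed.

Lemma cvg_cos_sin (T : Type) (F : set_system T) {FF : Filter F} (u : T -> R) (l : R) :
  u @ F --> l -> (fun t => cos (u t)) @ F --> cos l /\ (fun t => sin (u t)) @ F --> sin l.
Proof.
move=> ul; split; first exact: cvg_comp _ _ ul (@continuous_cos R l).
exact: cvg_comp _ _ ul (@continuous_sin R l).
Qed.

Lemma cexpect_cvg (dT : measure_display) (T : measurableType dT)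
    (P : probability T R) (Yn : nat -> T -> R) (Y : T -> R) :
  (forall n, measurable_fun setT (Yn n)) -> measurable_fun setT Y ->
  {ae P, forall x, Yn n x @[n --> \oo] --> Y x} ->
  complex.Re (cexpect P (Yn n)) @[n --> \oo] --> complex.Re (cexpect P Y) /\
  complex.Im (cexpect P (Yn n)) @[n --> \oo] --> complex.Im (cexpect P Y).
Proof.
move=> mYn mY YnY; split; apply: (@exp_cvg_ae _ _ _ _ _ 1).
- by move=> n; have [] := bmeas_cos (mYn n).
- by have [] := bmeas_cos mY.
- by move=> n x; rewrite ler_norml cos_geN1 cos_le1.
- by apply: ae_sub YnY => x /cvg_cos_sin[].
- by move=> n; have [] := bmeas_sin (mYn n).
- by have [] := bmeas_sin mY.
- by move=> n x; rewrite ler_norml sin_geN1 sin_le1.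
- by apply: ae_sub YnY => x /cvg_cos_sin[].
Qed.

(** Bounded convergence; rays suffice to follow a root of unity from the origin. *)
Lemma cexpect_ray_continuous (dT : measure_display) (T : measurableType dT)
    (P : probability T R) (Y : T -> R) : measurable_fun setT Y ->
  continuous (fun u : R => complex.Re (cexpect P (fun x => u * Y x))) /\
  continuous (fun u : R => complex.Im (cexpect P (fun x => u * Y x))).
Proof.
move=> mY; have mu (u : R) : measurable_fun setT (fun x => u * Y x).
  by apply: measurable_funM.
have seq_c (u : R) (un : nat -> R) : un @ \oo --> u ->
    complex.Re (cexpect P (fun x => un n * Y x)) @[n --> \oo] -->
      complex.Re (cexpect P (fun x => u * Y x)) /\
    complex.Im (cexpect P (fun x => un n * Y x)) @[n --> \oo] -->
      complex.Im (cexpect P (fun x => u * Y x)).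
  move=> unu; apply: cexpect_cvg => //.
  by apply: aeW => x; apply: cvgM unu (@cvg_cst _ _ _ _ _).
by split=> u; apply/continuous_withinNx; apply/cvgr_dnbhsP => un [_ /seq_c[]].
Qed.

Lemma cexpect_cst0 (dT : measure_display) (T : measurableType dT)
    (P : probability T R) : cexpect P (cst 0) = 1.
Proof. by rewrite /cexpect /= cos0 sin0 !exp_cst. Qed.

Section exponent.
Context (dO : measure_display) (Omega : measurableType dO) (P : probability Omega R).
Variables (L : R -> {RV P >-> S}) (eta : S -> R[i]).
Hypothesis Llevy : levy_process L.
Hypothesis eta0 : eta 0 = 0.
Hypothesis eta_roots : forall s, 0 < s -> exists rho : probability S R,
  forall Z, charfun rho Z = cexp (rscale s (eta Z)).
Hypothesis L1_charfun : forall Z, levy_charfun L 1 Z = cexp (eta Z).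

Local Notation phi := (levy_charfun L).

Let zeroRV : {RV P >-> S} := cst 0.

Lemma independent_zeroRV : independent_of_process zeroRV L.
Proof.
move=> B E mB mE; case: (pselect (B 0)) => B0.
  rewrite (_ : zeroRV @^-1` B = setT).
    by rewrite setTI [X in (X * _)%E]probability_setT mul1e.
  by apply/seteqP; split.
rewrite (_ : zeroRV @^-1` B = set0); first by rewrite set0I measure0 mul0e.
by apply/seteqP; split.
Qed.

Lemma levy_charfun_incr s W : path <%R 0 s ->
  cexpect P (increment_phase L 0 s W) =
  \prod_(k < size s) phi (s`_k - (0 :: s)`_k) (W k).
Proof.
move=> sP; have := cexpect_increments Llevy independent_zeroRV 0 W sP.
rewrite (_ : cexpect P (fun w => trform (zeroRV w) 0) = 1) ?mul1r => [<-|].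
  by congr cexpect; apply/funext => w; rewrite trform0r add0r.
rewrite (_ : (fun w => _) = cst 0); first exact: cexpect_cst0.
by apply/funext => w; rewrite trform0r.
Qed.

Lemma levy_charfunM s h Z : 0 < s -> 0 < h -> phi (s + h) Z = phi s Z * phi h Z.
Proof.
move=> s0 h0; have [L0 _ _ _ _] := Llevy.
have := @levy_charfun_incr [:: s; s + h] (fun=> Z).
rewrite /= s0 ltrDl h0 => /(_ isT).
rewrite !big_ord_recl big_ord0 mulr1 /= subr0 [s + h - s]addrAC subrr add0r => <-.
apply: cexpect_ae.
- exact: measurable_trform_RV.
- exact: measurable_increment_phase.
apply: ae_sub L0 => w L0w.
rewrite /increment_phase !big_ord_recl big_ord0 addr0 /= -trformDl L0w subr0.
by rewrite addrCA subrr addr0.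
Qed.

Lemma levy_charfunMn s n Z : 0 < s -> phi (n.+1%:R * s) Z = phi s Z ^+ n.+1.
Proof.
move=> s0; elim: n => [|n IH]; first by rewrite mul1r expr1.
by rewrite -natr1 mulrDl mul1r levy_charfunM ?mulr_gt0// IH -exprSr.
Qed.

(** Both sides have the same [n + 1]-st power, so their quotient is a root of
    unity; it equals one at the origin and is continuous along the ray to [Z]. *)
Lemma levy_charfun_inv n Z : phi n.+1%:R^-1 Z = cexp (rscale n.+1%:R^-1 (eta Z)).
Proof.
have ni : 0 < n.+1%:R^-1 :> R by rewrite invr_gt0.
have nn0 : n.+1%:R != 0 :> R by rewrite pnatr_eq0.
have [rho rhoE] := eta_roots ni.
pose q (u : R) := phi n.+1%:R^-1 (u *: Z) / charfun rho (u *: Z).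
have rho0 u : charfun rho (u *: Z) != 0 by rewrite rhoE cexp_neq0.
have qn u : q u ^+ n.+1 = 1.
  rewrite expr_div_n -levy_charfunMn// divff// L1_charfun rhoE -cexpM_natl.
  by rewrite -rscale_natl rscaleA divff// rscale1 divff// cexp_neq0.
have q1 u : `|q u| = 1.
  apply/eqP; rewrite -(@pexpr_eq1 _ _ n.+1)// -normrX qn.
  by rewrite normr1.
have q0 : q 0 = 1.
  rewrite /q scale0r rhoE eta0 /rscale /= !mulr0 cexp0 divr1 /levy_charfun.
  rewrite (_ : (fun w => _) = cst 0); first exact: cexpect_cst0.
  by apply/funext => w; rewrite trform0r.
have mL : measurable_fun setT (fun w => trform (L n.+1%:R^-1 w) Z).
  exact: measurable_trform_RV.
have mX : measurable_fun setT (fun X : S => trform X Z) by apply: measurable_trform.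
have [cLR cLI] := cexpect_ray_continuous P mL.
have [crR crI] := cexpect_ray_continuous rho mX.
have cq : continuous (fun u => complex.Re (q u)).
  pose N (u : R) := complex.Re (charfun rho (u *: Z)) ^+ 2 +
    complex.Im (charfun rho (u *: Z)) ^+ 2.
  have eL u : phi n.+1%:R^-1 (u *: Z) = cexpect P (fun w => u * trform (L n.+1%:R^-1 w) Z).
    by congr cexpect; apply/funext => w; rewrite trformZr.
  have er u : charfun rho (u *: Z) = cexpect rho (fun X => u * trform X Z).
    rewrite charfunE /cexpect; congr (_ +i* _);
      by apply: eq_Rintegral => X _; rewrite trformZr.
  have N0 u : N u != 0.
    have := rho0 u; apply: contraNneq; rewrite /N => /eqP.
    rewrite paddr_eq0 ?sqr_ge0// !sqrf_eq0 => /andP[/eqP a /eqP b].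
    by apply/eqP; apply: complex_eq.
  have qE : (fun u => complex.Re (q u)) = (fun u =>
      (complex.Re (phi n.+1%:R^-1 (u *: Z)) * complex.Re (charfun rho (u *: Z)) +
       complex.Im (phi n.+1%:R^-1 (u *: Z)) * complex.Im (charfun rho (u *: Z))) / N u).
    apply/funext => u; rewrite /q /N.
    by case: (phi _ _) (charfun _ _) => a b [a' b'] /=; rewrite mulrDl; ring.
  rewrite qE => u.
  have aL : (fun u : R => complex.Re (phi n.+1%:R^-1 (u *: Z))) @ u -->
      complex.Re (phi n.+1%:R^-1 (u *: Z)).
    by under eq_fun do rewrite eL; rewrite eL; exact: cLR.
  have bL : (fun u : R => complex.Im (phi n.+1%:R^-1 (u *: Z))) @ u -->
      complex.Im (phi n.+1%:R^-1 (u *: Z)).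
    by under eq_fun do rewrite eL; rewrite eL; exact: cLI.
  have ar : (fun u : R => complex.Re (charfun rho (u *: Z))) @ u -->
      complex.Re (charfun rho (u *: Z)).
    by under eq_fun do rewrite er; rewrite er; exact: crR.
  have br : (fun u : R => complex.Im (charfun rho (u *: Z))) @ u -->
      complex.Im (charfun rho (u *: Z)).
    by under eq_fun do rewrite er; rewrite er; exact: crI.
  apply: cvgM; first by apply: cvgD; exact: cvgM.
  by apply: cvgV => //; apply: cvgD; exact: cvgM.
have := unity_root_constant (ltn0Sn n) qn q1 q0 cq.
rewrite /q scale1r => /(congr1 (fun z => z * charfun rho Z)).
by rewrite divfK -?rhoE ?mul1r// -[Z]scale1r.
Qed.

(** Rational times first, then right-continuity of the paths. *)
Theorem levy_charfunE s Z : 0 <= s -> phi s Z = cexp (rscale s (eta Z)).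
Proof.
move=> s0; have [_ _ _ _ cadl] := Llevy.
have phij j : phi (right_grid s j) Z = cexp (rscale (right_grid s j) (eta Z)).
  rewrite /right_grid levy_charfunMn ?invr_gt0// levy_charfun_inv -cexpM_natl -rscale_natl.
  by rewrite rscaleA.
have [cR cI] : complex.Re (phi (right_grid s j) Z) @[j --> \oo] --> complex.Re (phi s Z) /\
    complex.Im (phi (right_grid s j) Z) @[j --> \oo] --> complex.Im (phi s Z).
  apply: cexpect_cvg.
  - by move=> j; exact: measurable_trform_RV.
  - exact: measurable_trform_RV.
  apply: ae_sub cadl => w /(_ s s0)[rc _].
  apply: trform_cvg; exact: cvg_comp _ _ (right_grid_cvg s0) rc.
have cvg_scale (a : R) : right_grid s j * a @[j --> \oo] --> s * a.
  by apply: cvgM; [exact: right_grid_cvg0|exact: cvg_cst].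
have [eR eI] := @cexp_cvg _ _ \oo _ (fun j => rscale (right_grid s j) (eta Z)) (rscale s (eta Z))
  (cvg_scale _) (cvg_scale _).
have cR' : complex.Re (cexp (rscale (right_grid s j) (eta Z))) @[j --> \oo] -->
    complex.Re (phi s Z) by move: cR; under eq_fun do rewrite phij.
have cI' : complex.Im (cexp (rscale (right_grid s j) (eta Z))) @[j --> \oo] -->
    complex.Im (phi s Z) by move: cI; under eq_fun do rewrite phij.
apply: complex_eq.
  exact: (cvg_unique (@Rhausdorff R) cR' eR).
exact: (cvg_unique (@Rhausdorff R) cI' eI).
Qed.

End exponent.

End levy_exponent.

(** * Ornstein-Uhlenbeck integrals along the paths *)

Lemma ae_both (R : realType) (dT : measure_display) (T : measurableType dT)
    (P : probability T R) (B C : T -> Prop) : {ae P, forall x, B x} ->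
  {ae P, forall x, C x} -> {ae P, forall x, B x /\ C x}.
Proof. by move=> Bae Cae; apply: filterI. Qed.

Section ou_paths.
Context (R : realType) (d : nat) (dO : measure_display)
  (Omega : measurableType dO) (P : probability Omega R).
Local Notation S := (symmx R d).
Variables (A : 'M[R]_d) (L : R -> {RV P >-> S}).

Lemma quadform_cvg (T : Type) (F : set_system T) {FF : Filter F} v (X : T -> S) (X0 : S) :
  X @ F --> X0 -> (fun u => quadform v (X u)) @ F --> quadform v X0.
Proof.
move=> XX0; apply/cvgrPdist_lt => e e0.
pose C := \sum_i \sum_j `|v i 0| * `|v j 0|.
have C0 : 0 <= C by apply: sumr_ge0 => i _; apply: sumr_ge0 => j _; rewrite mulr_ge0.
have C1 : 0 < C + 1 by rewrite ltr_wpDl.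
have near_x : \forall u \near F, ball X0 (e / (C + 1)) (X u).
  by move/cvg_ballP: XX0 => /(_ _ (divr_gt0 e0 C1)).
apply: filterS near_x => u; rewrite -ball_normE /ball_ /= => h.
have -> : quadform v X0 - quadform v (X u) = quadform v (X0 - X u).
  by rewrite -quadformN -quadformD.
apply: (le_lt_trans (quadform_le v _)).
apply: (@le_lt_trans _ _ ((C + 1) * `|X0 - X u|)).
  by rewrite ler_wpM2r// lerDl.
by rewrite -ltr_pdivlMl// mulrC.
Qed.

Definition increasing_path (X : R -> S) :=
  (forall t, 0 <= t -> X @ t^'+ --> X t) /\
  forall s t, 0 <= s -> s <= t -> psd_cone (X t - X s).

(** Almost surely the increments over the points of all grids of step
    [1 / (j + 1)] lie in the closed cone; right-continuity does the rest. *)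
Lemma subordinator_paths : matrix_subordinator L ->
  {ae P, forall w, increasing_path (fun t => L t w)}.
Proof.
move=> [[L0 _ _ _ cadl] mono].
have grid : {ae P, forall w, forall k l j : nat, (k <= l)%N ->
    psd_cone (L (l.+1%:R * j.+1%:R^-1) w - L (k.+1%:R * j.+1%:R^-1) w)}.
  apply/ae_foralln => k; apply/ae_foralln => l; apply/ae_foralln => j.
  have [|lk] := leqP k l; last by apply: aeW => w.
  rewrite leq_eqVlt => /orP[/eqP->|kl].
    by apply: aeW => w _; rewrite subrr; exact: psd_cone0.
  have := mono (k.+1%:R * j.+1%:R^-1) (l.+1%:R * j.+1%:R^-1).
  have ji : 0 < j.+1%:R^-1 :> R by rewrite invr_gt0.
  rewrite mulr_ge0 ?(ltW ji)// ltr_pM2r// ltr_nat ltnS kl => /(_ isT isT).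
  by apply: ae_sub => w + _.
have both := ae_both grid cadl.
apply: ae_sub both => w [gridw cw]; split=> [t t0|s t s0 st].
  by have [] := cw t t0.
have t0 := le_trans s0 st.
move=> v; rewrite -/(quadform v _).
have -> : quadform v (L t w - L s w) = quadform v (L t w) - quadform v (L s w).
  by rewrite -quadformN -quadformD.
have lim u : 0 <= u -> (fun j => quadform v (L (right_grid u j) w)) @ \oo --> quadform v (L u w).
  by move=> u0; apply: quadform_cvg; exact: cvg_comp _ _ (right_grid_cvg u0) (cw u u0).1.
have H := @cvgB _ _ _ \oo eventually_filter _ _ _ _ (lim t t0) (lim s s0).
apply: (ler_cvg_to (@cvg_cst _ (0 : R) _ \oo _) H).
apply: filterE => j; rewrite fctE.
have -> : quadform v (L (right_grid t j) w) - quadform v (L (right_grid s j) w) =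
    quadform v (L (right_grid t j) w - L (right_grid s j) w).
  by rewrite -quadformN -quadformD.
apply: gridw; apply: le_truncn.
by rewrite ler_wpM2r.
Qed.

Lemma ou_stieltjes_cvg w (t : R) : 0 <= t -> increasing_path (fun s => L s w) ->
  (fun p : seq R * (nat -> R) =>
    stieltjes_sum (ou_kernel A t) (fun s => L s w) 0 p.1 p.2) @ mesh_filter 0 t -->
  stieltjes_integral (ou_kernel A t) (fun s => L s w) 0 t.
Proof.
move=> t0 [rc mono].
have [I IP] : exists I, is_stieltjes_integral (ou_kernel A t) (fun s => L s w) 0 t I.
  apply: cone_stieltjes_integral => //.
    by move=> s u s0 su _; exact: mono.
  by move=> s /andP[s0 _]; exact: rc.
apply/is_stieltjes_integralP; rewrite /stieltjes_integral.
by case: xgetP => [I' _ //|/(_ I)]; case.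
Qed.

Lemma mesh_seq a b (p : nat -> seq R * (nat -> R)) :
  (forall n, tagged_partition a b n.+1%:R^-1 (p n)) -> p @ \oo --> mesh_filter a b.
Proof.
move=> pP B [del d0 dB]; have h := @near_infty_natSinv_lt _ (PosNum d0).
apply: filterS h => n /= nd; apply: dB; have [? tag] := pP n; split=> // k ks.
by have [? /lt_trans h] := tag k ks; split=> //; exact: h.
Qed.

Lemma mesh_seq_exists a b : a <= b -> exists p : nat -> seq R * (nat -> R),
  forall n, tagged_partition a b n.+1%:R^-1 (p n).
Proof.
move=> ab; suff h n : {p | tagged_partition a b n.+1%:R^-1 p}.
  by exists (fun n => sval (h n)) => n; exact: (svalP (h n)).
apply: cid; have FP := mesh_filter_proper ab.
have : mesh_filter a b (tagged_partition a b n.+1%:R^-1).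
  by exists n.+1%:R^-1; rewrite ?invr_gt0.
exact: filter_ex.
Qed.

Lemma increment_phaseE t V p w : increment_phase L 0 p.1 (fun k => dual_flow A (t - p.2 k) V) w =
  \tr (stieltjes_sum (ou_kernel A t) (fun s => L s w) 0 p.1 p.2 *m V).
Proof.
rewrite /increment_phase /stieltjes_sum mulmx_suml raddf_sum; apply: eq_bigr => k _ /=.
by rewrite -trform_flow /trform ou_kernelE.
Qed.

(** [trform] of the integral against [V] is a limit of increment phases with
    weights on the dual flow of [V]. *)
Lemma ou_phase_cvg w (t : R) (Sig0 : {RV P >-> S}) (X : S) V p : 0 <= t ->
  increasing_path (fun s => L s w) ->
  X = ou_value A L Sig0 t w :> 'M[R]_d ->
  (forall n, tagged_partition 0 t n.+1%:R^-1 (p n)) ->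
  increment_phase L 0 (p n).1 (fun k => dual_flow A (t - (p n).2 k) V) w @[n --> \oo] -->
    trform X V - trform (Sig0 w) (dual_flow A t V).
Proof.
move=> t0 inc XE pP.
have IC := cvg_comp _ _ (mesh_seq pP) (ou_stieltjes_cvg t0 inc).
set I := stieltjes_integral _ _ _ _ in IC.
have -> : trform X V - trform (Sig0 w) (dual_flow A t V) = \tr (I *m V).
  rewrite -trform_flow /trform XE /ou_value mexp_tr -/(mxflow A t) mulmxDl mxtraceD.
  by rewrite addrAC subrr add0r.
have ent i j : (fun n => (stieltjes_sum (ou_kernel A t) (fun s => L s w) 0 (p n).1 (p n).2) i j)
    @ \oo --> I i j.
  apply/cvgrPdist_lt => e e0.
  have := IC => /cvgrPdist_lt /(_ e e0); apply: filterS => n /= h.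
  apply: le_lt_trans h; apply: le_trans (mx_entry_le _ i j).
  by rewrite !mxE.
rewrite (_ : (fun n => _) = fun n => \sum_i \sum_j
  (stieltjes_sum (ou_kernel A t) (fun s => L s w) 0 (p n).1 (p n).2) i j * V j i); last first.
  by apply/funext => n; rewrite increment_phaseE; apply: eq_bigr => i _; rewrite mxE.
rewrite (_ : \tr _ = \sum_i \sum_j I i j * V j i); last first.
  by apply: eq_bigr => i _; rewrite mxE.
apply: cvg_sum_seq => i; apply: cvg_sum_seq => j.
by apply: cvgM; [exact: ent|exact: cvg_cst].
Qed.

Lemma increment_phase_cat a q s W w : increment_phase L a (q ++ s) W w =
  increment_phase L a q W w + increment_phase L (last a q) s (fun k => W (k + size q)%N) w.
Proof.
elim: q a W => [|y q IH] a W /=.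
  rewrite [X in _ = X + _]/increment_phase big_ord0 add0r.
  by congr increment_phase; apply/funext => k; rewrite addn0.
rewrite !increment_phase_cons IH addrA; congr (_ + increment_phase _ _ _ _ _).
by apply/funext => k; rewrite addnS.
Qed.

Lemma increment_phase_ext a s W W' w : (forall k, (k < size s)%N -> W k = W' k) ->
  increment_phase L a s W w = increment_phase L a s W' w.
Proof. by move=> WW'; apply: eq_bigr => k _; rewrite WW'. Qed.

Definition cat_tagged (q p : seq R * (nat -> R)) : seq R * (nat -> R) :=
  (q.1 ++ p.1, fun k => if (k < size q.1)%N then q.2 k else p.2 (k - size q.1)%N).

Lemma cat_tagged_partition a b c del q p : tagged_partition a b del q ->
  tagged_partition b c del p -> tagged_partition a c del (cat_tagged q p).
Proof.
move=> [qP tq] [pP tp]; split; first exact: itv_partition_cat qP pP.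
have lq : last a q.1 = b by have [_ /eqP] := qP.
move=> k /=; rewrite size_cat => ks; rewrite nth_cat -cat_cons nth_cat /=.
case: (ltnP k (size q.1)) => kq; first by rewrite ltnS (ltnW kq); exact: tq.
have := tp (k - size q.1)%N; rewrite ltn_subLR// => /(_ ks).
rewrite ltnS; case: ltngtP kq => // kq _; last first.
  have <- : (a :: q.1)`_(size q.1) = b by rewrite -lq (last_nth 0).
  by rewrite -kq subnn.
by rewrite -(subnSK kq).
Qed.

(** The value at [t] is the value at [u] transported by the flow plus the integral
    over [[u, t]]; concatenating tagged partitions shows it for Riemann sums. *)
Lemma ou_window_cvg w (u t : R) (Sig0 : {RV P >-> S}) (Xu Xt : S) V p :
  0 <= u -> u <= t -> increasing_path (fun s => L s w) ->
  Xu = ou_value A L Sig0 u w :> 'M[R]_d -> Xt = ou_value A L Sig0 t w :> 'M[R]_d ->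
  (forall n, tagged_partition u t n.+1%:R^-1 (p n)) ->
  increment_phase L u (p n).1 (fun k => dual_flow A (t - (p n).2 k) V) w @[n --> \oo] -->
    trform Xt V - trform Xu (dual_flow A (t - u) V).
Proof.
move=> u0 ut inc XuE XtE pP; have t0 := le_trans u0 ut.
have [q qP] := mesh_seq_exists u0.
have qpP n := cat_tagged_partition (qP n) (pP n).
have ct := @ou_phase_cvg w t Sig0 Xt V _ t0 inc XtE qpP.
have cu := @ou_phase_cvg w u Sig0 Xu (dual_flow A (t - u) V) _ u0 inc XuE qP.
have := @cvgB _ _ _ \oo eventually_filter _ _ _ _ ct cu.
have -> : trform Xt V - trform (Sig0 w) (dual_flow A t V) -
    (trform Xu (dual_flow A (t - u) V) - trform (Sig0 w) (dual_flow A u (dual_flow A (t - u) V))) =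
    trform Xt V - trform Xu (dual_flow A (t - u) V).
  have -> : dual_flow A u (dual_flow A (t - u) V) = dual_flow A t V.
    by rewrite -(dual_flowD A (t - u) u V) subrK.
  by rewrite opprB addrA subrK.
rewrite [X in X @ _ --> _](_ : _ = fun n => increment_phase L u (p n).1
  (fun k => dual_flow A (t - (p n).2 k) V) w)//.
apply/funext => n; rewrite !fctE /= increment_phase_cat.
have -> : last 0 (q n).1 = u by have [[_ /eqP]] := qP n.
rewrite addrAC (@increment_phase_ext _ _ _
  (fun k => dual_flow A (u - (q n).2 k) (dual_flow A (t - u) V))); last first.
  move=> k kq; rewrite /= kq -(dual_flowD A (t - u) _ V).
  by rewrite (addrA (t - u)) subrK.
rewrite subrr add0r; apply: increment_phase_ext => k ks.
by rewrite ltnNge leq_addl /= addnK.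
Qed.

End ou_paths.

(** * Stationarity *)

Section polar_limit.
Context (R : realType).

(** The limit is identified from two families of approximations, one with the
    right modulus and one with the right argument. *)
Lemma polar_limit (K G : R[i]) (x y : R) (xn thn : nat -> R) :
  complex.Re (K * cexp (x +i* thn n)) @[n --> \oo] --> complex.Re G ->
  complex.Im (K * cexp (x +i* thn n)) @[n --> \oo] --> complex.Im G ->
  complex.Re (K * cexp (xn n +i* y)) @[n --> \oo] --> complex.Re G ->
  complex.Im (K * cexp (xn n +i* y)) @[n --> \oo] --> complex.Im G ->
  G = K * cexp (x +i* y).
Proof.
pose N (z : R[i]) := complex.Re z ^+ 2 + complex.Im z ^+ 2.
have NM z w : N (z * w) = N z * N w.
  by rewrite /N; case: z w => a b [a' b'] /=; ring.
have Nexp a b : N (cexp (a +i* b)) = expR a ^+ 2.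
  by rewrite /N /cexp /= !exprMn -mulrDr cos2Dsin2 mulr1.
have Ncvg (u : nat -> R[i]) : complex.Re (u n) @[n --> \oo] --> complex.Re G ->
    complex.Im (u n) @[n --> \oo] --> complex.Im G -> N (u n) @[n --> \oo] --> N G.
  move=> uR uI; rewrite /N.
  by apply: cvgD; rewrite !expr2; exact: cvgM.
move=> c1 c2 c3 c4; have NG : N G = N K * expR x ^+ 2.
  apply: (cvg_unique (@Rhausdorff R) (Ncvg _ c1 c2)).
  rewrite (_ : (fun n => _) = cst (N K * expR x ^+ 2)); first exact: cvg_cst.
  by apply/funext => n; rewrite NM Nexp.
have N_eq0 z : N z = 0 -> z = 0.
  move=> /eqP; rewrite paddr_eq0 ?sqr_ge0// !sqrf_eq0 => /andP[/eqP a /eqP b].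
  exact: complex_eq.
have [K0|K0] := eqVneq (N K) 0.
  by rewrite (N_eq0 K K0) mul0r; apply: N_eq0; rewrite NG K0 mul0r.
have ex : expR (xn n) @[n --> \oo] --> expR x.
  have h : (expR (xn n) ^+ 2) @[n --> \oo] --> expR x ^+ 2.
    have -> : expR x ^+ 2 = N G * (N K)^-1 by rewrite NG mulrAC divff// mul1r.
    rewrite (_ : (fun n => expR (xn n) ^+ 2) = (fun n => N (K * cexp (xn n +i* y)) * (N K)^-1)).
      by apply: cvgM; [exact: Ncvg|exact: cvg_cst].
    by apply/funext => n; rewrite NM Nexp mulrAC divff// mul1r.
  have := cvg_comp _ _ h (@sqrt_continuous R _).
  rewrite sqrtr_sqr (ger0_norm (expR_ge0 _)); apply: cvg_trans.
  rewrite (_ : (fun n => expR (xn n)) = (fun n => Num.sqrt (expR (xn n) ^+ 2))).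
    exact: cvg_refl.
  by apply/funext => n; rewrite sqrtr_sqr (ger0_norm (expR_ge0 _)).
pose K' : R[i] := K * (cos y +i* sin y).
have E a : K * cexp (a +i* y) = (expR a * complex.Re K') +i* (expR a * complex.Im K').
  by rewrite /K' /cexp; apply: complex_eq; case: K {NG K0 K' c1 c2 c3 c4} => a' b' /=; ring.
rewrite E; apply: complex_eq => /=.
  apply: (cvg_unique (@Rhausdorff R) c3).
  rewrite (_ : (fun n => _) = fun n => expR (xn n) * complex.Re K').
    by apply: cvgM => //; exact: cvg_cst.
  by apply/funext => n; rewrite E.
apply: (cvg_unique (@Rhausdorff R) c4).
rewrite (_ : (fun n => _) = fun n => expR (xn n) * complex.Im K').
  by apply: cvgM => //; exact: cvg_cst.
by apply/funext => n; rewrite E.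
Qed.

(** On each interval the mean value theorem provides the tag. *)
Lemma exact_tags (f f' : R -> R) (a b : R) (s : seq R) :
  (forall x, is_derive x (1 : R) f (f' x)) -> itv_partition a b s ->
  exists xi : nat -> R,
    (forall k, (k < size s)%N -> (a :: s)`_k <= xi k <= s`_k) /\
    \sum_(k < size s) (s`_k - (a :: s)`_k) * f' (xi k) = f b - f a.
Proof.
move=> df; elim: s a => [|y s IH] a sP.
  rewrite (itv_partition_nil sP); exists (fun=> 0); split=> //.
  by rewrite big_ord0 subrr.
have ay : a <= y by have [/=/andP[/ltW]] := sP.
have [xi [xiP xiE]] := IH y (itv_partition_cons sP).
have [c cay cE] := mean_value ay df.
exists (fun k => if k is k'.+1 then xi k' else c); split.
  by case=> [_|k ks] /=; [|exact: xiP].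
by rewrite big_ord_recl /= xiE mulrC -cE; ring.
Qed.

End polar_limit.

Section stationarity.
Context (R : realType) (d : nat) (dO : measure_display)
  (Omega : measurableType dO) (P : probability Omega R).
Local Notation S := (symmx R d).
Variables (A : 'M[R]_d) (L : R -> {RV P >-> S}) (psi : S -> R[i]).
Local Notation eta := (psi_L A psi).
Hypothesis Lsub : matrix_subordinator L.
Hypothesis psi_diff : forall Z : S, Z != 0 -> cdifferentiable psi Z.
Hypothesis L_charfun : forall s Z, 0 <= s -> levy_charfun L s Z = cexp (rscale s (eta Z)).
Variable Sigma0 : {RV P >-> S}.
Hypothesis Sigma0_charfun : forall Z, cexpect P (fun w => trform (Sigma0 w) Z) = cexp (psi Z).
Hypothesis Sigma0_indep : independent_of_process Sigma0 L.
Variable Sigma : R -> {RV P >-> S}.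
Hypothesis SigmaE : ou_process A L Sigma0 Sigma.

(** Exponent of the joint characteristic function of the increments over [a :: s]. *)
Definition exponent_sum (a : R) (s : seq R) (W : nat -> S) : R[i] :=
  \sum_(k < size s) rscale (s`_k - (a :: s)`_k) (eta (W k)).

(** [exp (i Y)] has mean [c] and is uncorrelated with the characters of the
    increments of [L] after time [u]; this is the only trace of independence of
    the past that the induction over time needs. *)
Definition splits (u : R) (Y : Omega -> R) (c : R[i]) :=
  forall s W, path <%R u s ->
    cexpect P (fun w => Y w + increment_phase L u s W w) = c * cexp (exponent_sum u s W).

Lemma exponent_sum_cat a q s W : exponent_sum a (q ++ s) W =
  exponent_sum a q W + exponent_sum (last a q) s (fun k => W (k + size q)%N).
Proof.
elim: q a W => [|y q IH] a W /=.
  rewrite [X in _ = X + _]/exponent_sum big_ord0 add0r.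
  by congr exponent_sum; apply/funext => k; rewrite addn0.
have cons a' y' s' W' : exponent_sum a' (y' :: s') W' =
    rscale (y' - a') (eta (W' 0%N)) + exponent_sum y' s' (fun k => W' k.+1).
  by rewrite /exponent_sum big_ord_recl.
rewrite !cons IH addrA; congr (_ + exponent_sum _ _ _).
by apply/funext => k; rewrite addnS.
Qed.

Lemma exponent_sum_ext a s W W' : (forall k, (k < size s)%N -> W k = W' k) ->
  exponent_sum a s W = exponent_sum a s W'.
Proof. by move=> WW'; apply: eq_bigr => k _; rewrite WW'. Qed.

Lemma cexp_sum n (F : nat -> R[i]) :
  \prod_(k < n) cexp (F k) = cexp (\sum_(k < n) F k).
Proof.
elim: n => [|n IH]; first by rewrite !big_ord0 cexp0.
by rewrite !big_ord_recr /= IH cexpD.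
Qed.

Lemma splits_initial V : splits 0 (fun w => trform (Sigma0 w) V) (cexp (psi V)).
Proof.
move=> s W sP; have [Llevy _] := Lsub.
rewrite (cexpect_increments Llevy Sigma0_indep) // Sigma0_charfun; congr (_ * _).
rewrite /exponent_sum -(cexp_sum (size s)
  (fun k => rscale (s`_k - (0 :: s)`_k) (eta (W k)))).
apply: eq_bigr => k _; rewrite L_charfun// subr_ge0.
by have /(pathP 0) /(_ k (ltn_ord k)) /ltW := sP.
Qed.

Lemma ou_window_ae (u t : R) V (p : nat -> seq R * (nat -> R)) : 0 <= u -> u <= t ->
  (forall n, tagged_partition u t n.+1%:R^-1 (p n)) ->
  {ae P, forall w,
    increment_phase L u (p n).1 (fun k => dual_flow A (t - (p n).2 k) V) w @[n --> \oo] -->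
      trform (Sigma t w) V - trform (Sigma u w) (dual_flow A (t - u) V)}.
Proof.
move=> u0 ut pP; have t0 := le_trans u0 ut.
have all := ae_both (subordinator_paths Lsub) (ae_both (SigmaE u0) (SigmaE t0)).
apply: ae_sub all => w [inc [su st]].
exact: (@ou_window_cvg _ _ _ _ _ A L w u t Sigma0).
Qed.

Lemma Sigma_initial : {ae P, forall w, forall V, trform (Sigma 0 w) V = trform (Sigma0 w) V}.
Proof.
have all := ae_both (subordinator_paths Lsub) (SigmaE (lexx 0)).
apply: ae_sub all => w [inc s0] V.
have pP n : tagged_partition 0 0 n.+1%:R^-1 ([::], fun=> 0 : R) by split=> //; split=> /=.
have := @ou_phase_cvg _ _ _ _ _ A L w 0 Sigma0 (Sigma 0 w) V _ (lexx 0) inc s0 pP.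
rewrite dual_flow0 (_ : (fun n => _) = cst 0); last first.
  by apply/funext => n; rewrite /increment_phase big_ord0.
move=> h; apply/eqP; rewrite -subr_eq0; apply/eqP.
by apply: (cvg_unique (@Rhausdorff R) h); exact: cvg_cst.
Qed.

Lemma measurable_phase (Y : Omega -> R) u s W : measurable_fun setT Y ->
  measurable_fun setT (fun w => Y w + increment_phase L u s W w).
Proof. by move=> mY; apply: measurable_funD => //; exact: measurable_increment_phase. Qed.

(** One step of the chain: the state at [t] is the image of the state at [u]
    under the flow plus a limit of sums of increments between [u] and [t]. The
    Riemann sums of [psi_L] along the dual flow need not converge, as [psi_L] is only
    known to be a derivative there, but tags can be chosen so that their real,
    or their imaginary, parts are exact. *)
Lemma splits_step (u t : R) (Y0 : Omega -> R) V c : 0 <= u -> u <= t ->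
  measurable_fun setT Y0 ->
  splits u (fun w => Y0 w + trform (Sigma u w) (dual_flow A (t - u) V)) c ->
  splits t (fun w => Y0 w + trform (Sigma t w) V)
    (c * cexp (psi V - psi (dual_flow A (t - u) V))).
Proof.
move=> u0 ut mY0 split_u s W sP.
set Z := dual_flow A (t - u) V; set D := psi V - psi Z.
set G := cexpect P _; pose B := cexp (exponent_sum t s W).
have mYu : measurable_fun setT (fun w => Y0 w + trform (Sigma u w) Z).
  by apply: measurable_funD => //; exact: measurable_trform_RV.
have mYt : measurable_fun setT (fun w => Y0 w + trform (Sigma t w) V).
  by apply: measurable_funD => //; exact: measurable_trform_RV.
(* Bounded convergence along any partitions of vanishing mesh: the increments on
   [[u, t]] are appended to those after [t] and integrated out by [split_u]. *)
have limG (p : nat -> seq R * (nat -> R)) :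
    (forall n, tagged_partition u t n.+1%:R^-1 (p n)) ->
    let An n := exponent_sum u (p n).1 (fun k => dual_flow A (t - (p n).2 k) V) in
    complex.Re (c * B * cexp (An n)) @[n --> \oo] --> complex.Re G /\
    complex.Im (c * B * cexp (An n)) @[n --> \oo] --> complex.Im G.
  move=> pP An.
  pose Wn n k := if (k < size (p n).1)%N then dual_flow A (t - (p n).2 k) V
    else W (k - size (p n).1)%N.
  pose Yn n w := Y0 w + trform (Sigma u w) Z +
    increment_phase L u ((p n).1 ++ s) (Wn n) w.
  have lastp n : last u (p n).1 = t by have [[_ /eqP]] := pP n.
  have tailW n : (fun k => Wn n (k + size (p n).1)%N) = W.
    by apply/funext => k; rewrite /Wn ltnNge leq_addl /= addnK.
  have YnE n : cexpect P (Yn n) = c * B * cexp (An n).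
    rewrite split_u; last by rewrite cat_path lastp sP andbT; have [[]] := pP n.
    rewrite exponent_sum_cat lastp tailW cexpD /B.
    rewrite (@exponent_sum_ext _ _ _ (fun k => dual_flow A (t - (p n).2 k) V)); last first.
      by move=> k kp; rewrite /Wn kp.
    by rewrite -mulrA [cexp (An n) * _]mulrC mulrA.
  have [cR cI] : complex.Re (cexpect P (Yn n)) @[n --> \oo] --> complex.Re G /\
      complex.Im (cexpect P (Yn n)) @[n --> \oo] --> complex.Im G.
    apply: cexpect_cvg.
    - by move=> n; exact: measurable_phase.
    - exact: measurable_phase.
    apply: ae_sub (@ou_window_ae u t V p u0 ut pP) => w h.
    have -> : Y0 w + trform (Sigma t w) V + increment_phase L t s W w =
        Y0 w + trform (Sigma u w) Z + increment_phase L t s W w +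
        (trform (Sigma t w) V - trform (Sigma u w) Z) by ring.
    rewrite (_ : (fun n => _) = fun n =>
      Y0 w + trform (Sigma u w) Z + increment_phase L t s W w +
      increment_phase L u (p n).1 (fun k => dual_flow A (t - (p n).2 k) V) w).
      by apply: cvgD h; exact: cvg_cst.
    apply/funext => n; rewrite /Yn increment_phase_cat lastp tailW.
    rewrite (@increment_phase_ext _ _ _ _ _ _ _ _ _ (fun k => dual_flow A (t - (p n).2 k) V)).
      by ring.
    by move=> k kp; rewrite /Wn kp.
  by split; under eq_fun do rewrite -YnE.
have [p pP] := mesh_seq_exists ut.
(* The partitions stay, the tags become exact for a given derivative. *)
have retag (f f' : R -> R) : (forall x, is_derive x (1 : R) f (f' x)) ->
    {p' : nat -> seq R * (nat -> R) |
      (forall n, tagged_partition u t n.+1%:R^-1 (p' n)) /\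
      forall n, \sum_(k < size (p' n).1) ((p' n).1`_k - (u :: (p' n).1)`_k) * f' ((p' n).2 k) =
        f t - f u}.
  move=> df; apply: cid.
  have h n : {xi : nat -> R | (forall k, (k < size (p n).1)%N ->
      (u :: (p n).1)`_k <= xi k <= (p n).1`_k) /\
      \sum_(k < size (p n).1) ((p n).1`_k - (u :: (p n).1)`_k) * f' (xi k) = f t - f u}.
    by apply: cid; apply: exact_tags => //; have [] := pP n.
  exists (fun n => ((p n).1, sval (h n))); split=> n; last exact: (svalP (h n)).2.
  have [pn tag] := pP n; split=> //= k ks; split; first exact: (svalP (h n)).1.
  by have [] := tag k ks.
have dflow (x : R) := is_derive_psi_flow A psi_diff V (t - x).
have dtx (x : R) : is_derive x (1 : R) (fun y => t - y) (-1).
  have := @is_deriveB _ _ _ (cst t) (@id R) x 1 0 1 (is_derive_cst t x 1) (is_derive_id x 1).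
  by rewrite sub0r.
have dR x : is_derive x (1 : R) (fun y => complex.Re (psi (dual_flow A (t - y) V)))
    (complex.Re (eta (dual_flow A (t - x) V))).
  have := @is_derive1_comp _ (fun v => complex.Re (psi (dual_flow A v V)))
    (fun y => t - y) x _ _ (dflow x).1 (dtx x).
  by move=> /is_derive_eq; apply; rewrite mulrNN mulr1.
have dI x : is_derive x (1 : R) (fun y => complex.Im (psi (dual_flow A (t - y) V)))
    (complex.Im (eta (dual_flow A (t - x) V))).
  have := @is_derive1_comp _ (fun v => complex.Im (psi (dual_flow A v V)))
    (fun y => t - y) x _ _ (dflow x).2 (dtx x).
  by move=> /is_derive_eq; apply; rewrite mulrNN mulr1.
have ReS (I : Type) (r : seq I) (F : I -> R[i]) :
    complex.Re (\sum_(i <- r) F i) = \sum_(i <- r) complex.Re (F i).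
  by elim: r => [|i r IH]; rewrite ?big_nil// !big_cons Re_add IH.
have ImS (I : Type) (r : seq I) (F : I -> R[i]) :
    complex.Im (\sum_(i <- r) F i) = \sum_(i <- r) complex.Im (F i).
  by elim: r => [|i r IH]; rewrite ?big_nil// !big_cons Im_add IH.
have [p1 [p1P p1E]] := retag _ _ dR; have [p2 [p2P p2E]] := retag _ _ dI.
have [c1 c2] := limG p1 p1P; have [c3 c4] := limG p2 p2P.
rewrite subrr dual_flow0 -/Z in p1E p2E.
have DR : complex.Re D = complex.Re (psi V) - complex.Re (psi Z).
  by rewrite /D; case: (psi V) (psi Z) => ? ? [].
have DI : complex.Im D = complex.Im (psi V) - complex.Im (psi Z).
  by rewrite /D; case: (psi V) (psi Z) => ? ? [].
pose A1 n := exponent_sum u (p1 n).1 (fun k => dual_flow A (t - (p1 n).2 k) V).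
pose A2 n := exponent_sum u (p2 n).1 (fun k => dual_flow A (t - (p2 n).2 k) V).
have A1E n : A1 n = complex.Re D +i* complex.Im (A1 n).
  by apply: complex_eq => //=; rewrite DR -(p1E n) /A1 ReS.
have A2E n : A2 n = complex.Re (A2 n) +i* complex.Im D.
  by apply: complex_eq => //=; rewrite DI -(p2E n) /A2 ImS.
have extf (f : R[i] -> R) (g h : nat -> R[i]) : (forall n, g n = h n) ->
    (fun n => f (c * B * cexp (g n))) = (fun n => f (c * B * cexp (h n))).
  by move=> gh; apply/funext => n; rewrite gh.
have DE : D = complex.Re D +i* complex.Im D by case: D {DR DI A1E A2E}.
rewrite -mulrA [cexp D * _]mulrC mulrA -/B DE.
apply: (@polar_limit _ _ _ _ _ (fun n => complex.Re (A2 n)) (fun n => complex.Im (A1 n))).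
- by rewrite -(extf _ _ _ A1E).
- by rewrite -(extf _ _ _ A1E).
- by rewrite -(extf _ _ _ A2E).
- by rewrite -(extf _ _ _ A2E).
Qed.

Lemma splits_ae u Y Y' c : measurable_fun setT Y -> measurable_fun setT Y' ->
  {ae P, forall w, Y w = Y' w} -> splits u Y c -> splits u Y' c.
Proof.
move=> mY mY' YY' sY s W sP; rewrite -(sY s W sP).
apply: cexpect_ae; [exact: measurable_phase|exact: measurable_phase|].
by apply: ae_sub YY' => w ->.
Qed.

(** At time zero the phase has mean [exp (psi (dual_flow A t V))], and one step
    replaces the argument by [V]: the law of the state does not depend on time. *)
Lemma splits_one t V : 0 <= t -> splits t (fun w => trform (Sigma t w) V) (cexp (psi V)).
Proof.
move=> t0; have base : splits 0 (fun w => 0 + trform (Sigma 0 w) (dual_flow A (t - 0) V))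
    (cexp (psi (dual_flow A t V))).
  apply: splits_ae (splits_initial _).
  - exact: measurable_trform_RV.
  - by apply: measurable_funD => //; exact: measurable_trform_RV.
  by apply: ae_sub Sigma_initial => w h; rewrite add0r h subr0.
have m0 : measurable_fun setT (fun _ : Omega => (0 : R)) by exact: measurable_cst.
have := splits_step (lexx 0) t0 m0 base.
rewrite subr0 -cexpD [X in cexp X]addrC subrK => h s W sP.
by rewrite -h//; congr cexpect; apply/funext => w; rewrite add0r.
Qed.

Definition state_phase (l : seq (R * S)) (h : R) (w : Omega) : R :=
  \sum_(p <- l) trform (Sigma (h + p.1) w) p.2.

(** The latest time comes first in the list; a step back to the next time merges
    its argument with that of the next state. Only differences of times enter
    [c], which therefore does not depend on the shift [h]. *)
Lemma state_phase_splits (l : seq (R * S)) p :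
  (forall q, q \in p :: l -> 0 <= q.1) ->
  path (fun q r : R * S => r.1 <= q.1) p l ->
  exists c, forall h, 0 <= h -> splits (h + p.1) (state_phase (p :: l) h) c.
Proof.
elim: l p => [|q l IH] p pos sorted_l.
  exists (cexp (psi p.2)) => h h0.
  have hp : 0 <= h + p.1 by rewrite addr_ge0// pos ?mem_head.
  move=> s W sP; rewrite -(splits_one p.2 hp)//; congr cexpect; apply/funext => w.
  by rewrite /state_phase big_seq1.
move: sorted_l => /= /andP[qp sl].
pose q' : R * S := (q.1, q.2 + dual_flow A (p.1 - q.1) p.2).
have [||c cP] := IH q'.
- move=> r; rewrite inE => /orP[/eqP->|rl]; first by apply: (pos q); rewrite !inE eqxx orbT.
  by apply: pos; rewrite !inE rl !orbT.
- by case: (l) sl.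
exists (c * cexp (psi p.2 - psi (dual_flow A (p.1 - q.1) p.2))) => h h0.
pose Y0 w := trform (Sigma (h + q.1) w) q.2 + \sum_(r <- l) trform (Sigma (h + r.1) w) r.2.
have mY0 : measurable_fun setT Y0.
  apply: measurable_funD; first exact: measurable_trform_RV.
  by apply: measurable_sum => r; exact: measurable_trform_RV.
have q0 : 0 <= h + q.1 by rewrite addr_ge0// pos// !inE eqxx orbT.
have hqp : h + q.1 <= h + p.1 by rewrite lerD2l.
have gap : h + p.1 - (h + q.1) = p.1 - q.1 by ring.
have base : splits (h + q.1)
    (fun w => Y0 w + trform (Sigma (h + q.1) w) (dual_flow A (h + p.1 - (h + q.1)) p.2)) c.
  move=> s W sP; rewrite -(cP h h0 s W sP); congr cexpect; apply/funext => w.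
  by rewrite /state_phase big_cons /= trformDr gap /Y0; ring.
have := splits_step q0 hqp mY0 base; rewrite gap => H s W sP.
rewrite -H//; congr cexpect; apply/funext => w.
by rewrite /state_phase !big_cons /Y0; ring.
Qed.

(** Sorting the times makes state_phase_splits applicable, and its constant does
    not depend on the shift. *)
Lemma state_phase_shift (l : seq (R * S)) h : (forall q, q \in l -> 0 <= q.1) -> 0 <= h ->
  cexpect P (state_phase l h) = cexpect P (state_phase l 0).
Proof.
move=> pos h0; pose ge (q r : R * S) := r.1 <= q.1.
have perm h' : state_phase (sort ge l) h' = state_phase l h'.
  apply/funext => w; rewrite /state_phase; apply: perm_big.
  by rewrite perm_sort.
rewrite -!perm; have tot : total ge by move=> q r; rewrite /ge; exact: le_total.
have := sort_sorted tot l.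
have {}pos : forall q, q \in sort ge l -> 0 <= q.1 by move=> q; rewrite mem_sort; exact: pos.
case: (sort ge l) pos => [|p l'] pos sl.
  by congr cexpect; apply/funext => w; rewrite /state_phase !big_nil.
have [c cP] := state_phase_splits pos sl.
have E h' : 0 <= h' -> cexpect P (state_phase (p :: l') h') = c.
  move=> h'0; have := cP h' h'0 [::] (fun=> 0) isT.
  rewrite /exponent_sum big_ord0 cexp0 mulr1 => <-; congr cexpect.
  by apply/funext => w; rewrite /increment_phase big_ord0 addr0.
by rewrite !E.
Qed.

(** Both tuples have the same characteristic function. *)
Lemma Sigma_stationary : stationary_process Sigma.
Proof.
move=> n t h C t0 h0 mC.
have mT (h' : R) : measurable_fun setT
    (fun w => [tuple Sigma (tnth t i + h') w | i < n] : n.-tuple S).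
  have [_ gen] := @coordinates_tuple_symmx R d n; apply: gen => k.
  rewrite [X in measurable_fun _ X](_ : _ = fun w => Sigma (tnth t k.1 + h') w k.2.1 k.2.2).
    exact: (measurableT_comp (measurable_entry k.2.1 k.2.2) (RV_measurable _)).
  by apply/funext => w /=; rewrite tnth_mktuple.
have [Q QE] := law_exists P (mT h); have [Q0 Q0E] := law_exists P (mT 0).
transitivity (Q C); first by rewrite QE.
transitivity (Q0 C); last first.
  rewrite Q0E; congr (P _).
  have tE w : [tuple Sigma (tnth t i + 0) w | i < n] = [tuple Sigma (tnth t i) w | i < n].
    by apply: eq_from_tnth => i; rewrite !tnth_mktuple addr0.
  by apply/seteqP; split=> w /=; rewrite tE.
have phaseE (th : 'I_n * ('I_d * 'I_d) -> R) (x : n.-tuple S) :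
    \sum_k th k * tnth x k.1 k.2.1 k.2.2 =
    \sum_i trform (tnth x i) (symmetric_part (fun a b => th (i, (a, b)))).
  under [RHS]eq_bigr do rewrite trform_symmetric_part pair_big.
  by rewrite pair_big; apply: eq_bigr => -[i [a b]] _.
(* A linear form of the coordinates of the tuple is a phase of the states. *)
pose l (th : 'I_n * ('I_d * 'I_d) -> R) : seq (R * S) :=
  [seq (tnth t i, symmetric_part (fun a b => th (i, (a, b)))) | i <- index_enum 'I_n].
have stateE th h' w : \sum_k th k *
    tnth [tuple Sigma (tnth t i + h') w | i < n] k.1 k.2.1 k.2.2 = state_phase (l th) h' w.
  rewrite phaseE /state_phase big_map; apply: eq_bigr => i _.
  by rewrite tnth_mktuple addrC.
have lpos th q : q \in l th -> 0 <= q.1 by move=> /mapP[i _ ->]; exact: t0.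
have mphase th : measurable_fun setT
    (fun x : n.-tuple S => \sum_k th k * tnth x k.1 k.2.1 k.2.2).
  have [mcoord _] := @coordinates_tuple_symmx R d n.
  by apply: measurable_sum => k; apply: measurable_funM => //; exact: mcoord.
have shift th := state_phase_shift (lpos th) h0.
apply: (eq_charfun_eq_measure (@coordinates_tuple_symmx R d n)) => // th.
- have bc := bmeas_cos (mphase th).
  rewrite (exp_pushforward (mT h) bc (fun B _ => QE B)).
  rewrite (exp_pushforward (mT 0) bc (fun B _ => Q0E B)).
  have := congr1 (fun z : R[i] => complex.Re z) (shift th); rewrite /cexpect /=.
  by move=> E; under eq_Rintegral do rewrite stateE; rewrite E;
    apply: eq_Rintegral => w _; rewrite stateE.
- have bs := bmeas_sin (mphase th).
  rewrite (exp_pushforward (mT h) bs (fun B _ => QE B)).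
  rewrite (exp_pushforward (mT 0) bs (fun B _ => Q0E B)).
  have := congr1 (fun z : R[i] => complex.Im z) (shift th); rewrite /cexpect /=.
  by move=> E; under eq_Rintegral do rewrite stateE; rewrite E;
    apply: eq_Rintegral => w _; rewrite stateE.
Qed.

Lemma Sigma_law (mu : probability S R) t : 0 <= t ->
  (forall Z, charfun mu Z = cexp (psi Z)) -> has_law (Sigma t) mu.
Proof.
move=> t0 mu_c; apply: charfun_inj => Z.
rewrite charfun_distribution mu_c.
have := splits_one Z t0 (s := [::]) (fun=> 0) isT.
rewrite /exponent_sum big_ord0 cexp0 mulr1 => <-; congr cexpect.
by apply/funext => w; rewrite /increment_phase big_ord0 addr0.
Qed.

End stationarity.

(** * Existence of the process *)

Section ou_existence.
Context (R : realType) (d : nat) (dO : measure_display)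
  (Omega : measurableType dO) (P : probability Omega R).
Local Notation S := (symmx R d).
Variables (A : 'M[R]_d) (L : R -> {RV P >-> S}).
Hypothesis Lsub : matrix_subordinator L.

Lemma symmx_sum n (F : 'I_n -> S) i j : (\sum_k F k) i j = \sum_k F k i j.
Proof.
elim: n F => [|n IH] F; first by rewrite !big_ord0 /= mxE.
by rewrite !big_ord_recr symmxD IH.
Qed.

(** The value at time [t] is an almost sure limit of Riemann sums, which are
    measurable; off an event of probability one the limit is set to zero. *)
Lemma ou_value_RV (Sigma0 : {RV P >-> S}) t : 0 <= t ->
  exists X : {RV P >-> S}, {ae P, forall w, X w = ou_value A L Sigma0 t w :> 'M[R]_d}.
Proof.
move=> t0; have [p pP] := mesh_seq_exists t0.
have [N [mN PN0 NP]] := subordinator_paths Lsub.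
have good w : ~ N w -> increasing_path (fun s => L s w).
  by move=> nN; apply: contrapT => h; apply: nN; exact: NP.
pose X_ n w : S := congruence (mxflow A t) (Sigma0 w) +
  \sum_(k < size (p n).1) congruence (mxflow A (t - (p n).2 k))
    (L (p n).1`_k w - L (0 :: (p n).1)`_k w).
have mX_ n : measurable_fun setT (X_ n).
  apply: measurable_symmxD; first by apply: measurable_congruence; exact: RV_measurable.
  elim: (size (p n).1) => [|m IH].
    by under eq_fun do rewrite big_ord0; exact: measurable_cst.
  under eq_fun do rewrite big_ord_recr /=; apply: measurable_symmxD => //.
  by apply: measurable_congruence; apply: measurable_symmxB; exact: RV_measurable.
have X_E n w : X_ n w = mexp (t *: A) *m Sigma0 w *m mexp (t *: A^T)
    + stieltjes_sum (ou_kernel A t) (fun s => L s w) 0 (p n).1 (p n).2 :> 'M[R]_d.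
  apply/matrixP => i j; rewrite mexp_tr /X_ symmxD [RHS]mxE; congr (_ + _).
  rewrite symmx_sum summxE; apply: eq_bigr => k _.
  by rewrite ou_kernelE.
have X_cvg w i j : ~ N w -> X_ n w i j @[n --> \oo] --> ou_value A L Sigma0 t w i j.
  move=> /good inc; have IC := cvg_comp _ _ (mesh_seq pP)
    (@ou_stieltjes_cvg _ _ _ _ _ A L w t t0 inc).
  rewrite (_ : (fun n => X_ n w i j) = fun n => (mexp (t *: A) *m Sigma0 w *m mexp (t *: A^T)) i j
    + stieltjes_sum (ou_kernel A t) (fun s => L s w) 0 (p n).1 (p n).2 i j).
    rewrite (_ : ou_value A L Sigma0 t w i j =
      (mexp (t *: A) *m Sigma0 w *m mexp (t *: A^T)) i j +
      stieltjes_integral (ou_kernel A t) (fun s => L s w) 0 t i j); last first.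
      by rewrite /ou_value [LHS]mxE.
    apply: cvgD; first exact: cvg_cst.
    exact: (cvg_comp _ _ IC (@coord_continuous _ _ _ i j _)).
  by apply/funext => n; rewrite X_E [LHS]mxE.
pose g i j w : R := if w \in N then 0 else ou_value A L Sigma0 t w i j.
have mg i j : measurable_fun setT (g i j).
  apply: (@measurable_fun_cvg _ _ _ setT (fun n w => X_ n w i j * \1_(~` N) w)).
    move=> n; apply: measurable_funM; last exact: measurable_indic (measurableC mN).
    exact: (measurableT_comp (measurable_entry i j)).
  move=> w _; rewrite /g indicE in_setC; case: ifPn => /= [_|wN].
    by under eq_fun do rewrite mulr0; exact: cvg_cst.
  under eq_fun do rewrite mulr1.
  by apply: X_cvg => Nw; move: wN; rewrite notin_setE.
pose X w : S := symmetrize (fun i j => g i j w).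
have mX : measurable_fun setT X.
  by apply: measurable_symmx => i j; under eq_fun do rewrite symmetrizeE; exact: mg.
pose XV : {RV P >-> S} := HB.pack X (isMeasurableFun.Build _ _ _ _ X mX).
exists XV; exists N; split=> // w /= XE; apply: contrapT => wN; apply: XE.
apply/matrixP => i j; rewrite /X symmetrizeE.
have gE a b : g a b w = ou_value A L Sigma0 t w a b by rewrite /g ifF//; exact: memNset.
rewrite gE; case: (leP i j) => // _.
apply: (cvg_unique (@Rhausdorff R) (X_cvg w j i wN)).
rewrite (_ : (fun n => _) = fun n => X_ n w i j); first exact: X_cvg.
by apply/funext => n; exact: symmxC.
Qed.

Lemma ou_process_exists (Sigma0 : {RV P >-> S}) :
  exists Sigma : R -> {RV P >-> S}, ou_process A L Sigma0 Sigma.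
Proof.
have h t : {X : {RV P >-> S} | 0 <= t ->
    {ae P, forall w, X w = ou_value A L Sigma0 t w :> 'M[R]_d}}.
  apply: cid; have [/ou_value_RV h|_] := leP 0 t; last by exists Sigma0.
  by have [X XE] := h Sigma0; exists X.
by exists (fun t => sval (h t)) => t; exact: (svalP (h t)).
Qed.

End ou_existence.

(** * The stationary distribution *)

Theorem theorem4p9 (R : realType) (d : nat) (d_gt0 : (0 < d)%N)
    (bA : {linear symmx R d -> symmx R d}) (A : 'M[R]_d)
    (spectrum_A : forall z : R[i],
       eigenvalue (map_mx (real_complex R) A) z -> complex.Re z < 0)
    (bAE : forall X : symmx R d, bA X = A *m X + X *m A^T :> 'M[R]_d)
    (mu : probability (symmx R d) R)
    (mu_psd : mu (psd_cone) = 1%E)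
    (mu_osd : operator_selfdecomposable bA mu)
    (gamma : symmx R d) (gamma_psd : psd_cone gamma)
    (nu : {measure set (symmx R d) -> \bar R})
    (nu_levy : levy_measure nu)
    (nu_psd : nu (~` psd_cone) = 0%E)
    (nu_fv : (\int[nu]_(X in [set X | (`|X| <= 1)%R]) `|X|%:E < +oo)%E)
    (mu_charfun : forall Z : symmx R d,
       charfun mu Z = cexp (subordinator_exponent gamma nu Z))
    (psi : symmx R d -> R[i]) (psi_cumulant : cumulant_transform mu psi)
    (drift_psd : psd_cone (neg_lyapunov A gamma))
    (psi_diff : forall Z : symmx R d, Z != 0 -> cdifferentiable psi Z)
    (psi_L_cont : ccontinuous_at (psi_L A psi) 0) :
  (exists mu_L : probability (symmx R d) R,
     [/\ mu_L (psd_cone) = 1%E,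
         infinitely_divisible mu_L
       & forall Z : symmx R d, charfun mu_L Z = cexp (psi_L A psi Z)]) /\
  (forall (dO : measure_display) (Omega : measurableType dO)
     (P : probability Omega R) (L : R -> {RV P >-> symmx R d}),
     matrix_subordinator L ->
     (forall Z : symmx R d,
        charfun (distribution P (L 1)) Z = cexp (psi_L A psi Z)) ->
     ou_stationary_distribution A L mu).
Proof.
have law := driving_law bAE mu_osd nu_levy nu_psd nu_fv mu_charfun psi_cumulant drift_psd
  psi_diff psi_L_cont.
split.
  exact: (driving_law_exists bAE mu_osd nu_levy nu_psd nu_fv mu_charfun psi_cumulant
    drift_psd psi_diff psi_L_cont).
move=> dO Omega P L Lsub L1 Sigma0 Sigma0_law Sigma0_indep.
have [psi_cont psi0 psiE] := psi_cumulant.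
have eta0 : psi_L A psi 0 = 0 by rewrite /psi_L eqxx.
have eta_roots s : 0 < s -> exists rho : probability (symmx R d) R,
    forall Z, charfun rho Z = cexp (rscale s (psi_L A psi Z)).
  by move=> /law[rho [_ rhoE]]; exists rho.
have L1_charfun Z : levy_charfun L 1 Z = cexp (psi_L A psi Z).
  by rewrite -L1 charfun_distribution.
have L_charfun s Z := @levy_charfunE _ _ _ _ _ L _ Lsub.1 eta0 eta_roots L1_charfun s Z.
have Sigma0_charfun Z : cexpect P (fun w => trform (Sigma0 w) Z) = cexp (psi Z).
  have E f : bmeas f -> \int[mu]_x f x = \int[distribution P Sigma0]_x f x.
    move=> bf; apply: (@exp_pushforward _ _ _ _ _ (distribution P Sigma0) mu id) => //.
    by move=> B mB; exact: esym (Sigma0_law B mB).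
  by rewrite psiE -charfun_distribution !charfunE !E//;
    [exact: bmeas_sin_trform|exact: bmeas_cos_trform].
split; first exact: ou_process_exists.
move=> Sigma SigmaE; split.
  exact: (Sigma_stationary Lsub psi_diff L_charfun Sigma0_charfun Sigma0_indep SigmaE).
move=> t t0; apply: (Sigma_law Lsub psi_diff L_charfun Sigma0_charfun Sigma0_indep SigmaE t0).
by move=> Z; rewrite psiE.
Qed.
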